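(* With $e_i^c,\gamma_i,\varepsilon_i$ ($i=1,2$) the natural ones on $\mathcal V_1$ and with $$e_0^c:=\overline\sigma^{-1}\circ\overline e_0^c\circ\overline\sigma,\qquad \gamma_0:=\overline\gamma_0\circ\overline\sigma,\qquad \varepsilon_0:=\overline\varepsilon_0\circ\overline\sigma,$$ the quadruple $\chi=(\mathcal V_1,\{e_i\}_{i\in I},\{\gamma_i\}_{i\in I},\{\varepsilon_i\}_{i\in I})$, $I=\{0,1,2\}$, is a positive affine geometric crystal of type $D_4^{(3)}$: it is a $\mathfrak g$-geometric crystal, and $\theta:(\mathbb C^\times)^6\to\mathcal V_1$, $x\mapsto V_1(x)$, is a positive structure on it. Its explicit form is as follows. First, $$e_1^c(V_1(x))=V_1(x_0,\mathcal C_1x_1,x_2,\mathcal C_3x_3,x_4,\mathcal C_5x_5),\qquad e_2^c(V_1(x))=V_1(x_0,x_1,\mathcal C_2x_2,x_3,\mathcal C_4x_4,x_5),$$ where $$\mathcal C_1=\frac{\frac{cx_0}{x_1}+\frac{x_0x_2}{x_1^2x_3}+\frac{x_0x_2x_4}{x_1^2x_3^2x_5}}{\frac{x_0}{x_1}+\frac{x_0x_2}{x_1^2x_3}+\frac{x_0x_2x_4}{x_1^2x_3^2x_5}},\quad \mathcal C_3=\frac{\frac{cx_0}{x_1}+\frac{cx_0x_2}{x_1^2x_3}+\frac{x_0x_2x_4}{x_1^2x_3^2x_5}}{\frac{cx_0}{x_1}+\frac{x_0x_2}{x_1^2x_3}+\frac{x_0x_2x_4}{x_1^2x_3^2x_5}},$$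 $$\mathcal C_5=\frac{c\left(\frac{x_0}{x_1}+\frac{x_0x_2}{x_1^2x_3}+\frac{x_0x_2x_4}{x_1^2x_3^2x_5}\right)}{\frac{cx_0}{x_1}+\frac{cx_0x_2}{x_1^2x_3}+\frac{x_0x_2x_4}{x_1^2x_3^2x_5}},\quad \mathcal C_2=\frac{\frac{cx_1^3}{x_2}+\frac{x_1^3x_3^3}{x_2^2x_4}}{\frac{x_1^3}{x_2}+\frac{x_1^3x_3^3}{x_2^2x_4}},\quad \mathcal C_4=\frac{c\left(\frac{x_1^3}{x_2}+\frac{x_1^3x_3^3}{x_2^2x_4}\right)}{\frac{cx_1^3}{x_2}+\frac{x_1^3x_3^3}{x_2^2x_4}},$$ $$\varepsilon_1(V_1(x))=\frac{x_0}{x_1}+\frac{x_0x_2}{x_1^2x_3}+\frac{x_0x_2x_4}{x_1^2x_3^2x_5},\qquad \varepsilon_2(V_1(x))=\frac{x_1^3}{x_2}+\frac{x_1^3x_3^3}{x_2^2x_4},$$ $$\gamma_1(V_1(x))=\frac{x_1^2x_3^2x_5^2}{x_0x_2x_4},\qquad \gamma_2(V_1(x))=\frac{x_2^2x_4^2}{x_1^3x_3^3x_5^3}.$$ Moreover $$e_0^c(V_1(x))=V_1\left(\frac{D}{cE}x_0,\ \frac{F}{cE}x_1,\ \frac{G}{c^3E^3}x_2,\ \frac{DH}{c^2EF}x_3,\ \frac{D^3}{c^3G}x_4,\ \frac{D}{cH}x_5\right),$$ $$\varepsilon_0(V_1(x))=\frac{E}{x_0^3x_2x_3},\qquad \gamma_0(V_1(x))=\frac{x_0^2}{x_1x_3x_5},$$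 where \begin{align*} D={}&c^2x_0^2x_2x_3+x_1x_2x_3^2x_5+cx_0\big(x_1x_3^3+x_2(x_3^2+x_1x_4+x_1x_3x_5)\big),\\ E={}&x_0^2x_2x_3+x_1x_2x_3^2x_5+x_0\big(x_1x_3^3+x_2(x_3^2+x_1x_4+x_1x_3x_5)\big),\\ F={}&x_2x_3^2(x_0+x_1x_5)+cx_0\big(x_0x_2x_3+x_1(x_3^3+x_2x_4+x_2x_3x_5)\big),\\ H={}&cx_0^2x_2x_3+x_0x_2x_3^2+x_0x_1x_3^3+x_0x_1x_2x_4+cx_0x_1x_2x_3x_5+x_1x_2x_3^2x_5,\\ G={}&c^3x_0^6x_2^3x_3^3+3c^2x_0^5x_2^3x_3^4+3c^2x_0^5x_1x_2^2x_3^5+3cx_0^4x_2^3x_3^5\\ &+6cx_0^4x_1x_2^2x_3^6+x_0^3x_2^3x_3^6+3cx_0^4x_1^2x_2x_3^7+3x_0^3x_1x_2^2x_3^7\\ &+3x_0^3x_1^2x_2x_3^8+x_0^3x_1^3x_3^9+3c^3x_0^5x_1x_2^3x_3^2x_4+6c^2x_0^4x_1x_2^3x_3^3x_4\\ &+3cx_0^4x_1^2x_2^2x_3^4x_4+3c^3x_0^4x_1^2x_2^2x_3^4x_4+3cx_0^3x_1x_2^3x_3^4x_4\\ &+3x_0^3x_1^2x_2^2x_3^5x_4+3c^2x_0^3x_1^2x_2^2x_3^5x_4+2x_0^3x_1^3x_2x_3^6x_4\\ &+c^3x_0^3x_1^3x_2x_3^6x_4+3c^3x_0^4x_1^2x_2^3x_3x_4^2+3c^2x_0^3x_1^2x_2^3x_3^2x_4^2\\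 &+x_0^3x_1^3x_2^2x_3^3x_4^2+2c^3x_0^3x_1^3x_2^2x_3^3x_4^2+c^3x_0^3x_1^3x_2^3x_4^3\\ &+3c^3x_0^5x_1x_2^3x_3^3x_5+9c^2x_0^4x_1x_2^3x_3^4x_5+6c^2x_0^4x_1^2x_2^2x_3^5x_5\\ &+9cx_0^3x_1x_2^3x_3^5x_5+12cx_0^3x_1^2x_2^2x_3^6x_5+3x_0^2x_1x_2^3x_3^6x_5\\ &+3cx_0^3x_1^3x_2x_3^7x_5+6x_0^2x_1^2x_2^2x_3^7x_5+3x_0^2x_1^3x_2x_3^8x_5\\ &+6c^3x_0^4x_1^2x_2^3x_3^2x_4x_5+12c^2x_0^3x_1^2x_2^3x_3^3x_4x_5+3cx_0^3x_1^3x_2^2x_3^4x_4x_5\\ &+3c^3x_0^3x_1^3x_2^2x_3^4x_4x_5+6cx_0^2x_1^2x_2^3x_3^4x_4x_5+3x_0^2x_1^3x_2^2x_3^5x_4x_5\\ &+3c^2x_0^2x_1^3x_2^2x_3^5x_4x_5+3c^3x_0^3x_1^3x_2^3x_3x_4^2x_5+3c^2x_0^2x_1^3x_2^3x_3^2x_4^2x_5\\ &+3c^3x_0^4x_1^2x_2^3x_3^3x_5^2+9c^2x_0^3x_1^2x_2^3x_3^4x_5^2+3c^2x_0^3x_1^3x_2^2x_3^5x_5^2\\ &+9cx_0^2x_1^2x_2^3x_3^5x_5^2+6cx_0^2x_1^3x_2^2x_3^6x_5^2+3x_0x_1^2x_2^3x_3^6x_5^2\\ &+3x_0x_1^3x_2^2x_3^7x_5^2+3c^3x_0^3x_1^3x_2^3x_3^2x_4x_5^2+6c^2x_0^2x_1^3x_2^3x_3^3x_4x_5^2\\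 &+3cx_0x_1^3x_2^3x_3^4x_4x_5^2+c^3x_0^3x_1^3x_2^3x_3^3x_5^3+3c^2x_0^2x_1^3x_2^3x_3^4x_5^3\\ &+3cx_0x_1^3x_2^3x_3^5x_5^3+x_1^3x_2^3x_3^6x_5^3. \end{align*}
   Context: Let $\mathfrak g$ be the affine Lie algebra of type $D_4^{(3)}$ with index set $I=\{0,1,2\}$, Cartan matrix $A=(a_{ij})_{i,j\in I}$, $a_{ij}=\alpha_j(\alpha_i^\vee)$, $$A=\begin{pmatrix}2&-1&0\\-1&2&-3\\0&-1&2\end{pmatrix},$$ Chevalley generators $e_i,f_i$, simple coroots $\alpha_i^\vee$, and fundamental weights $\Lambda_i$ with $\langle\alpha_i^\vee,\Lambda_j\rangle=\delta_{ij}$. **Module.** The fundamental representation $W(\varpi_1)$ is the 8-dimensional complex $\mathfrak g$-module with basis $\{v_1,v_2,v_3,v_0,\emptyset,v_{\bar3},v_{\bar2},v_{\bar1}\}$ of weight vectors, with weights $\mathrm{wt}(v_1)=\Lambda_1-2\Lambda_0$, $\mathrm{wt}(v_2)=-\Lambda_0-\Lambda_1+\Lambda_2$, $\mathrm{wt}(v_3)=-\Lambda_0+2\Lambda_1-\Lambda_2$, $\mathrm{wt}(v_{\bar i})=-\mathrm{wt}(v_i)$ ($i=1,2,3$), $\mathrm{wt}(v_0)=\mathrm{wt}(\emptyset)=0$. The nonzero actions of the $f_i$ on basis vectors are: - $f_0v_0=v_1$, $f_0v_{\bar3}=v_2$, $f_0v_{\bar2}=v_3$, $f_0v_{\bar1}=\emptyset+\tfrac12v_0$,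 $f_0\emptyset=\tfrac32v_1$; - $f_1v_1=v_2$, $f_1v_3=v_0$, $f_1v_0=2v_{\bar3}$, $f_1v_{\bar2}=v_{\bar1}$; - $f_2v_2=v_3$, $f_2v_{\bar3}=v_{\bar2}$; all other $f_i$ applied to basis vectors give $0$. **The sets $\mathcal V_1,\mathcal V_2$.** For $c\in\mathbb C^\times$ let $\alpha_i^\vee(c)$ act on a weight vector $v$ by $\alpha_i^\vee(c)v=c^{\langle\alpha_i^\vee,\mathrm{wt}(v)\rangle}v$, and put $Y_i(c)=\exp(c^{-1}f_i)\,\alpha_i^\vee(c)$. For $x,y\in(\mathbb C^\times)^6$ set $$V_1(x)=Y_0(x_0)Y_1(x_1)Y_2(x_2)Y_1(x_3)Y_2(x_4)Y_1(x_5)v_1,$$ $$V_2(y)=Y_2(y_2)Y_1(y_1)Y_2(y_4)Y_1(y_3)Y_0(y_0)Y_1(y_5)v_{\bar2},$$ $\mathcal V_1=\{V_1(x)\mid x\in(\mathbb C^\times)^6\}$, $\mathcal V_2=\{V_2(y)\mid y\in(\mathbb C^\times)^6\}$. Rational maps on and between these are expressed in the coordinates $x,y$. **The map $\overline\sigma$.** There is a unique solution $y=y(x)$, $a=a(x)$ in rational functions of $x$ of the equation $V_2(y)=a(x)V_1(x)$ in $W(\varpi_1)$; $\overline\sigma:\mathcal V_1\to\mathcal V_2$ is the rational map $V_1(x)\mapsto V_2(y(x))$. It is birational. **Natural structures.** For a product $Y_{i_1}(c_1)\cdots Y_{i_k}(c_k)$ and $i\in I$, put $t_m=\big(c_1^{a_{i_1,i}}\cdots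 c_{m-1}^{a_{i_{m-1},i}}c_m\big)^{-1}$ for each $m$ with $i_m=i$. The natural structure is: $\varepsilon_i=\sum_{m:\,i_m=i}t_m$, $\gamma_i=c_1^{a_{i_1,i}}\cdots c_k^{a_{i_k,i}}$, and $e_i^c$ replaces each $c_j$ by $$c_j\cdot\frac{\sum_{m\le j,\,i_m=i}c\,t_m+\sum_{m>j,\,i_m=i}t_m}{\sum_{m<j,\,i_m=i}c\,t_m+\sum_{m\ge j,\,i_m=i}t_m}.$$ Applied to the product defining $V_1(x)$ with $i=1,2$, this gives $e_i,\gamma_i,\varepsilon_i$ on $\mathcal V_1$. Applied to the product defining $V_2(y)$ with $i=0,1$, it gives $\overline e_i,\overline\gamma_i,\overline\varepsilon_i$ on $\mathcal V_2$. In particular $\overline e_0^c$ replaces $y_0$ by $cy_0$ and fixes the other $y_j$, $\overline\varepsilon_0=y_1y_3/y_0$, and $\overline\gamma_0=y_0^2/(y_1y_3y_5)$. **Geometric crystal.** A $\mathfrak g$-geometric crystal is a quadruple $(X,\{e_i\}_{i\in I},\{\gamma_i\}_{i\in I},\{\varepsilon_i\}_{i\in I})$, where $X$ is an algebraic (ind-)variety over $\mathbb C$, $\gamma_i,\varepsilon_i:X\to\mathbb C$ are rational functions and $e_i:\mathbb C^\times\times X\to X$, $(c,x)\mapsto e_i^c(x)$, are rational $\mathbb C^\times$-actions, such that: (i) $\{1\}\times X\subset\mathrm{dom}(e_i)$ for all $i$; (ii) $\gamma_j(e_i^c(x))=c^{a_{ij}}\gamma_j(x)$; (iii) (Verma relations)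 - $e_i^{c_1}e_j^{c_2}=e_j^{c_2}e_i^{c_1}$ if $a_{ij}=a_{ji}=0$; - $e_i^{c_1}e_j^{c_1c_2}e_i^{c_2}=e_j^{c_2}e_i^{c_1c_2}e_j^{c_1}$ if $a_{ij}=a_{ji}=-1$; - $e_i^{c_1}e_j^{c_1^2c_2}e_i^{c_1c_2}e_j^{c_2}=e_j^{c_2}e_i^{c_1c_2}e_j^{c_1^2c_2}e_i^{c_1}$ if $a_{ij}=-2$, $a_{ji}=-1$; - $e_i^{c_1}e_j^{c_1^3c_2}e_i^{c_1^2c_2}e_j^{c_1^3c_2^2}e_i^{c_1c_2}e_j^{c_2}=e_j^{c_2}e_i^{c_1c_2}e_j^{c_1^3c_2^2}e_i^{c_1^2c_2}e_j^{c_1^3c_2}e_i^{c_1}$ if $a_{ij}=-3$, $a_{ji}=-1$; (iv) $\varepsilon_i(e_i^c(x))=c^{-1}\varepsilon_i(x)$. **Positivity.** A nonzero rational function on an algebraic torus is positive if it can be written as $g/h$ with $g,h$ positive linear combinations of characters; a rational map between tori is positive if its composition with every character of the target is positive. A positive structure on a geometric crystal is a birational isomorphism $\theta:T'\to X$ from an algebraic torus $T'$ such that for all $i\in I$ the functions $\gamma_i\circ\theta$, $\varepsilon_i\circ\theta$ and the map $\mathbb C^\times\times T'\to T'$, $(c,t)\mapsto\theta^{-1}\circ e_i^c\circ\theta(t)$, are positive. A geometric crystal is called positive if it is equipped with a positive structure.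
   Formalization: Condition (i), {1}×X ⊂ dom(e_i), is required only on a dense open subset of X: at x=(1,1,1,1,−2,1) one has ε_1=0 and e_1 is not regular at (1,V_1(x)), so the literal condition fails on V_1. *)

(* Defs.v *)
From HB Require Import structures.
From mathcomp Require Import all_boot all_order all_algebra.
From mathcomp Require Import reals.
From mathcomp Require Import complex mpoly.

Set Implicit Arguments.
Unset Strict Implicit.
Unset Printing Implicit Defensive.

Import Order.TTheory GRing.Theory Num.Theory.
Local Open Scope ring_scope.

(** * Rational maps between quasi-affine varieties over the complex numbers

   A rational map is represented by a total function, considered only up to
   [generic] equality: its values off a nonempty Zariski-open set are junk.
   Every notion below is insensitive to that junk. *)

Section RationalMaps.
Variable R : realType.
Local Notation C := R[i].

Definition peval n (p : {mpoly C[n]}) (x : 'rV[C]_n) : C :=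
  p.@[fun j => x 0 j].

(* On an irreducible X, nonempty Zariski-open subsets are exactly the dense
   ones, and they are closed under finite intersection. *)
Definition generic n (X P : 'rV[C]_n -> Prop) : Prop :=
  exists2 h : {mpoly C[n]},
    (exists2 x, X x & peval h x != 0) &
    (forall x, X x -> peval h x != 0 -> P x).

Definition zclosure n (X : 'rV[C]_n -> Prop) (x : 'rV[C]_n) : Prop :=
  forall p : {mpoly C[n]}, (forall z, X z -> peval p z = 0) -> peval p x = 0.

(* Irreducible and locally closed in affine space. *)
Definition variety n (X : 'rV[C]_n -> Prop) : Prop :=
  [/\ exists x, X x,
      forall p q : {mpoly C[n]}, (forall x, X x -> peval (p * q) x = 0) ->
        (forall x, X x -> peval p x = 0) \/ (forall x, X x -> peval q x = 0) &
      forall x, X x -> exists2 h : {mpoly C[n]}, peval h x != 0 &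
        forall z, zclosure X z -> peval h z != 0 -> X z].

Definition torus n (x : 'rV[C]_n) : Prop := forall j, x 0 j != 0.

Definition set_image n m (X : 'rV[C]_n -> Prop) (f : 'rV[C]_n -> 'rV[C]_m)
    (w : 'rV[C]_m) : Prop :=
  exists2 x, X x & w = f x.

(* The product of the multiplicative group with X. *)
Definition Gm n (X : 'rV[C]_n -> Prop) (z : 'rV[C]_(1 + n)) : Prop :=
  lsubmx z 0 0 != 0 /\ X (rsubmx z).

Definition uncurry_Gm n T (F : C -> 'rV[C]_n -> T) (z : 'rV[C]_(1 + n)) : T :=
  F (lsubmx z 0 0) (rsubmx z).

Definition generic1 n (X : 'rV[C]_n -> Prop) (P : C -> 'rV[C]_n -> Prop) :=
  generic (Gm X) (uncurry_Gm P).

Definition generic2 n (X : 'rV[C]_n -> Prop) (P : C -> C -> 'rV[C]_n -> Prop) :=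
  generic (Gm (Gm X)) (uncurry_Gm (fun c1 => uncurry_Gm (P c1))).

Definition represents n (X : 'rV[C]_n -> Prop) (p q : {mpoly C[n]})
    (f : 'rV[C]_n -> C) : Prop :=
  generic X (fun x => peval q x != 0 /\ f x = peval p x / peval q x).

Definition rational_fun n (X : 'rV[C]_n -> Prop) (f : 'rV[C]_n -> C) : Prop :=
  exists p q, represents X p q f.

Definition rational_map n m (X : 'rV[C]_n -> Prop) (Y : 'rV[C]_m -> Prop)
    (f : 'rV[C]_n -> 'rV[C]_m) : Prop :=
  (forall j, rational_fun X (fun x => f x 0 j)) /\ generic X (fun x => Y (f x)).

(* The rational map f is regular at x, with value v there; v need not be the
   junk value [f x]. *)
Definition regular_value n m (X : 'rV[C]_n -> Prop)
    (f : 'rV[C]_n -> 'rV[C]_m) (x : 'rV[C]_n) (v : 'rV[C]_m) : Prop :=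
  forall j, exists p q, [/\ represents X p q (fun z => f z 0 j),
    peval q x != 0 & v 0 j = peval p x / peval q x].

Definition in_dom n m (X : 'rV[C]_n -> Prop) (Y : 'rV[C]_m -> Prop)
    (f : 'rV[C]_n -> 'rV[C]_m) (x : 'rV[C]_n) : Prop :=
  X x /\ exists2 v, Y v & regular_value X f x v.

Definition dominant n m (X : 'rV[C]_n -> Prop) (Y : 'rV[C]_m -> Prop)
    (f : 'rV[C]_n -> 'rV[C]_m) : Prop :=
  forall P, generic Y P -> generic X (fun x => P (f x)).

Definition birational_inverse n m (X : 'rV[C]_n -> Prop) (Y : 'rV[C]_m -> Prop)
    (f : 'rV[C]_n -> 'rV[C]_m) (g : 'rV[C]_m -> 'rV[C]_n) : Prop :=
  [/\ rational_map X Y f /\ rational_map Y X g,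
      dominant X Y f /\ dominant Y X g,
      generic X (fun x => g (f x) = x) &
      generic Y (fun y => f (g y) = y)].

Definition rational_action n (X : 'rV[C]_n -> Prop)
    (e : C -> 'rV[C]_n -> 'rV[C]_n) : Prop :=
  [/\ rational_map (Gm X) X (uncurry_Gm e),
      generic2 X (fun c1 c2 x => e c1 (e c2 x) = e (c1 * c2) x) &
      generic X (fun x => forall v,
        regular_value (Gm X) (uncurry_Gm e) (row_mx 1%:M x) v -> v = x)].

End RationalMaps.

(** * Geometric crystals and positive structures *)

Record crystal_data (R : realType) (r n : nat) := CrystalData {
  act : 'I_r -> R[i] -> 'rV[R[i]]_n -> 'rV[R[i]]_n;
  gam : 'I_r -> 'rV[R[i]]_n -> R[i];
  eps : 'I_r -> 'rV[R[i]]_n -> R[i] }.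

Section GeometricCrystals.
Variables (R : realType) (r : nat) (A : 'M[int]_r).
Local Notation C := R[i].

Definition verma n (X : 'rV[C]_n -> Prop)
    (e : 'I_r -> C -> 'rV[C]_n -> 'rV[C]_n) : Prop :=
  forall i j,
  [/\ A i j = 0 -> A j i = 0 -> generic2 X (fun c1 c2 x =>
        e i c1 (e j c2 x) = e j c2 (e i c1 x)),
      A i j = -1 -> A j i = -1 -> generic2 X (fun c1 c2 x =>
        e i c1 (e j (c1 * c2) (e i c2 x))
        = e j c2 (e i (c1 * c2) (e j c1 x))),
      A i j = -2 -> A j i = -1 -> generic2 X (fun c1 c2 x =>
        e i c1 (e j (c1 ^+ 2 * c2) (e i (c1 * c2) (e j c2 x)))
        = e j c2 (e i (c1 * c2) (e j (c1 ^+ 2 * c2) (e i c1 x)))) &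
      A i j = -3 -> A j i = -1 -> generic2 X (fun c1 c2 x =>
        e i c1 (e j (c1 ^+ 3 * c2) (e i (c1 ^+ 2 * c2)
          (e j (c1 ^+ 3 * c2 ^+ 2) (e i (c1 * c2) (e j c2 x)))))
        = e j c2 (e i (c1 * c2) (e j (c1 ^+ 3 * c2 ^+ 2)
          (e i (c1 ^+ 2 * c2) (e j (c1 ^+ 3 * c2) (e i c1 x))))))].

(* The third clause is the requirement that {1} x X meet dom(e_i) in a dense
   open subset of {1} x X.  It cannot be asked at every point of X: natural
   structures involve factors 1 + (c - 1) t / eps_i with t a unit, for which
   (1, x) is a point of indeterminacy wherever eps_i(x) = 0. *)
Definition geometric_crystal n (X : 'rV[C]_n -> Prop)
    (chi : crystal_data R r n) : Prop :=
  [/\ variety X,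
      (forall i, rational_fun X (gam chi i)) /\
      (forall i, rational_fun X (eps chi i)) /\
      (forall i, rational_action X (act chi i)),
      forall i, generic X (fun x =>
        in_dom (Gm X) X (uncurry_Gm (act chi i)) (row_mx 1%:M x)),
      forall i j, generic1 X (fun c x =>
        gam chi j (act chi i c x) = c ^ A i j * gam chi j x) &
      verma X (act chi) /\
      forall i, generic1 X (fun c x =>
        eps chi i (act chi i c x) = c^-1 * eps chi i x)].

Definition character n (m : 'rV[int]_n) (t : 'rV[C]_n) : C :=
  \prod_j t 0 j ^ m 0 j.

Definition char_comb n (s : seq (C * 'rV[int]_n)) (t : 'rV[C]_n) : C :=
  \sum_(u <- s) u.1 * character u.2 t.

Definition pos_comb n (s : seq (C * 'rV[int]_n)) : Prop :=
  s <> [::] /\ forall u, u \in s -> 0 < u.1.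

Definition positive_fun n (f : 'rV[C]_n -> C) : Prop :=
  exists g h, [/\ pos_comb g, pos_comb h &
    generic (@torus R n) (fun t =>
      char_comb h t != 0 /\ f t = char_comb g t / char_comb h t)].

Definition positive_map n m (f : 'rV[C]_n -> 'rV[C]_m) : Prop :=
  forall u : 'rV[int]_m, positive_fun (fun t => character u (f t)).

Definition positive_structure n k (X : 'rV[C]_n -> Prop)
    (chi : crystal_data R r n) (theta : 'rV[C]_k -> 'rV[C]_n) : Prop :=
  exists2 theta' : 'rV[C]_n -> 'rV[C]_k,
    birational_inverse (@torus R k) X theta theta' &
    forall i, [/\ positive_fun (fun t => gam chi i (theta t)),
      positive_fun (fun t => eps chi i (theta t)) &
      positive_map (uncurry_Gm (fun c t => theta' (act chi i c (theta t))))].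

End GeometricCrystals.

(** * The fundamental representation of type D_4^(3) *)

Definition i0 : 'I_3 := inord 0.
Definition i1 : 'I_3 := inord 1.
Definition i2 : 'I_3 := inord 2.

Definition cartan : 'M[int]_3 :=
  \matrix_(i, j) nth 0 (nth [::]
    [:: [:: 2; -1; 0]; [:: -1; 2; -3]; [:: 0; -1; 2]] i) j.

Section D43.
Variable R : realType.
Local Notation C := R[i].

(* The basis is v_1, v_2, v_3, v_0, emptyset, v_{bar 3}, v_{bar 2}, v_{bar 1},
   in this order; a vector is the row of its coordinates, and operators act by
   right multiplication. *)
Local Notation v1 := (inord 0 : 'I_8).
Local Notation v2 := (inord 1 : 'I_8).
Local Notation v3 := (inord 2 : 'I_8).
Local Notation v0 := (inord 3 : 'I_8).
Local Notation ve := (inord 4 : 'I_8).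
Local Notation w3 := (inord 5 : 'I_8).
Local Notation w2 := (inord 6 : 'I_8).
Local Notation w1 := (inord 7 : 'I_8).

(* [wt k i] is the pairing of the coroot alpha_i^vee with the weight of the
   k-th basis vector, i.e. the coefficient of Lambda_i in that weight. *)
Definition wt (k : 'I_8) (i : 'I_3) : int :=
  nth 0 (nth [::]
    [:: [:: -2; 1; 0]; [:: -1; -1; 1]; [:: -1; 2; -1]; [:: 0; 0; 0];
        [:: 0; 0; 0]; [:: 1; -2; 1]; [:: 1; 1; -1]; [:: 2; -1; 0]] k) i.

Definition f_mx (i : 'I_3) : 'M[C]_8 :=
  let E k l : 'M[C]_8 := delta_mx k l in
  nth 0
    [:: E v0 v1 + E w3 v2 + E w2 v3 + (E w1 ve + 2^-1 *: E w1 v0)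
          + (3 / 2) *: E ve v1;
        E v1 v2 + E v3 v0 + 2 *: E v0 w3 + E w2 w1;
        E v2 v3 + E w3 w2] i.

(* The exponential of a nilpotent matrix N, for which N ^+ n.+1 = 0. *)
Definition exp_nilp n (N : 'M[C]_n.+1) : 'M[C]_n.+1 :=
  \sum_(k < n.+1) (k`!%:R)^-1 *: N ^+ k.

Definition coroot_act (i : 'I_3) (c : C) (w : 'rV[C]_8) : 'rV[C]_8 :=
  \row_k (c ^ wt k i * w 0 k).

Definition Y (i : 'I_3) (c : C) (w : 'rV[C]_8) : 'rV[C]_8 :=
  coroot_act i c w *m exp_nilp (c^-1 *: f_mx i).

Definition xc (x : 'rV[C]_6) (k : nat) : C := x 0 (inord k).

Definition V1 (x : 'rV[C]_6) : 'rV[C]_8 :=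
  Y i0 (xc x 0) (Y i1 (xc x 1) (Y i2 (xc x 2)
    (Y i1 (xc x 3) (Y i2 (xc x 4) (Y i1 (xc x 5)
      (delta_mx 0 v1)))))).

Definition V2 (y : 'rV[C]_6) : 'rV[C]_8 :=
  Y i2 (xc y 2) (Y i1 (xc y 1) (Y i2 (xc y 4)
    (Y i1 (xc y 3) (Y i0 (xc y 0) (Y i1 (xc y 5)
      (delta_mx 0 w2)))))).

Definition calV1 : 'rV[C]_8 -> Prop := set_image (@torus R 6) V1.
Definition calV2 : 'rV[C]_8 -> Prop := set_image (@torus R 6) V2.

(** ** Natural structures

   Factors of a product are labelled by their coordinate: the coordinate j
   occurs as Y_{letter j}(c_j), at the place [pos j] of the product.  The two
   products attach the same letter to the same coordinate number. *)

Definition letter (j : 'I_6) : 'I_3 := inord (nth 0%N [:: 0; 1; 2; 1; 2; 1]%N j).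
Definition pos1 (j : 'I_6) : nat := j.
Definition pos2 (j : 'I_6) : nat := nth 0%N [:: 4; 1; 0; 3; 2; 5]%N j.

Definition nat_t (pos : 'I_6 -> nat) (i : 'I_3) (x : 'rV[C]_6) (m : 'I_6) : C :=
  ((\prod_(l < 6 | (pos l < pos m)%N) x 0 l ^ cartan (letter l) i) * x 0 m)^-1.

Definition nat_eps (pos : 'I_6 -> nat) (i : 'I_3) (x : 'rV[C]_6) : C :=
  \sum_(m < 6 | letter m == i) nat_t pos i x m.

Definition nat_gam (i : 'I_3) (x : 'rV[C]_6) : C :=
  \prod_(l < 6) x 0 l ^ cartan (letter l) i.

Definition nat_act (pos : 'I_6 -> nat) (i : 'I_3) (c : C) (x : 'rV[C]_6) :
    'rV[C]_6 :=
  \row_j (x 0 j *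
    ((\sum_(m < 6 | (letter m == i) && (pos m <= pos j)%N) c * nat_t pos i x m
      + \sum_(m < 6 | (letter m == i) && (pos j < pos m)%N) nat_t pos i x m)
     / (\sum_(m < 6 | (letter m == i) && (pos m < pos j)%N) c * nat_t pos i x m
      + \sum_(m < 6 | (letter m == i) && (pos j <= pos m)%N) nat_t pos i x m))).

Definition is_natural (V : 'rV[C]_6 -> 'rV[C]_8) (pos : 'I_6 -> nat)
    (chi : crystal_data R 3 8) (i : 'I_3) : Prop :=
  [/\ generic1 (@torus R 6)
        (fun c x => act chi i c (V x) = V (nat_act pos i c x)),
      generic (@torus R 6) (fun x => gam chi i (V x) = nat_gam i x) &
      generic (@torus R 6) (fun x => eps chi i (V x) = nat_eps pos i x)].

(** ** The map sigma and the quadruple chi *)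

Definition is_sigma (sigma sigma' : 'rV[C]_8 -> 'rV[C]_8) : Prop :=
  (exists y a,
    [/\ rational_map (@torus R 6) (@torus R 6) y,
        rational_fun (@torus R 6) a,
        generic (@torus R 6) (fun x => V2 (y x) = a x *: V1 x) &
        generic (@torus R 6) (fun x => sigma (V1 x) = V2 (y x))]) /\
  birational_inverse calV1 calV2 sigma sigma'.

(* A predicate rather than a definition because rational maps are only given
   up to generic equality. *)
Definition is_chi (chi : crystal_data R 3 8) : Prop :=
  exists sigma sigma' chibar,
  [/\ is_sigma sigma sigma',
      is_natural V1 pos1 chi i1 /\ is_natural V1 pos1 chi i2,
      is_natural V2 pos2 chibar i0 /\ is_natural V2 pos2 chibar i1 &
      [/\ generic1 calV1 (fun c w =>
            act chi i0 c w = sigma' (act chibar i0 c (sigma w))),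
          generic calV1 (fun w => gam chi i0 w = gam chibar i0 (sigma w)) &
          generic calV1 (fun w => eps chi i0 w = eps chibar i0 (sigma w))]].

(** ** The explicit formulas *)

Definition row6 (a0 a1 a2 a3 a4 a5 : C) : 'rV[C]_6 :=
  \row_j nth 0 [:: a0; a1; a2; a3; a4; a5] j.

Definition e1_formula (c : C) (x : 'rV[C]_6) : 'rV[C]_6 :=
  let x0 := xc x 0 in let x1 := xc x 1 in let x2 := xc x 2 in
  let x3 := xc x 3 in let x4 := xc x 4 in let x5 := xc x 5 in
  let C1 :=
    (c * x0 / x1 + x0 * x2 / (x1 ^+ 2 * x3)
       + x0 * x2 * x4 / (x1 ^+ 2 * x3 ^+ 2 * x5))
    / (x0 / x1 + x0 * x2 / (x1 ^+ 2 * x3)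
       + x0 * x2 * x4 / (x1 ^+ 2 * x3 ^+ 2 * x5)) in
  let C3 :=
    (c * x0 / x1 + c * x0 * x2 / (x1 ^+ 2 * x3)
       + x0 * x2 * x4 / (x1 ^+ 2 * x3 ^+ 2 * x5))
    / (c * x0 / x1 + x0 * x2 / (x1 ^+ 2 * x3)
       + x0 * x2 * x4 / (x1 ^+ 2 * x3 ^+ 2 * x5)) in
  let C5 :=
    c * (x0 / x1 + x0 * x2 / (x1 ^+ 2 * x3)
       + x0 * x2 * x4 / (x1 ^+ 2 * x3 ^+ 2 * x5))
    / (c * x0 / x1 + c * x0 * x2 / (x1 ^+ 2 * x3)
       + x0 * x2 * x4 / (x1 ^+ 2 * x3 ^+ 2 * x5)) in
  row6 x0 (C1 * x1) x2 (C3 * x3) x4 (C5 * x5).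

Definition eps1_formula (x : 'rV[C]_6) : C :=
  let x0 := xc x 0 in let x1 := xc x 1 in let x2 := xc x 2 in
  let x3 := xc x 3 in let x4 := xc x 4 in let x5 := xc x 5 in
  x0 / x1 + x0 * x2 / (x1 ^+ 2 * x3)
    + x0 * x2 * x4 / (x1 ^+ 2 * x3 ^+ 2 * x5).

Definition gam1_formula (x : 'rV[C]_6) : C :=
  let x0 := xc x 0 in let x1 := xc x 1 in let x2 := xc x 2 in
  let x3 := xc x 3 in let x4 := xc x 4 in let x5 := xc x 5 in
  x1 ^+ 2 * x3 ^+ 2 * x5 ^+ 2 / (x0 * x2 * x4).

Definition e2_formula (c : C) (x : 'rV[C]_6) : 'rV[C]_6 :=
  let x0 := xc x 0 in let x1 := xc x 1 in let x2 := xc x 2 in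
  let x3 := xc x 3 in let x4 := xc x 4 in let x5 := xc x 5 in
  let C2 :=
    (c * x1 ^+ 3 / x2 + x1 ^+ 3 * x3 ^+ 3 / (x2 ^+ 2 * x4))
    / (x1 ^+ 3 / x2 + x1 ^+ 3 * x3 ^+ 3 / (x2 ^+ 2 * x4)) in
  let C4 :=
    c * (x1 ^+ 3 / x2 + x1 ^+ 3 * x3 ^+ 3 / (x2 ^+ 2 * x4))
    / (c * x1 ^+ 3 / x2 + x1 ^+ 3 * x3 ^+ 3 / (x2 ^+ 2 * x4)) in
  row6 x0 x1 (C2 * x2) x3 (C4 * x4) x5.

Definition eps2_formula (x : 'rV[C]_6) : C :=
  let x1 := xc x 1 in let x2 := xc x 2 in
  let x3 := xc x 3 in let x4 := xc x 4 in
  x1 ^+ 3 / x2 + x1 ^+ 3 * x3 ^+ 3 / (x2 ^+ 2 * x4).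

Definition gam2_formula (x : 'rV[C]_6) : C :=
  let x1 := xc x 1 in let x2 := xc x 2 in let x3 := xc x 3 in
  let x4 := xc x 4 in let x5 := xc x 5 in
  x2 ^+ 2 * x4 ^+ 2 / (x1 ^+ 3 * x3 ^+ 3 * x5 ^+ 3).

Definition polyD (c : C) (x : 'rV[C]_6) : C :=
  let x0 := xc x 0 in let x1 := xc x 1 in let x2 := xc x 2 in
  let x3 := xc x 3 in let x4 := xc x 4 in let x5 := xc x 5 in
  c ^+ 2 * x0 ^+ 2 * x2 * x3 + x1 * x2 * x3 ^+ 2 * x5
  + c * x0 * (x1 * x3 ^+ 3 + x2 * (x3 ^+ 2 + x1 * x4 + x1 * x3 * x5)).

Definition polyE (x : 'rV[C]_6) : C :=
  let x0 := xc x 0 in let x1 := xc x 1 in let x2 := xc x 2 in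
  let x3 := xc x 3 in let x4 := xc x 4 in let x5 := xc x 5 in
  x0 ^+ 2 * x2 * x3 + x1 * x2 * x3 ^+ 2 * x5
  + x0 * (x1 * x3 ^+ 3 + x2 * (x3 ^+ 2 + x1 * x4 + x1 * x3 * x5)).

Definition polyF (c : C) (x : 'rV[C]_6) : C :=
  let x0 := xc x 0 in let x1 := xc x 1 in let x2 := xc x 2 in
  let x3 := xc x 3 in let x4 := xc x 4 in let x5 := xc x 5 in
  x2 * x3 ^+ 2 * (x0 + x1 * x5)
  + c * x0 * (x0 * x2 * x3 + x1 * (x3 ^+ 3 + x2 * x4 + x2 * x3 * x5)).

Definition polyH (c : C) (x : 'rV[C]_6) : C :=
  let x0 := xc x 0 in let x1 := xc x 1 in let x2 := xc x 2 in
  let x3 := xc x 3 in let x4 := xc x 4 in let x5 := xc x 5 in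
  c * x0 ^+ 2 * x2 * x3 + x0 * x2 * x3 ^+ 2 + x0 * x1 * x3 ^+ 3
  + x0 * x1 * x2 * x4 + c * x0 * x1 * x2 * x3 * x5 + x1 * x2 * x3 ^+ 2 * x5.

Definition polyG (c : C) (x : 'rV[C]_6) : C :=
  let x0 := xc x 0 in let x1 := xc x 1 in let x2 := xc x 2 in
  let x3 := xc x 3 in let x4 := xc x 4 in let x5 := xc x 5 in
  c ^+ 3 * x0 ^+ 6 * x2 ^+ 3 * x3 ^+ 3
  + 3 * c ^+ 2 * x0 ^+ 5 * x2 ^+ 3 * x3 ^+ 4
  + 3 * c ^+ 2 * x0 ^+ 5 * x1 * x2 ^+ 2 * x3 ^+ 5
  + 3 * c * x0 ^+ 4 * x2 ^+ 3 * x3 ^+ 5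
  + 6 * c * x0 ^+ 4 * x1 * x2 ^+ 2 * x3 ^+ 6 + x0 ^+ 3 * x2 ^+ 3 * x3 ^+ 6
  + 3 * c * x0 ^+ 4 * x1 ^+ 2 * x2 * x3 ^+ 7
  + 3 * x0 ^+ 3 * x1 * x2 ^+ 2 * x3 ^+ 7
  + 3 * x0 ^+ 3 * x1 ^+ 2 * x2 * x3 ^+ 8 + x0 ^+ 3 * x1 ^+ 3 * x3 ^+ 9
  + 3 * c ^+ 3 * x0 ^+ 5 * x1 * x2 ^+ 3 * x3 ^+ 2 * x4
  + 6 * c ^+ 2 * x0 ^+ 4 * x1 * x2 ^+ 3 * x3 ^+ 3 * x4
  + 3 * c * x0 ^+ 4 * x1 ^+ 2 * x2 ^+ 2 * x3 ^+ 4 * x4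
  + 3 * c ^+ 3 * x0 ^+ 4 * x1 ^+ 2 * x2 ^+ 2 * x3 ^+ 4 * x4
  + 3 * c * x0 ^+ 3 * x1 * x2 ^+ 3 * x3 ^+ 4 * x4
  + 3 * x0 ^+ 3 * x1 ^+ 2 * x2 ^+ 2 * x3 ^+ 5 * x4
  + 3 * c ^+ 2 * x0 ^+ 3 * x1 ^+ 2 * x2 ^+ 2 * x3 ^+ 5 * x4
  + 2 * x0 ^+ 3 * x1 ^+ 3 * x2 * x3 ^+ 6 * x4
  + c ^+ 3 * x0 ^+ 3 * x1 ^+ 3 * x2 * x3 ^+ 6 * x4
  + 3 * c ^+ 3 * x0 ^+ 4 * x1 ^+ 2 * x2 ^+ 3 * x3 * x4 ^+ 2
  + 3 * c ^+ 2 * x0 ^+ 3 * x1 ^+ 2 * x2 ^+ 3 * x3 ^+ 2 * x4 ^+ 2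
  + x0 ^+ 3 * x1 ^+ 3 * x2 ^+ 2 * x3 ^+ 3 * x4 ^+ 2
  + 2 * c ^+ 3 * x0 ^+ 3 * x1 ^+ 3 * x2 ^+ 2 * x3 ^+ 3 * x4 ^+ 2
  + c ^+ 3 * x0 ^+ 3 * x1 ^+ 3 * x2 ^+ 3 * x4 ^+ 3
  + 3 * c ^+ 3 * x0 ^+ 5 * x1 * x2 ^+ 3 * x3 ^+ 3 * x5
  + 9 * c ^+ 2 * x0 ^+ 4 * x1 * x2 ^+ 3 * x3 ^+ 4 * x5
  + 6 * c ^+ 2 * x0 ^+ 4 * x1 ^+ 2 * x2 ^+ 2 * x3 ^+ 5 * x5
  + 9 * c * x0 ^+ 3 * x1 * x2 ^+ 3 * x3 ^+ 5 * x5
  + 12 * c * x0 ^+ 3 * x1 ^+ 2 * x2 ^+ 2 * x3 ^+ 6 * x5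
  + 3 * x0 ^+ 2 * x1 * x2 ^+ 3 * x3 ^+ 6 * x5
  + 3 * c * x0 ^+ 3 * x1 ^+ 3 * x2 * x3 ^+ 7 * x5
  + 6 * x0 ^+ 2 * x1 ^+ 2 * x2 ^+ 2 * x3 ^+ 7 * x5
  + 3 * x0 ^+ 2 * x1 ^+ 3 * x2 * x3 ^+ 8 * x5
  + 6 * c ^+ 3 * x0 ^+ 4 * x1 ^+ 2 * x2 ^+ 3 * x3 ^+ 2 * x4 * x5
  + 12 * c ^+ 2 * x0 ^+ 3 * x1 ^+ 2 * x2 ^+ 3 * x3 ^+ 3 * x4 * x5
  + 3 * c * x0 ^+ 3 * x1 ^+ 3 * x2 ^+ 2 * x3 ^+ 4 * x4 * x5
  + 3 * c ^+ 3 * x0 ^+ 3 * x1 ^+ 3 * x2 ^+ 2 * x3 ^+ 4 * x4 * x5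
  + 6 * c * x0 ^+ 2 * x1 ^+ 2 * x2 ^+ 3 * x3 ^+ 4 * x4 * x5
  + 3 * x0 ^+ 2 * x1 ^+ 3 * x2 ^+ 2 * x3 ^+ 5 * x4 * x5
  + 3 * c ^+ 2 * x0 ^+ 2 * x1 ^+ 3 * x2 ^+ 2 * x3 ^+ 5 * x4 * x5
  + 3 * c ^+ 3 * x0 ^+ 3 * x1 ^+ 3 * x2 ^+ 3 * x3 * x4 ^+ 2 * x5
  + 3 * c ^+ 2 * x0 ^+ 2 * x1 ^+ 3 * x2 ^+ 3 * x3 ^+ 2 * x4 ^+ 2 * x5
  + 3 * c ^+ 3 * x0 ^+ 4 * x1 ^+ 2 * x2 ^+ 3 * x3 ^+ 3 * x5 ^+ 2
  + 9 * c ^+ 2 * x0 ^+ 3 * x1 ^+ 2 * x2 ^+ 3 * x3 ^+ 4 * x5 ^+ 2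
  + 3 * c ^+ 2 * x0 ^+ 3 * x1 ^+ 3 * x2 ^+ 2 * x3 ^+ 5 * x5 ^+ 2
  + 9 * c * x0 ^+ 2 * x1 ^+ 2 * x2 ^+ 3 * x3 ^+ 5 * x5 ^+ 2
  + 6 * c * x0 ^+ 2 * x1 ^+ 3 * x2 ^+ 2 * x3 ^+ 6 * x5 ^+ 2
  + 3 * x0 * x1 ^+ 2 * x2 ^+ 3 * x3 ^+ 6 * x5 ^+ 2
  + 3 * x0 * x1 ^+ 3 * x2 ^+ 2 * x3 ^+ 7 * x5 ^+ 2
  + 3 * c ^+ 3 * x0 ^+ 3 * x1 ^+ 3 * x2 ^+ 3 * x3 ^+ 2 * x4 * x5 ^+ 2
  + 6 * c ^+ 2 * x0 ^+ 2 * x1 ^+ 3 * x2 ^+ 3 * x3 ^+ 3 * x4 * x5 ^+ 2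
  + 3 * c * x0 * x1 ^+ 3 * x2 ^+ 3 * x3 ^+ 4 * x4 * x5 ^+ 2
  + c ^+ 3 * x0 ^+ 3 * x1 ^+ 3 * x2 ^+ 3 * x3 ^+ 3 * x5 ^+ 3
  + 3 * c ^+ 2 * x0 ^+ 2 * x1 ^+ 3 * x2 ^+ 3 * x3 ^+ 4 * x5 ^+ 3
  + 3 * c * x0 * x1 ^+ 3 * x2 ^+ 3 * x3 ^+ 5 * x5 ^+ 3
  + x1 ^+ 3 * x2 ^+ 3 * x3 ^+ 6 * x5 ^+ 3.

Definition e0_formula (c : C) (x : 'rV[C]_6) : 'rV[C]_6 :=
  let D := polyD c x in let E := polyE x in let F := polyF c x in
  let G := polyG c x in let H := polyH c x in
  row6 (D / (c * E) * xc x 0)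
       (F / (c * E) * xc x 1)
       (G / (c ^+ 3 * E ^+ 3) * xc x 2)
       (D * H / (c ^+ 2 * E * F) * xc x 3)
       (D ^+ 3 / (c ^+ 3 * G) * xc x 4)
       (D / (c * H) * xc x 5).

Definition eps0_formula (x : 'rV[C]_6) : C :=
  polyE x / (xc x 0 ^+ 3 * xc x 2 * xc x 3).

Definition gam0_formula (x : 'rV[C]_6) : C :=
  xc x 0 ^+ 2 / (xc x 1 * xc x 3 * xc x 5).

Definition has_explicit_form (chi : crystal_data R 3 8) (i : 'I_3)
    (e : C -> 'rV[C]_6 -> 'rV[C]_6) (g ep : 'rV[C]_6 -> C) : Prop :=
  [/\ generic1 (@torus R 6) (fun c x => act chi i c (V1 x) = V1 (e c x)),
      generic (@torus R 6) (fun x => gam chi i (V1 x) = g x) &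
      generic (@torus R 6) (fun x => eps chi i (V1 x) = ep x)].

End D43.

(* Main.v *)
Require Import Defs.
From mathcomp Require Import all_boot all_order all_algebra.
From mathcomp Require Import reals.
From mathcomp Require Import complex mpoly.
From mathcomp Require Import ring.

Set Implicit Arguments.
Unset Strict Implicit.
Unset Printing Implicit Defensive.

Import Order.TTheory GRing.Theory Num.Theory.
Local Open Scope ring_scope.

(** The maps of the statement are subtraction-free: quotients of polynomials with
    nonnegative coefficients.  Two such maps agree generically as soon as they
    agree at the points whose coordinates are real and greater than 1
    ([PF_eq_gt1]), and there every denominator that occurs is positive.  So
    each relation is first proved at positive points, over an arbitrary
    numerical field, by field identities whose side conditions are matters of
    sign; it is then carried to the torus and, through the parametrizations
    V_1 and V_2, to the varieties ([param_generic], [param_crystal],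
    [param_positive_structure]).

    The map sigma.  Both products have short coordinates in the basis of the
    representation ([V1E], [V2E]), and both vectors lie on one quadric.  The
    equation V_2(y) = a V_1(x) reduces to a linear system in y_1, y_2 and a with
    a nonzero determinant, so it has at most one solution ([prop12_inj]); a
    subtraction-free solution y = yhat x is checked against the coordinates
    ([yhat_prop]).  Solving for x instead gives xhat y ([xhat_prop]), the
    inverse of yhat ([xhatK], [yhatK]).  Hence sigma is yhat in coordinates,
    and e_0^c is the scaling of y_0 by c conjugated by yhat; its expansion is
    the stated one ([e0xE], [polyG_cubes]).

    The Verma relations.  The natural action e_i^c multiplies a product of
    factors Y_l by the one-parameter subgroup x_i(a) with
    a = (c - 1) / eps_i.  For a simply laced pair the relation between x_i and
    x_j in SL_3 yields the relation of type A2 ([wact_braid]).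
    - For e_0 and e_1 it is applied to the second product.  There e_1 is natural
      too, because x_1(s) acts on the vectors themselves and so preserves their
      proportionality ([yhat_e1x]).
    - For e_1 and e_2 the pair is G2.  Replacing each factor Y_1 by three
      commuting factors turns the product into one for D4, where e_1 is the
      product of the operators at the three branches; the relation becomes an
      equality between two runs of twelve operators joined by moves of type A2
      and commutations ([wact3_braid]).
    - The operators e_0 and e_2 commute because e_2 changes only x_2 x_4 among
      x_0, x_1, x_3, x_5, x_2 x_4 and x_4 + x_3^3 / x_2, and x_2 x_4 enters
      e_0 only by being scaled ([e0x_e2x_comm]).

    Since actions are known only generically, composing them at parameters such
    as c_1^3 c_2 requires the substitutions to be dominant; this holds because
    the vectors of exponents are primitive ([generic2_act]). *)

(** * Crystal operators on words *)

Lemma addr_gt0_ge0 (F : numDomainType) (x y : F) :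
  0 < x -> 0 <= y -> 0 < x + y.
Proof. by move=> x0 y0; rewrite ltr_wpDr. Qed.

(* The two tactics call each other because a sum is positive as soon as one of
   its terms is positive and the other nonnegative. *)
Ltac nneg := first
  [ assumption | apply: addr_ge0; nneg | apply: mulr_ge0; nneg
  | apply: exprn_ge0; nneg | rewrite invr_ge0; nneg | apply: ltW; pos
  | exact: ler0n | exact: ler01 ]
with pos := first
  [ assumption | exact: ltr01 | by rewrite ltr0n | apply: mulr_gt0; pos
  | apply: addr_gt0; pos | apply: addr_gt0_ge0; [pos | nneg]
  | rewrite addrC; apply: addr_gt0_ge0; [pos | nneg]
  | apply: exprn_gt0; pos | rewrite invr_gt0; pos ].

Ltac neq0 := repeat (apply/andP; split); repeat split; apply: lt0r_neq0; pos.

Section Words.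

Variables (F : numFieldType) (adj : rel nat).
Hypotheses (adjC : ssrbool.symmetric adj) (adjxx : irreflexive adj).
Implicit Types (w : seq (nat * F)) (a c p q : F) (i j l : nat).

(** A word stands for a product of factors Y_l(c) of a simply laced group, and
   [xact i a] for left multiplication of that product by the one-parameter
   subgroup x_i(a).  On its way to the right, x_i(a) is rescaled by the factors
   Y_l(c) with l adjacent to i, and a factor Y_i(c) absorbs a part of it. *)
Fixpoint xact i a w : seq (nat * F) :=
  if w isn't (l, c) :: w' then [::] else
  if l == i then (l, c + a) :: xact i (a / (c * (c + a))) w'
  else (l, c) :: xact i (if adj l i then a * c else a) w'.

(** The function eps_i of the natural structure. *)
Fixpoint weps i w : F :=
  if w isn't (l, c) :: w' then 0 else
  if l == i then c^-1 + weps i w' / c ^+ 2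
  else if adj l i then c * weps i w' else weps i w'.

(** For adjacent i and j, the derivative of eps_i along x_j; the product of
   eps_i and eps_j is the sum of the two derivatives. *)
Fixpoint weps2 i j w : F :=
  if w isn't (l, c) :: w' then 0 else
  if l == i then weps2 i j w' / c
  else if l == j then weps i w' + weps2 i j w' / c
  else (if adj l i then c else 1) * (if adj l j then c else 1) * weps2 i j w'.

Definition wpos w := all (fun u => 0 < u.2) w.

Definition letters w := [seq u.1 | u <- w].

(** The natural action e_i^c multiplies by x_i(a) with a = (c - 1) / eps_i. *)
Definition wact i c w := xact i ((c - 1) / weps i w) w.

Lemma xact_letters i a w : letters (xact i a w) = letters w.
Proof. by elim: w a => [|[l c] w IH] a //=; case: eqP => _ /=; rewrite IH. Qed.

Lemma xact_pos i a w : wpos w -> 0 < a -> wpos (xact i a w).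
Proof.
elim: w a => [|[l c] w IH] a //= /andP[c0 w0] a0.
case: eqP => _ /=; apply/andP; split=> //; first by pos.
  by apply: IH => //; pos.
by apply: IH => //; case: ifP => _; pos.
Qed.

Lemma weps_ge0 i w : wpos w -> 0 <= weps i w.
Proof.
elim: w => [|[l c] w IH] //= /andP[c0 /IH w0].
case: eqP => _; last by case: ifP => _ //; rewrite mulr_ge0 // ltW.
by rewrite addr_ge0 ?invr_ge0 ?divr_ge0 ?exprn_ge0 // ltW.
Qed.

Lemma weps_gt0 i w : wpos w -> i \in letters w -> 0 < weps i w.
Proof.
elim: w => [|[l c] w IH] //= /andP[c0 w0]; rewrite inE eq_sym.
case: eqP => [_ _|_ /= /(IH w0) iw].
  by rewrite ltr_wpDr ?invr_gt0 // divr_ge0 ?weps_ge0 ?exprn_ge0 // ltW.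
by case: ifP => _ //; pos.
Qed.

Lemma weps2_ge0 i j w : wpos w -> 0 <= weps2 i j w.
Proof.
elim: w => [|[l c] w IH] //= /andP[c0 w0]; have {}IH := IH w0.
have c0' := ltW c0; have e0 := weps_ge0 i w0.
by repeat case: ifP => _; rewrite ?addr_ge0 ?divr_ge0 ?mulr_ge0 // ?ler01.
Qed.

Lemma xact_comm i j a b w : ~~ adj i j -> i != j ->
  xact i a (xact j b w) = xact j b (xact i a w).
Proof.
move=> nij ij; elim: w a b => [|[l c] w IH] a b //=.
have nji : adj j i = false by rewrite adjC (negbTE nij).
have [->|li] := eqVneq l i.
  by rewrite (negbTE ij) /= eqxx (negbTE ij) (negbTE nij) IH.
have [->|lj] := eqVneq l j; first by rewrite /= eqxx eq_sym (negbTE ij) nji IH.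
by rewrite /= (negbTE li) (negbTE lj) IH.
Qed.

Lemma xactD i a b w : wpos w -> 0 < a -> 0 < b ->
  xact i a (xact i b w) = xact i (a + b) w.
Proof.
elim: w a b => [|[l c] w IH] a b //= /andP[c0 w0] a0 b0.
have [->|li] := eqVneq l i.
  rewrite /= eqxx addrAC -addrA IH //; try by pos.
  by congr (_ :: xact _ _ _); field; neq0.
rewrite /= (negbTE li) IH //; try by case: ifP => _; pos.
by case: ifP => _ //; rewrite mulrDl.
Qed.

(** The relation between x_i and x_j in SL_3.  Both sides have the same effect
   on each letter, and leave parameters that are related in the same way. *)
Lemma xact_braid i j a1 a2 a3 w : adj i j -> wpos w ->
    0 < a1 -> 0 < a2 -> 0 < a3 ->
  xact i a1 (xact j a2 (xact i a3 w)) =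
  xact j (a2 * a3 / (a1 + a3))
    (xact i (a1 + a3) (xact j (a1 * a2 / (a1 + a3)) w)).
Proof.
move=> aij; have aji : adj j i by rewrite adjC.
have ij : (i == j) = false by apply: contraTF aij => /eqP->; rewrite adjxx.
elim: w a1 a2 a3 => [|[l c] w IH] a1 a2 a3 //= /andP[c0 w0] p1 p2 p3.
have [->|li] := eqVneq l i.
  rewrite ij /= eqxx ij aij /= eqxx ij aij IH //; try by pos.
  congr ((_, _) :: _); first by ring.
  by congr (xact _ _ (xact _ _ (xact _ _ _))); field; neq0.
have [->|lj] := eqVneq l j.
  rewrite /= eqxx eq_sym ij aji /= eqxx eq_sym ij aji IH //; try by pos.
  congr ((_, _) :: _); first by field; neq0.
  by congr (xact _ _ (xact _ _ (xact _ _ _))); field; neq0.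
do 3! rewrite /= ?(negbTE li) ?(negbTE lj); rewrite IH //;
  try by case: ifP => _; pos.
congr ((_, _) :: xact _ _ (xact _ _ (xact _ _ _)));
  case: (adj l i); case: (adj l j) => //; field; neq0.
Qed.

Lemma weps_xact i a w : wpos w -> 0 < a ->
  weps i (xact i a w) = weps i w / (1 + a * weps i w).
Proof.
elim: w a => [|[l c] w IH] a /=; first by rewrite mul0r.
move=> /andP[c0 w0] a0; have e0 := weps_ge0 i w0.
have [->|li] := eqVneq l i.
  rewrite /= eqxx IH //; try by pos.
  by field; neq0.
rewrite /= (negbTE li); case: (adj l i); rewrite IH //; try by pos.
by rewrite !mulrA.
Qed.

Lemma weps_xact_comm i j a w : ~~ adj i j -> i != j ->
  weps i (xact j a w) = weps i w.
Proof.
move=> nij ij; elim: w a => [|[l c] w IH] a //=.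
have [->|lj] := eqVneq l j.
  by rewrite /= eq_sym (negbTE ij) adjC (negbTE nij) IH.
by rewrite /= IH.
Qed.

Lemma weps2_xactl i j a w : adj i j -> wpos w -> 0 < a ->
  weps2 i j (xact i a w) = weps2 i j w / (1 + a * weps i w).
Proof.
move=> aij; have aji : adj j i by rewrite adjC.
elim: w a => [|[l c] w IH] a /=; first by rewrite mul0r.
move=> /andP[c0 w0] a0; have e0 := weps_ge0 i w0.
have [->|li] := eqVneq l i.
  rewrite /= eqxx IH //; try by pos.
  by field; neq0.
rewrite /= (negbTE li); have [->|lj] := eqVneq l j.
  rewrite aji weps_xact ?IH //; try by pos.
  by field; neq0.
case: (adj l i); case: (adj l j); rewrite IH //; try (by pos);
  rewrite ?mul1r ?mulr1 ?mulrA //; ring.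
Qed.

Lemma weps_weps2 i j w : adj i j -> wpos w ->
  weps i w * weps j w = weps2 i j w + weps2 j i w.
Proof.
move=> aij; have aji : adj j i by rewrite adjC.
have ij : (i == j) = false by apply: contraTF aij => /eqP->; rewrite adjxx.
elim: w => [|[l c] w IH] /=; first by rewrite mul0r addr0.
move=> /andP[c0 w0]; have {IH}IHw := IH w0.
have [->|li] := eqVneq l i.
  rewrite ij aij; have -> : weps2 i j w = weps i w * weps j w - weps2 j i w.
    by rewrite IHw; ring.
  by field; neq0.
have [->|lj] := eqVneq l j.
  rewrite aji; have -> : weps2 i j w = weps i w * weps j w - weps2 j i w.
    by rewrite IHw; ring.
  by field; neq0.
case: (adj l i); case: (adj l j); rewrite ?mul1r ?mulr1 -?IHw;
  rewrite ?mulrA ?IHw; ring: IHw.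
Qed.

Lemma weps_xact_adj i j a w : adj i j -> wpos w -> 0 < a ->
  weps j (xact i a w) = weps j w + a * weps2 j i w.
Proof.
move=> aij; have aji : adj j i by rewrite adjC.
have ij : (i == j) = false by apply: contraTF aij => /eqP->; rewrite adjxx.
elim: w a => [|[l c] w IH] a /=; first by rewrite mulr0 addr0.
move=> /andP[c0 w0] a0.
have [->|li] := eqVneq l i.
  rewrite /= ij aij IH //; try by pos.
  by field; neq0.
rewrite /=; have [->|lj] := eqVneq l j.
  rewrite aji IH //; try by pos.
  by field; neq0.
by case: (adj l i); case: (adj l j); rewrite IH //; (try by pos); ring.
Qed.

(** Here e and f are the values of eps_i and eps_j, and r, s the two parts of
   their product.  The parameters of x_i, x_j on the two sides of the Verma
   relation are exactly those which the relation in SL_3 exchanges. *)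
Lemma braid_parameters p q e f r s :
    1 < p -> 1 < q -> 0 < e -> 0 < f -> 0 <= r -> 0 <= s -> e * f = r + s ->
  let a3 := (q - 1) / e in
  let a2 := (p * q - 1) / (f + a3 * s) in
  let a1 := (p - 1) / (e / (1 + a3 * e) + a2 * (r / (1 + a3 * e))) in
  let b3 := (p - 1) / f in
  let b2 := (p * q - 1) / (e + b3 * r) in
  let b1 := (q - 1) / (f / (1 + b3 * f) + b2 * (s / (1 + b3 * f))) in
  [/\ 0 < a1, 0 < a2 & 0 < a3] /\
  [/\ a1 * a2 / (a1 + a3) = b3, a1 + a3 = b2 & a2 * a3 / (a1 + a3) = b1].
Proof.
rewrite -subr_gt0 -(subr_gt0 1 q) => p0 q0 e0 f0 r0 s0 efE.
have -> : p * q - 1 = (p - 1) + (q - 1) + (p - 1) * (q - 1) by ring.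
move: (p - 1) (q - 1) p0 q0 => {}p {}q p0 q0.
have fE : f = (r + s) / e by rewrite -efE; field; neq0.
have rs0 : 0 < r + s by rewrite -efE; pos.
rewrite fE {f f0 efE fE} => a3 a2 a1 b3 b2 b1.
have a30 : 0 < a3 by rewrite /a3; pos.
have a20 : 0 < a2 by rewrite /a2; pos.
have a10 : 0 < a1 by rewrite /a1; pos.
split=> //; split; rewrite /b1 /b2 /b3 /a1 /a2 /a3; field.
all: neq0.
Qed.

Lemma wact_braid i j p q w : adj i j -> wpos w ->
    i \in letters w -> j \in letters w -> 1 < p -> 1 < q ->
  wact i p (wact j (p * q) (wact i q w)) =
  wact j q (wact i (p * q) (wact j p w)).
Proof.
move=> aij w0 iw jw p1 q1.
have aji : adj j i by rewrite adjC.
have [[]] := braid_parameters p1 q1 (weps_gt0 w0 iw) (weps_gt0 w0 jw)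
  (weps2_ge0 i j w0) (weps2_ge0 j i w0) (weps_weps2 aij w0).
set a3 := (q - 1) / weps i w; set b3 := (p - 1) / weps j w.
have b30 : 0 < b3.
  by rewrite /b3; apply: divr_gt0; rewrite ?subr_gt0 ?weps_gt0.
set a2 := (p * q - 1) / (weps j w + _).
set a1 := (p - 1) / (weps i w / _ + _).
set b2 := (p * q - 1) / (weps i w + _).
set b1 := (q - 1) / (weps j w / _ + _) => a10 a20 a30 [eb3 eb2 eb1].
have b20 : 0 < b2 by rewrite -eb2 addr_gt0.
have xa3 := xact_pos i w0 a30; have xb3 := xact_pos j w0 b30.
have -> : wact i q w = xact i a3 w by [].
have -> : wact j p w = xact j b3 w by [].
have -> : wact j (p * q) (xact i a3 w) = xact j a2 (xact i a3 w).
  by rewrite /wact weps_xact_adj.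
have -> : wact i (p * q) (xact j b3 w) = xact i b2 (xact j b3 w).
  by rewrite /wact weps_xact_adj.
have -> : wact i p (xact j a2 (xact i a3 w)) =
          xact i a1 (xact j a2 (xact i a3 w)).
  by rewrite /wact weps_xact_adj // weps_xact // weps2_xactl.
have -> : wact j q (xact i b2 (xact j b3 w)) =
          xact j b1 (xact i b2 (xact j b3 w)).
  by rewrite /wact weps_xact_adj // weps_xact // weps2_xactl.
by rewrite xact_braid // eb1 -eb3 -eb2.
Qed.

Lemma wact_comm i j p q w : ~~ adj i j -> i != j ->
  wact i p (wact j q w) = wact j q (wact i p w).
Proof.
move=> nij ij; rewrite /wact !weps_xact_comm //; first exact: xact_comm.
  by rewrite adjC.
by rewrite eq_sym.
Qed.

Lemma wactM i p q w : wpos w -> i \in letters w -> 1 < p -> 1 < q ->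
  wact i p (wact i q w) = wact i (p * q) w.
Proof.
move=> w0 iw p1 q1; have e0 := weps_gt0 w0 iw.
have a0 : 0 < (q - 1) / weps i w by rewrite divr_gt0 ?subr_gt0.
rewrite /wact weps_xact // xactD //.
  by congr xact; have q0 := lt_trans ltr01 q1; field; rewrite addrC subrK; neq0.
have -> : 1 + (q - 1) / weps i w * weps i w = q by field; neq0.
by rewrite divr_gt0 ?subr_gt0 ?divr_gt0 // (lt_trans ltr01).
Qed.

Lemma wact_letters i p w : letters (wact i p w) = letters w.
Proof. exact: xact_letters. Qed.

Lemma wact_pos i p w : wpos w -> i \in letters w -> 1 < p ->
  wpos (wact i p w).
Proof.
by move=> w0 iw p1; apply: xact_pos; rewrite // divr_gt0 ?subr_gt0 ?weps_gt0.
Qed.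

(** ** Runs of crystal operators with monomial parameters *)

Variables (s t : F).
Hypotheses (s1 : 1 < s) (t1 : 1 < t).

(** A triple (i, (m, n)) is the operator e_i with parameter s^m t^n.  Keeping
   exponents rather than values turns the rewriting of runs into a
   computation on natural numbers. *)
Definition opstep := (nat * (nat * nat))%type.

Definition opar (u : opstep) := s ^+ u.2.1 * t ^+ u.2.2.

Definition run (r : seq opstep) w := foldr (fun u => wact u.1 (opar u)) w r.

Definition admissible (r : seq opstep) w :=
  wpos w && all (fun u => (u.1 \in letters w) && (0 < u.2.1 + u.2.2)%N) r.

Lemma opar_gt1 u : (0 < u.2.1 + u.2.2)%N -> 1 < opar u.
Proof.
case: u => l [[|m] [|n]] //= _; rewrite /opar /= ?expr0 ?mul1r ?mulr1;
  rewrite ?exprn_egt1 //.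
by rewrite mulr_egt1 // exprn_egt1.
Qed.

Lemma run_letters r w : letters (run r w) = letters w.
Proof. by elim: r => //= u r IH; rewrite wact_letters. Qed.

Lemma run_pos r w : admissible r w -> wpos (run r w).
Proof.
case/andP=> w0; elim: r => //= u r IH /andP[/andP[uw u1] rw].
by apply: wact_pos; rewrite ?run_letters ?opar_gt1 ?IH.
Qed.

(** The commutation relation and the Verma relation of type A2 as rewriting
   rules; a run to which neither applies is left alone. *)
Definition braid (r : seq opstep) : seq opstep :=
  match r with
  | u1 :: u2 :: r' =>
    if (u1.1 != u2.1) && ~~ adj u1.1 u2.1 then u2 :: u1 :: r' else
    if r' isn't u3 :: r'' then r else
    if [&& adj u1.1 u2.1, u3.1 == u1.1, u2.2.1 == u1.2.1 + u3.2.1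
         & u2.2.2 == u1.2.2 + u3.2.2]%N
    then (u2.1, u3.2) :: (u1.1, u2.2) :: (u2.1, u1.2) :: r'' else r
  | _ => r
  end.

Definition braid_at (k : nat) r := take k r ++ braid (drop k r).

Lemma run_cat r1 r2 w : run (r1 ++ r2) w = run r1 (run r2 w).
Proof. exact: foldr_cat. Qed.

Lemma run_braid r w : admissible r w -> run (braid r) w = run r w.
Proof.
case: r => [|u1 [|u2 r]] //=.
case: ifP => [/andP[u12 n12]|_] /andP[w0 /= /and3P[a1 a2 ar]].
  by rewrite wact_comm 1?adjC // eq_sym.
case: r ar => //= u3 r /andP[a3 ar].
case: ifP => // /and4P[a12 /eqP l3 /eqP m /eqP n].
rewrite /= l3; case/andP: a1 a2 a3 => l1 n1 /andP[l2 n2] /andP[_ n3].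
have rw0 : wpos (run r w) by apply: run_pos; rewrite /admissible w0.
have e2 : opar u2 = opar u1 * opar u3 by rewrite /opar m n !exprD; ring.
have := @wact_braid u1.1 u2.1 (opar u1) (opar u3) (run r w).
by rewrite -e2 !run_letters => ->; rewrite ?opar_gt1.
Qed.

Lemma admissible_braid r w : admissible r w -> admissible (braid r) w.
Proof.
case: r => [|u1 [|u2 r]] //=.
case: ifP => [_|_] /andP[w0 /= /and3P[a1 a2 ar]].
  by rewrite /admissible w0 /= a1 a2 ar.
case: r ar => [|u3 r] /=; first by rewrite /admissible w0 /= a1 a2.
case/andP=> a3 ar; case: ifP => [/and4P[_ /eqP l3 _ _]|_].
  move: a1 a2 a3; rewrite /admissible w0 /= ar l3.
  by move=> /andP[-> ->] /andP[-> ->] /andP[_ ->].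
by rewrite /admissible w0 /= a1 a2 a3 ar.
Qed.

Lemma run_braids ks r w : admissible r w ->
  run (foldl (fun r k => braid_at k r) r ks) w = run r w.
Proof.
elim: ks r => //= k ks IH r ar.
have [ar1 ar2] : admissible (take k r) w /\ admissible (drop k r) w.
  move: ar; rewrite /admissible -{1}(cat_take_drop k r) all_cat.
  by case/and3P=> -> -> ->.
rewrite IH /braid_at; first by rewrite run_cat run_braid // -run_cat cat_take_drop.
move: (admissible_braid ar2) ar1; rewrite /admissible all_cat.
by case/andP=> -> -> /andP[_ ->].
Qed.

End Words.

(** * Folding: the G2 relation inside D4 *)

(** The vertices 1, 3, 4 are pairwise disconnected, and each is joined to both 0
   and 2.  On 1, 2, 3, 4 this is D4, whose folding is G2; on 0, 1, 2 it is a
   chain, which is all that the actions of e_0 and e_1 depend on. *)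
Definition adj0134 : rel nat := fun i j =>
  (i \in [:: 0; 2]%N) && (j \in [:: 1; 3; 4]%N)
  || (i \in [:: 1; 3; 4]%N) && (j \in [:: 0; 2]%N).

Lemma adj0134C : ssrbool.symmetric adj0134.
Proof.
by move=> i j; rewrite /adj0134 orbC; congr (_ || _); apply: andbC.
Qed.

Lemma adj0134xx : irreflexive adj0134.
Proof. by move=> i; rewrite /adj0134 !inE; case: i => [|[|[|[|[|i]]]]]. Qed.

Section Folding.

Variable F : numFieldType.
Implicit Types (w : seq (nat * F)) (s t c : F).

Definition wact3 c w :=
  wact adj0134 1 c (wact adj0134 3 c (wact adj0134 4 c w)).

(** The two sides are runs of twelve operators in the simply laced diagram D4,
   and correspond to two reduced words of the longest element that are
   symmetric under triality, so braid moves lead from one to the other. *)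
Lemma wact3_braid s t w : wpos w -> 1 < s -> 1 < t ->
    all (fun i => i \in letters w) [:: 1; 2; 3; 4]%N ->
  let e2 := wact adj0134 2 in
  wact3 s (e2 (s ^+ 3 * t) (wact3 (s ^+ 2 * t)
    (e2 (s ^+ 3 * t ^+ 2) (wact3 (s * t) (e2 t w)))))
  = e2 t (wact3 (s * t) (e2 (s ^+ 3 * t ^+ 2)
      (wact3 (s ^+ 2 * t) (e2 (s ^+ 3 * t) (wact3 s w))))).
Proof.
move=> w0 s1 t1 /and5P[w1 w2 w3 w4 _] e2.
pose b3 m n : seq opstep := [:: (1, (m, n)); (3, (m, n)); (4, (m, n))]%N.
pose b2 m n : seq opstep := [:: (2, (m, n))]%N.
pose r1 := b3 1 0 ++ b2 3 1 ++ b3 2 1 ++ b2 3 2 ++ b3 1 1 ++ b2 0 1.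
pose r2 := b2 0 1 ++ b3 1 1 ++ b2 3 2 ++ b3 2 1 ++ b2 3 1 ++ b3 1 0.
have ad : admissible r1 w by rewrite /admissible w0 /= w1 w2 w3 w4.
(* the places of the moves along such a path, found by a graph search *)
have := run_braids adj0134C adj0134xx s1 t1
  [:: 4; 5; 4; 2; 6; 4; 3; 1; 3; 6; 5; 7; 9; 8; 6; 4; 3; 2; 0; 6; 4; 2; 4;
      8; 7; 5; 3; 5; 7; 6; 5]%N ad.
rewrite (_ : foldl _ _ _ = r2); last by vm_compute.
by rewrite /= /opar /= !expr0 !mulr1 mul1r.
Qed.

End Folding.

(** * The two products in coordinates *)

Ltac pos_coords px a0 a1 a2 a3 a4 a5 :=
  move: (px 0%N isT) (px 1%N isT) (px 2%N isT) (px 3%N isT) (px 4%N isT)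
    (px 5%N isT) => a0 a1 a2 a3 a4 a5.

Section Points.

Variable F : numFieldType.
Implicit Types (x y : 'rV[F]_6) (c d : F).

Definition co x (k : nat) : F := x 0 (inord k).

Definition vec6 (a0 a1 a2 a3 a4 a5 : F) : 'rV[F]_6 :=
  \row_j nth 0 [:: a0; a1; a2; a3; a4; a5] j.

Lemma co_vec6 a0 a1 a2 a3 a4 a5 k : (k < 6)%N ->
  co (vec6 a0 a1 a2 a3 a4 a5) k = nth 0 [:: a0; a1; a2; a3; a4; a5] k.
Proof. by move=> k6; rewrite /co mxE inordK. Qed.

Lemma vec6_co x :
  x = vec6 (co x 0) (co x 1) (co x 2) (co x 3) (co x 4) (co x 5).
Proof.
apply/rowP=> j; rewrite mxE; case: j => [[|[|[|[|[|[|//]]]]]] lj] /=;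
  by congr (x 0 _); apply/val_inj; rewrite /= inordK.
Qed.

Definition nz6 x := forall k, (k < 6)%N -> co x k != 0.
Definition pos6 x := forall k, (k < 6)%N -> 0 < co x k.

Lemma pos6_nz6 x : pos6 x -> nz6 x.
Proof. by move=> px k /px /lt0r_neq0. Qed.

Lemma pos6_vec6 a0 a1 a2 a3 a4 a5 :
  0 < a0 -> 0 < a1 -> 0 < a2 -> 0 < a3 -> 0 < a4 -> 0 < a5 ->
  pos6 (vec6 a0 a1 a2 a3 a4 a5).
Proof.
by move=> ? ? ? ? ? ? k k6; rewrite co_vec6 //; case: k k6 => [|[|[|[|[|[|]]]]]].
Qed.

(** ** Coordinates of the two products *)

Section Coordinates1.
Variable x : 'rV[F]_6.
Local Notation x0 := (co x 0).
Local Notation x1 := (co x 1).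
Local Notation x2 := (co x 2).
Local Notation x3 := (co x 3).
Local Notation x4 := (co x 4).
Local Notation x5 := (co x 5).

Definition qA := x5 + x4 / x3 + x3 ^+ 2 / x2.
Definition sA := x1 * qA + x3.
(** With [A2], [A3], [A0] and [A3b], the coordinates of V_1(x) on v_1, v_2, v_3,
   v_0 and v_{bar 3}; those on the other basis vectors are monomials. *)
Definition A1 := 1 + sA / x0 + x1 * x3 * x5 / x0 ^+ 2.
Definition pA := qA + 2 * x3 / x1 + x2 / x1 ^+ 2.
Definition A2 :=
  pA + (x3 * x5 + x2 * x5 / x1 + x2 * x4 / (x1 * x3)) / x0.
Definition A3 := x1 + x1 ^+ 2 * qA / x0.
Definition A0 := x0 / 2 + sA.
Definition A3b := x0 * pA.

Definition tA := x5 ^+ 2 / x4 + 2 * x5 / x3 + x4 / x3 ^+ 2 + x3 / x2 + x1^-1.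
Definition bA := x5 ^+ 3 / x4 + 3 * x5 ^+ 2 / x3 + 3 * x4 * x5 / x3 ^+ 2
  + x4 ^+ 2 / x3 ^+ 3 + 3 * x3 * x5 / x2 + 2 * x4 / x2 + x3 ^+ 3 / x2 ^+ 2.

(** With [yhat], the solution a, y of V_2(y) = a V_1(x).  It comes from the
   linear system of [prop12_linear] below; only its expanded form, free of
   subtractions, is used. *)
Definition yscale := x3 * x5 / (x2 * x4) + x5 / (x1 * x4) + (x1 * x3)^-1 + tA / x0.
Definition yhat1 := tA + (x1 * bA + 2 * qA + x3 / x1) / x0.
Definition yhat2 := bA + 3 * qA / x1 + 3 * x3 / x1 ^+ 2 + x2 / x1 ^+ 3.

Definition yhat := vec6 (yscale * x0) yhat1 yhat2 (yscale * A1 / yhat1)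
  (x2 * x4 * yscale ^+ 3 / yhat2) (yscale * (x1 * x3 * x5) / A1).

Hypothesis nx : nz6 x.
Let n0 : x0 != 0 := @nx 0%N isT.
Let n1 : x1 != 0 := @nx 1%N isT.
Let n2 : x2 != 0 := @nx 2%N isT.
Let n3 : x3 != 0 := @nx 3%N isT.
Let n4 : x4 != 0 := @nx 4%N isT.
Let n5 : x5 != 0 := @nx 5%N isT.

Ltac nz := rewrite ?n0 ?n1 ?n2 ?n3 ?n4 ?n5 //.
Ltac unf := rewrite /yscale /yhat1 /yhat2 /A3b /A1 /A2 /A3 /A0 /pA /sA /tA /bA /qA.

Lemma A1E : x1 * x3 * x5 + x0 * sA + x0 ^+ 2 = x0 ^+ 2 * A1.
Proof. by unf; field; nz. Qed.

Lemma yhat2_A1 : yhat2 * A1 + x2 * x4 * yscale ^+ 2 = yhat1 * A2.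
Proof. by unf; field; nz. Qed.

Lemma yhat1E : yhat1 + x1 * x3 * x5 * A2 / (x2 * x4) = yscale * sA.
Proof. by unf; field; nz. Qed.

Lemma yhat2_A3 : yhat1 * sA + A2 - x1 * x3 * x5 * yscale = A3 * yhat2.
Proof. by unf; field; nz. Qed.

Lemma A3bA1 : (x0 + sA) * A2 - x2 * x4 * yscale = A3b * A1.
Proof. by unf; field; nz. Qed.

(** Both products lie on the quadric where v_1 v_{bar 1} - v_2 v_{bar 2}
   + v_3 v_{bar 3} equals v_0^2 plus 3/4 of the square of the coordinate on the
   empty set.  It recovers one coordinate from the others. *)
Lemma quadric1 : A1 * x0 ^+ 2 - A2 * (x0 * x1) + A3 * A3b
  = A0 ^+ 2 + 3 / 4 * x0 ^+ 2.
Proof. by unf; field; nz. Qed.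

End Coordinates1.

Section Coordinates2.
Variable y : 'rV[F]_6.
Local Notation y0 := (co y 0).
Local Notation y1 := (co y 1).
Local Notation y2 := (co y 2).
Local Notation y3 := (co y 3).
Local Notation y4 := (co y 4).
Local Notation y5 := (co y 5).

Definition sB := y1 + y3 * y5 + y1 * y3 ^+ 2 * y5 / y4.
(** [B1], [B2], [B3], [B0], [B3b], [B2b] and [B1b] are the coordinates of V_2(y)
   on v_1, v_2, v_3, v_0, v_{bar 3}, v_{bar 2} and v_{bar 1}. *)
Definition B1 := y1 * y3.
Definition B2 := y2 * (y3 + y4 / y1).
Definition B3 := B1 ^+ 2 * y5 / (y2 * y4) + y1 ^+ 2 / y2 + y3 + y4 / y1.
Definition B0 := y0 / 2 + sB.
Definition B3b := y0 * B2 / B1 + y2 + y5 * B2 ^+ 2 / (y2 * y4).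
Definition B2b := y0 * B3 / B1 + 1 + y1 * y5 / y2 + y5 * (y3 + y4 / y1) ^+ 2 / y4.
Definition B1b := y5 + y0 * (sB + y0) / B1.

(** The polynomial combinations of coordinates in [hBE] and [kBE] have no visible
   sign; [hB] and [kB] are their subtraction-free expansions, on which the
   positivity of the inverse map rests. *)
Definition hB :=
  y0 * (y1 * y5 / y2 + y3 ^+ 2 * y5 / y4 + 1 + 2 * y3 * y5 / y1
        + y4 * y5 / y1 ^+ 2)
  + (y1 * y3 ^+ 4 * y5 ^+ 2 / y4 ^+ 2 + 2 * y1 * y3 ^+ 2 * y5 / y4 + y1
     + y1 * y3 * y5 ^+ 2 / y2 + 3 * y3 ^+ 3 * y5 ^+ 2 / y4 + 2 * y3 * y5
     + 3 * y3 ^+ 2 * y5 ^+ 2 / y1 + y3 * y4 * y5 ^+ 2 / y1 ^+ 2).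
Definition kB :=
  y1 ^+ 3 * y3 ^+ 6 * y5 ^+ 3 / (y2 * y4 ^+ 3)
  + 3 * y1 ^+ 3 * y3 ^+ 4 * y5 ^+ 2 / (y2 * y4 ^+ 2)
  + 3 * y1 ^+ 3 * y3 ^+ 2 * y5 / (y2 * y4)
  + y1 ^+ 3 / y2 + y1 ^+ 3 * y3 ^+ 3 * y5 ^+ 3 / (y2 ^+ 2 * y4)
  + 3 * y1 ^+ 2 * y3 ^+ 5 * y5 ^+ 3 / (y2 * y4 ^+ 2)
  + 3 * y1 ^+ 2 * y3 ^+ 3 * y5 ^+ 2 / (y2 * y4)
  + 3 * y1 * y3 ^+ 4 * y5 ^+ 3 / (y2 * y4) + y4 + y3 ^+ 3 * y5 ^+ 3 / y2.

Definition xhat := vec6 (B1b / y0) (B2b / y0)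
  ((hB ^+ 3 + y2 * y4 * B2b ^+ 3) / (y0 ^+ 3 * kB))
  (B1b * hB / (y0 ^+ 2 * B2b))
  (B1b ^+ 3 * (y2 * y4) / (y0 ^+ 3 * ((hB ^+ 3 + y2 * y4 * B2b ^+ 3) / kB)))
  (y1 * y3 * y5 * B1b / (y0 * hB)).

Hypothesis ny : nz6 y.
Let n0 : y0 != 0 := @ny 0%N isT.
Let n1 : y1 != 0 := @ny 1%N isT.
Let n2 : y2 != 0 := @ny 2%N isT.
Let n3 : y3 != 0 := @ny 3%N isT.
Let n4 : y4 != 0 := @ny 4%N isT.
Let n5 : y5 != 0 := @ny 5%N isT.

Ltac nz := rewrite ?n0 ?n1 ?n2 ?n3 ?n4 ?n5 //.
Ltac unf := rewrite /hB /kB /B1b /B2b /B3b /B0 /B3 /B2 /B1 /sB.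

Lemma B1E : y0 ^+ 2 + y0 * sB + y1 * y3 * y5 = B1b * B1.
Proof. by unf; field; nz. Qed.

Lemma hBE : hB = (sB + y0) * B2b - B3 * B1b.
Proof. by unf; field; nz. Qed.

Lemma kBE : hB * (sB * B2b - hB) = y1 * y3 * y5 * B2b ^+ 2 + kB * B1b.
Proof. by unf; field; nz. Qed.

Lemma kB_B3b : kB * B3b =
  y2 * y4 * B2b + hB * sB ^+ 2 - y1 * y3 * y5 * B2b * sB - y1 * y3 * y5 * hB.
Proof. by unf; field; nz. Qed.

Lemma quadric2 : B1 * B1b - B2 * B2b + B3 * B3b = B0 ^+ 2 + 3 / 4 * y0 ^+ 2.
Proof. by unf; field; nz. Qed.

End Coordinates2.

(** ** Positivity *)

Section Positivity.
Variable x : 'rV[F]_6.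
Hypothesis px : pos6 x.
Let p0 : 0 < co x 0 := @px 0%N isT.
Let p1 : 0 < co x 1 := @px 1%N isT.
Let p2 : 0 < co x 2 := @px 2%N isT.
Let p3 : 0 < co x 3 := @px 3%N isT.
Let p4 : 0 < co x 4 := @px 4%N isT.
Let p5 : 0 < co x 5 := @px 5%N isT.

Lemma qA_gt0 : 0 < qA x. Proof. by rewrite /qA; pos. Qed.
Lemma sA_gt0 : 0 < sA x. Proof. by have := qA_gt0; rewrite /sA => ?; pos. Qed.
Lemma A1_gt0 : 0 < A1 x. Proof. by have := sA_gt0; rewrite /A1 => ?; pos. Qed.
Lemma A2_gt0 : 0 < A2 x.
Proof. by have := qA_gt0; rewrite /A2 /pA => ?; pos. Qed.
Lemma yscale_gt0 : 0 < yscale x. Proof. by rewrite /yscale /tA; pos. Qed.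
Lemma yhat1_gt0 : 0 < yhat1 x.
Proof. by have := qA_gt0; rewrite /yhat1 /tA /bA => ?; pos. Qed.
Lemma yhat2_gt0 : 0 < yhat2 x.
Proof. by have := qA_gt0; rewrite /yhat2 /bA => ?; pos. Qed.

Lemma yhat_pos : pos6 (yhat x).
Proof.
have := A1_gt0; have := yscale_gt0; have := yhat1_gt0; have := yhat2_gt0.
by move=> ? ? ? ?; apply: pos6_vec6; pos.
Qed.

Lemma B1_gt0 : 0 < B1 x. Proof. by rewrite /B1; pos. Qed.
Lemma B2b_gt0 : 0 < B2b x. Proof. by rewrite /B2b /B3 /B1; pos. Qed.
Lemma B1b_gt0 : 0 < B1b x. Proof. by rewrite /B1b /sB /B1; pos. Qed.
Lemma hB_gt0 : 0 < hB x. Proof. by rewrite /hB; pos. Qed.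
Lemma kB_gt0 : 0 < kB x. Proof. by rewrite /kB; pos. Qed.

Lemma xhat_pos : pos6 (xhat x).
Proof.
have := B1b_gt0; have := B2b_gt0; have := hB_gt0; have := kB_gt0.
by move=> ? ? ? ?; apply: pos6_vec6; pos.
Qed.

End Positivity.

(** ** Proportionality of the two products *)

(** The equation V_2(y) = a V_1(x), with the coordinate on v_0 diminished by
   half of that on the empty set. *)
Definition prop12 a x y :=
  [/\ B1 y = a * A1 x, B2 y = a * A2 x, B3 y = a * A3 x & sB y = a * sA x] /\
  [/\ co y 0 = a * co x 0, B3b y = a * A3b x, B2b y = a * (co x 0 * co x 1)
    & B1b y = a * co x 0 ^+ 2].

(** Seven coordinates follow from the identities above; the remaining one, on
   v_{bar 2}, follows from the quadric. *)
Lemma yhat_prop x : pos6 x -> prop12 (yscale x) x (yhat x).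
Proof.
move=> px; have nx := pos6_nz6 px.
pos_coords px p0 p1 p2 p3 p4 p5.
have a0 := yscale_gt0 px; have y10 := yhat1_gt0 px; have y20 := yhat2_gt0 px.
have A10 := A1_gt0 px; have A20 := A2_gt0 px.
have e2 : A2 x = (yhat2 x * A1 x + co x 2 * co x 4 * yscale x ^+ 2) / yhat1 x.
  by rewrite yhat2_A1 //; field; neq0.
have eS : sA x = (yhat1 x + co x 1 * co x 3 * co x 5 * A2 x
                   / (co x 2 * co x 4)) / yscale x.
  by rewrite yhat1E //; field; neq0.
have b1 : B1 (yhat x) = yscale x * A1 x.
  by rewrite /B1 !co_vec6 //=; field; neq0.
have b2 : B2 (yhat x) = yscale x * A2 x.
  by rewrite e2 /B2 !co_vec6 //=; field; neq0.
have bS : sB (yhat x) = yscale x * sA x.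
  by rewrite eS e2 /sB !co_vec6 //=; field; neq0.
have b3 : B3 (yhat x) = yscale x * A3 x.
  have -> : A3 x = (yhat1 x * sA x + A2 x
                - co x 1 * co x 3 * co x 5 * yscale x) / yhat2 x.
    by rewrite yhat2_A3 //; field; neq0.
  by rewrite eS e2 /B3 b1 !co_vec6 //=; field; neq0.
have b3b : B3b (yhat x) = yscale x * A3b x.
  have -> : A3b x = ((co x 0 + sA x) * A2 x
                - co x 2 * co x 4 * yscale x) / A1 x.
    by rewrite A3bA1 //; field; neq0.
  rewrite /B3b b1 b2 !co_vec6 //= eS e2; field; neq0.
have b1b : B1b (yhat x) = yscale x * co x 0 ^+ 2.
  have -> : co x 0 ^+ 2 = (co x 1 * co x 3 * co x 5 + co x 0 * (sA x + co x 0))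
                         / A1 x.
    have -> : co x 1 * co x 3 * co x 5 + co x 0 * (sA x + co x 0) =
      co x 0 ^+ 2 * A1 x by rewrite -A1E //; ring.
    by field; neq0.
  by rewrite /B1b b1 bS !co_vec6 //=; field; neq0.
split; split=> //; first by rewrite co_vec6.
have a0' := lt0r_neq0 a0; have A20' := lt0r_neq0 A20.
apply: (mulfI (mulf_neq0 a0' A20')); rewrite -b2.
have py := yhat_pos px; have := quadric2 (pos6_nz6 py).
rewrite b1 b1b b3 b3b /B0 bS co_vec6 //= => eq2.
have {eq2} -> : B2 (yhat x) * B2b (yhat x) = yscale x ^+ 2 *
    (A1 x * co x 0 ^+ 2 + A3 x * A3b x - (A0 x ^+ 2 + 3 / 4 * co x 0 ^+ 2)).
  apply/eqP; rewrite eq_sym -subr_eq0 /A0; apply/eqP.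
  move/eqP: eq2; rewrite -subr_eq0 => /eqP eq2; rewrite -[RHS]eq2.
  by field.
by rewrite -quadric1 // b2; ring.
Qed.

End Points.

(** * Uniqueness of the proportionality, and the inverse map *)

Section LinearCombinations.
Variables (A : pzRingType) (l r l1 r1 l2 r2 l3 r3 k1 k2 k3 : A).

(** An equation is deduced from others by exhibiting the multipliers, after
   which a polynomial identity remains. *)
Lemma lincomb1 : l1 = r1 -> l - r = k1 * (l1 - r1) -> l = r.
Proof. by move=> ->; rewrite subrr mulr0 => /subr0_eq. Qed.

Lemma lincomb2 : l1 = r1 -> l2 = r2 ->
  l - r = k1 * (l1 - r1) + k2 * (l2 - r2) -> l = r.
Proof. by move=> -> ->; rewrite !subrr !mulr0 addr0 => /subr0_eq. Qed.

Lemma lincomb3 : l1 = r1 -> l2 = r2 -> l3 = r3 ->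
  l - r = k1 * (l1 - r1) + k2 * (l2 - r2) + k3 * (l3 - r3) -> l = r.
Proof. by move=> -> -> ->; rewrite !subrr !mulr0 !addr0 => /subr0_eq. Qed.

End LinearCombinations.

Arguments lincomb1 {A l r l1 r1} k1.
Arguments lincomb2 {A l r l1 r1 l2 r2} k1 k2.
Arguments lincomb3 {A l r l1 r1 l2 r2 l3 r3} k1 k2 k3.

Section Inverse.
Variable F : numFieldType.
Implicit Types (x y : 'rV[F]_6) (a c d : F).

(** On v_2 the equation is again left to the quadric. *)
Lemma xhat_prop y : pos6 y -> prop12 (co y 0 ^+ 2 / B1b y) (xhat y) y.
Proof.
move=> py; have ny := pos6_nz6 py.
pos_coords py p0 p1 p2 p3 p4 p5.
have B1b0 := B1b_gt0 py; have B2b0 := B2b_gt0 py; have B10 := B1_gt0 py.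
have h0 := hB_gt0 py; have k0 := kB_gt0 py.
have eq : qA (xhat y) = B1b y * (sB y * B2b y - hB y) / (co y 0 * B2b y ^+ 2).
  have -> : sB y * B2b y - hB y =
    (co y 1 * co y 3 * co y 5 * B2b y ^+ 2 + kB y * B1b y) / hB y.
    by rewrite -kBE //; field; neq0.
  by rewrite /qA !co_vec6 //=; field; neq0.
have eS' : sA (xhat y) = sB y * B1b y / co y 0 ^+ 2.
  by rewrite /sA eq !co_vec6 //=; field; neq0.
have eS : sB y = co y 0 ^+ 2 / B1b y * sA (xhat y).
  by rewrite eS'; field; neq0.
have e1 : B1 y = co y 0 ^+ 2 / B1b y * A1 (xhat y).
  have -> : B1 y = (co y 0 ^+ 2 + co y 0 * sB y + co y 1 * co y 3 * co y 5)
                   / B1b y by rewrite B1E //; field; neq0.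
  by rewrite /A1 eS' !co_vec6 //=; field; neq0.
have e3 : B3 y = co y 0 ^+ 2 / B1b y * A3 (xhat y).
  have -> : B3 y = ((sB y + co y 0) * B2b y - hB y) / B1b y.
    by rewrite hBE //; field; neq0.
  by rewrite /A3 eq !co_vec6 //=; field; neq0.
have e3b : B3b y = co y 0 ^+ 2 / B1b y * A3b (xhat y).
  have -> : B3b y = (co y 2 * co y 4 * B2b y + hB y * sB y ^+ 2
     - co y 1 * co y 3 * co y 5 * B2b y * sB y
     - co y 1 * co y 3 * co y 5 * hB y) / kB y.
    by rewrite -kB_B3b //; field; neq0.
  rewrite /A3b /pA eq !co_vec6 //=.
  have eM : co y 1 * co y 3 * co y 5 =
      (hB y * (sB y * B2b y - hB y) - kB y * B1b y) / B2b y ^+ 2.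
    by rewrite kBE //; field; neq0.
  by rewrite eM; field; neq0.
have px := xhat_pos py; have nx := pos6_nz6 px.
split; split=> //; first last.
- by rewrite !co_vec6 //=; field; neq0.
- by rewrite !co_vec6 //=; field; neq0.
- by rewrite !co_vec6 //=; field; neq0.
have e2b : B2b y = co y 0 ^+ 2 / B1b y * (co (xhat y) 0 * co (xhat y) 1).
  by rewrite !co_vec6 //=; field; neq0.
have e1b : B1b y = co y 0 ^+ 2 / B1b y * co (xhat y) 0 ^+ 2.
  by rewrite !co_vec6 //=; field; neq0.
have e0 : B0 y = co y 0 ^+ 2 / B1b y * A0 (xhat y).
  by rewrite /A0 eS' /B0 !co_vec6 //=; field; neq0.
have ey0 : co y 0 = co y 0 ^+ 2 / B1b y * co (xhat y) 0.
  by rewrite !co_vec6 //=; field; neq0.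
apply: (mulIf (lt0r_neq0 B2b0)).
move: e1 e3 e3b e0 ey0 e1b e2b (quadric1 nx) (quadric2 ny).
move: (co y 0 ^+ 2 / B1b y) => a -> -> -> -> -> -> -> q1 q2.
by apply: (lincomb2 (a ^+ 2) (-1) q1 q2); ring.
Qed.

(** The coordinates y_0, y_3, y_4, y_5 are explicit in y_1, y_2 and a, and after
   their elimination the system is linear in the remaining three unknowns. *)
Lemma prop12_linear a x y : nz6 x -> nz6 y -> A1 x != 0 -> a != 0 ->
    prop12 a x y ->
  [/\ co y 1 * sA x = A3 x * co y 2 - A2 x + a * (co x 1 * co x 3 * co x 5),
      (co x 0 * co x 1 * A1 x - co x 0 * A3 x) * co y 2 =
      A3b x * A1 x - co x 0 * A2 x + co x 1 * co x 3 * co x 5 * co y 1 &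
      a * (co x 2 * co x 4 * yscale x) = co y 1 * A2 x - co y 2 * A1 x] /\
  [/\ co y 0 = a * co x 0, co y 3 = a * A1 x / co y 1,
      co y 4 = a * A2 x * co y 1 / co y 2 - a * A1 x &
      co y 5 = a * (co x 1 * co x 3 * co x 5) / A1 x].
Proof.
move=> nx ny nA na [[e1 e2 e3 eS] [ey0 e3b e2b e1b]].
have [m0 m1 m2] : [/\ co x 0 != 0, co x 1 != 0 & co x 2 != 0]
  by split; apply: nx.
have [m3 m4 m5] : [/\ co x 3 != 0, co x 4 != 0 & co x 5 != 0]
  by split; apply: nx.
have [n0 n1 n2] : [/\ co y 0 != 0, co y 1 != 0 & co y 2 != 0]
  by split; apply: ny.
have [n3 n4 n5] : [/\ co y 3 != 0, co y 4 != 0 & co y 5 != 0]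
  by split; apply: ny.
have f1 : co y 1 * sB y = B3 y * co y 2 - B2 y + B1 y * co y 5.
  by rewrite /sB /B3 /B2 /B1; field; rewrite n1 n2 n4.
have f2 : co y 2 * (B2b y * B1 y - co y 0 * B3 y)
    = B3b y * B1 y - co y 0 * B2 y + B1 y * co y 1 * co y 5.
  by rewrite /B2b /B3b /B3 /B2 /B1; field; rewrite n1 n2 n3 n4.
have f3 : sB y * B2 y =
    co y 1 * B2 y + B3b y * B1 y - co y 0 * B2 y - B1 y * co y 2.
  by rewrite /sB /B3b /B2 /B1; field; rewrite n1 n2 n3 n4.
have y3 : co y 3 = a * A1 x / co y 1 by rewrite -e1 /B1; field.
have y4 : co y 4 = a * A2 x * co y 1 / co y 2 - a * A1 x.
  by rewrite -e2 -e1 /B2 /B1; field; rewrite n1 n2.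
have y5 : co y 5 = a * (co x 1 * co x 3 * co x 5) / A1 x.
  move: (A1E nx) (B1E ny); rewrite e1b e1 ey0 eS y3 => g1 g2.
  have {g2} g2 : a * A1 x * co y 5 = a ^+ 2 * (co x 0 ^+ 2 * A1 x
      - co x 0 * sA x - co x 0 ^+ 2).
    rewrite [X in _ = X](_ : _ = a * co x 0 ^+ 2 * (a * A1 x)
      - ((a * co x 0) ^+ 2 + a * co x 0 * (a * sA x))); last by ring.
    by rewrite -g2; field.
  apply: (mulfI (mulf_neq0 na nA)); rewrite g2 -g1; by field.
split; split=> //.
- apply: (mulfI na); rewrite mulrCA -eS f1 y5 e1 e2 e3; by field.
- apply: (mulfI (mulf_neq0 na na)).
  transitivity (co y 2 * (B2b y * B1 y - co y 0 * B3 y)).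
    by rewrite e1 e2b e3 ey0; ring.
  by rewrite f2 e1 e2 e3b ey0 y5; field.
apply: (mulfI na); transitivity (a * a * ((co x 0 + sA x) * A2 x
    - A3b x * A1 x)); first by rewrite -A3bA1 //; ring.
rewrite (_ : _ * _ = sB y * B2 y + co y 0 * B2 y - B3b y * B1 y).
  by rewrite f3 e1 e2; ring.
by rewrite e1 e2 e3b eS ey0; ring.
Qed.

(** The determinant of the linear system is x_2 x_4 times [A1 x * sA x]. *)
Lemma prop12_inj a a' x y y' : nz6 x -> nz6 y -> nz6 y' ->
    A1 x != 0 -> sA x != 0 -> a != 0 -> a' != 0 ->
  prop12 a x y -> prop12 a' x y' -> a = a' /\ y = y'.
Proof.
move=> nx ny ny' nA nS na na' P P'.
have [[f1 f2 f3] [e0 e3 e4 e5]] := prop12_linear nx ny nA na P.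
have [[f1' f2' f3'] [e0' e3' e4' e5']] := prop12_linear nx ny' nA na' P'.
have [m0 m1 m2] : [/\ co x 0 != 0, co x 1 != 0 & co x 2 != 0]
  by split; apply: nx.
have [m3 m4 m5] : [/\ co x 3 != 0, co x 4 != 0 & co x 5 != 0]
  by split; apply: nx.
pose M := co x 1 * co x 3 * co x 5.
pose m := co x 2 * co x 4 * yscale x.
pose W := co x 0 * co x 1 * A1 x - co x 0 * A3 x.
have r1 : sA x * (co y 1 - co y' 1) - A3 x * (co y 2 - co y' 2) - M * (a - a') = 0.
  by apply: (lincomb2 1 (-1) f1 f1'); rewrite /M; ring.
have r2 : M * (co y 1 - co y' 1) - W * (co y 2 - co y' 2) = 0.
  by apply: (lincomb2 (-1) 1 f2 f2'); rewrite /M /W; ring.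
have r3 : A2 x * (co y 1 - co y' 1) - A1 x * (co y 2 - co y' 2) - m * (a - a') = 0.
  by apply: (lincomb2 (-1) 1 f3 f3'); rewrite /m; ring.
pose det := m * (sA x * W - A3 x * M) - M * (W * A2 x - M * A1 x).
have detE : det = co x 2 * co x 4 * (A1 x * sA x).
  rewrite /det /m /M /W /yscale /A2 /A3 /A1 /pA /sA /qA /tA; field.
  by rewrite m0 m1 m2 m3 m4.
have det0 : det != 0 by rewrite detE !mulf_neq0.
(* Cramer's rule: the multipliers are the cofactors of the system *)
have d1 : co y 1 - co y' 1 = 0.
  apply: (mulfI det0); rewrite mulr0.
  apply: (lincomb3 (W * m) (M * A1 x - A3 x * m) (- (M * W)) r1 r2 r3).
  by rewrite /det; ring.
have d2 : co y 2 - co y' 2 = 0.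
  apply: (mulfI det0); rewrite mulr0.
  apply: (lincomb3 (M * m) (M * A2 x - sA x * m) (- M ^+ 2) r1 r2 r3).
  by rewrite /det; ring.
have da : a - a' = 0.
  apply: (mulfI det0); rewrite mulr0.
  apply: (lincomb3 (W * A2 x - M * A1 x) (sA x * A1 x - A3 x * A2 x)
    (A3 x * M - sA x * W) r1 r2 r3).
  by rewrite /det; ring.
move: (subr0_eq d1) (subr0_eq d2) (subr0_eq da) => {}d1 {}d2 {}da.
split=> //; rewrite [LHS]vec6_co [RHS]vec6_co.
by rewrite e0 e3 e4 e5 e0' e3' e4' e5' d1 d2 da.
Qed.

(** V_2(y) is proportional to V_1 at [xhat y], and so is V_2 at the image of
   [xhat y]; uniqueness identifies the two arguments. *)
Lemma yhatK y : pos6 y -> yhat (xhat y) = y.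
Proof.
move=> py; have px := xhat_pos py; have nx := pos6_nz6 px.
have a0 : co y 0 ^+ 2 / B1b y != 0.
  by have := B1b_gt0 py; have := py _ (isT : (0 < 6)%N) => ? ?; neq0.
have [//] := prop12_inj nx (pos6_nz6 (yhat_pos px)) (pos6_nz6 py)
  (lt0r_neq0 (A1_gt0 px)) (lt0r_neq0 (sA_gt0 px))
  (lt0r_neq0 (yscale_gt0 px)) a0 (yhat_prop px) (xhat_prop py).
Qed.

Lemma hB_yhat x : pos6 x ->
  hB (yhat x) = yscale x ^+ 2 * (co x 0 * co x 1 * co x 3).
Proof.
move=> px; have [[e1 e2 e3 eS] [ey0 e3b e2b e1b]] := yhat_prop px.
have [p0 p1] : 0 < co x 0 /\ 0 < co x 1 by split; apply: px.
have py := yhat_pos px; rewrite hBE ?e1b ?e2b ?e3 ?eS ?ey0; last exact: pos6_nz6.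
by rewrite /sA /A3; field; neq0.
Qed.

Lemma kB_yhat x : pos6 x -> kB (yhat x) =
  yscale x ^+ 3 * co x 1 ^+ 3 * (co x 4 + co x 3 ^+ 3 / co x 2).
Proof.
move=> px; have [[e1 e2 e3 eS] [ey0 e3b e2b e1b]] := yhat_prop px.
pos_coords px p0 p1 p2 p3 p4 p5.
have a0 := yscale_gt0 px; have A10 := A1_gt0 px.
have y10 := yhat1_gt0 px; have y20 := yhat2_gt0 px.
have ny := pos6_nz6 (yhat_pos px).
have b0 : yscale x * co x 0 ^+ 2 != 0 by neq0.
apply: (mulIf b0); rewrite -{1}e1b; move: (kBE ny).
rewrite hB_yhat // e1b e2b eS !co_vec6 //= => e.
apply: (lincomb1 (-1) e); rewrite /sA /qA; field; neq0.
Qed.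

Lemma xhatK x : pos6 x -> xhat (yhat x) = x.
Proof.
move=> px; have [[e1 e2 e3 eS] [ey0 e3b e2b e1b]] := yhat_prop px.
pos_coords px p0 p1 p2 p3 p4 p5.
have a0 := yscale_gt0 px; have A10 := A1_gt0 px.
have y10 := yhat1_gt0 px; have y20 := yhat2_gt0 px.
rewrite [RHS]vec6_co /xhat hB_yhat // kB_yhat // e1b e2b !co_vec6 //=.
congr vec6; field; neq0.
Qed.

End Inverse.

(** * The crystal operators at positive points *)

Section Operators.
Variable F : numFieldType.
Implicit Types (x y : 'rV[F]_6) (a b c d s t : F).

(** Left multiplication of the first product by x_1(s), and in [unip1y] of the
   second one. *)
Definition unip1x s x :=
  let a := s * co x 0 in
  let b := a / (co x 1 * (co x 1 + a)) * co x 2 in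
  let d := b / (co x 3 * (co x 3 + b)) * co x 4 in
  vec6 (co x 0) (co x 1 + a) (co x 2) (co x 3 + b) (co x 4) (co x 5 + d).

Definition unip1y s y :=
  let a := s * co y 2 in
  let b := a / (co y 1 * (co y 1 + a)) * co y 4 in
  let d := b / (co y 3 * (co y 3 + b)) * co y 0 in
  vec6 (co y 0) (co y 1 + a) (co y 2) (co y 3 + b) (co y 4) (co y 5 + d).

Definition ep0 x := A1 x / co x 0.
Definition ep1 x := co x 0 / co x 1
  + co x 0 * co x 2 / (co x 1 ^+ 2 * co x 3)
  + co x 0 * co x 2 * co x 4 / (co x 1 ^+ 2 * co x 3 ^+ 2 * co x 5).
Definition ep2 x := co x 1 ^+ 3 / co x 2
  + co x 1 ^+ 3 * co x 3 ^+ 3 / (co x 2 ^+ 2 * co x 4).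
Definition ep1y y := co y 2 / co y 1
  + co y 2 * co y 4 / (co y 1 ^+ 2 * co y 3)
  + co y 2 * co y 4 * co y 0 / (co y 1 ^+ 2 * co y 3 ^+ 2 * co y 5).

Definition e1y c y := unip1y ((c - 1) / ep1y y) y.
Definition e0y c y :=
  vec6 (c * co y 0) (co y 1) (co y 2) (co y 3) (co y 4) (co y 5).

Definition e1x c x := unip1x ((c - 1) / ep1 x) x.
(** Written with the product x_2 x_4 and the sum x_4 + x_3^3 / x_2 in mind:
   the action multiplies the former by c and fixes the latter. *)
Definition e2x c x :=
  let r := (c * (co x 2 * co x 4) + co x 3 ^+ 3)
           / (co x 2 * co x 4 + co x 3 ^+ 3) in
  vec6 (co x 0) (co x 1) (r * co x 2) (co x 3) (c / r * co x 4) (co x 5).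
Definition e0x c x := xhat (e0y c (yhat x)).

(** The word on D4 that folds to the first product: each Y_1 becomes a product
   of commuting factors at the three branches, and the exponent 3 of the
   G2 Cartan matrix counts these branches. *)
Definition foldw x : seq (nat * F) :=
  [:: (0, co x 0); (1, co x 1); (3, co x 1); (4, co x 1); (2, co x 2);
      (1, co x 3); (3, co x 3); (4, co x 3); (2, co x 4);
      (1, co x 5); (3, co x 5); (4, co x 5)]%N.

Definition word1 x : seq (nat * F) :=
  [:: (0, co x 0); (1, co x 1); (2, co x 2); (1, co x 3); (2, co x 4);
      (1, co x 5)]%N.

Definition word2 y : seq (nat * F) :=
  [:: (2, co y 2); (1, co y 1); (2, co y 4); (1, co y 3); (0, co y 0);
      (1, co y 5)]%N.

Section Positive.
Variable x : 'rV[F]_6.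
Hypothesis px : pos6 x.
Let p0 : 0 < co x 0 := @px 0%N isT.
Let p1 : 0 < co x 1 := @px 1%N isT.
Let p2 : 0 < co x 2 := @px 2%N isT.
Let p3 : 0 < co x 3 := @px 3%N isT.
Let p4 : 0 < co x 4 := @px 4%N isT.
Let p5 : 0 < co x 5 := @px 5%N isT.

Lemma ep1_gt0 : 0 < ep1 x. Proof. by rewrite /ep1; pos. Qed.
Lemma ep1y_gt0 : 0 < ep1y x. Proof. by rewrite /ep1y; pos. Qed.

Lemma unip1x_pos s : 0 < s -> pos6 (unip1x s x).
Proof. by move=> s0; apply: pos6_vec6; pos. Qed.

Lemma unip1y_pos s : 0 < s -> pos6 (unip1y s x).
Proof. by move=> s0; apply: pos6_vec6; pos. Qed.

(** The matrix of x_1(s) in the representation: the coordinates of the product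
   change by the same linear map here and in [unip1yE]. *)
Lemma unip1xE s : 0 < s ->
  [/\ A1 (unip1x s x) = A1 x + s * A2 x,
      A2 (unip1x s x) = A2 x,
      A3 (unip1x s x) = A3 x + s * (co x 0 + 2 * sA x) + s ^+ 2 * A3b x &
      sA (unip1x s x) = sA x + s * A3b x] /\
  [/\ co (unip1x s x) 0 = co x 0, A3b (unip1x s x) = A3b x &
      co (unip1x s x) 1 = co x 1 + s * co x 0].
Proof.
move=> s0; do 2 split; rewrite /A1 /A2 /A3 /A3b /pA /sA /qA !co_vec6 //=; field.
all: neq0.
Qed.

Lemma unip1yE s : 0 < s ->
  [/\ B1 (unip1y s x) = B1 x + s * B2 x,
      B2 (unip1y s x) = B2 x,
      B3 (unip1y s x) = B3 x + s * (co x 0 + 2 * sB x) + s ^+ 2 * B3b x &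
      sB (unip1y s x) = sB x + s * B3b x] /\
  [/\ co (unip1y s x) 0 = co x 0, B3b (unip1y s x) = B3b x,
      B2b (unip1y s x) = B2b x + s * B1b x & B1b (unip1y s x) = B1b x].
Proof.
move=> s0; do 2 split;
  rewrite /B1b /B2b /B3b /B3 /B2 /B1 /sB !co_vec6 //=; field.
all: neq0.
Qed.

Lemma ep1_yhat : ep1y (yhat x) = ep1 x.
Proof.
have [[e1 e2 e3 eS] [ey0 e3b e2b e1b]] := yhat_prop px.
have a0 := yscale_gt0 px; have A10 := A1_gt0 px.
have y10 := yhat1_gt0 px; have y20 := yhat2_gt0 px.
have -> : ep1y (yhat x) =
    (A2 x + yscale x * co x 0 * co x 2 * co x 4 / (co x 1 * co x 3 * co x 5))
      / A1 x.
  have -> : A2 x = B2 (yhat x) / yscale x by rewrite e2; field; neq0.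
  by rewrite /ep1y /B2 !co_vec6 //=; field; neq0.
apply: (mulIf (lt0r_neq0 A10)); rewrite divfK ?lt0r_neq0 //.
by rewrite /ep1 /yscale /tA /A2 /A1 /pA /sA /qA; field; neq0.
Qed.

Lemma foldw_pos : wpos (foldw x). Proof. by rewrite /wpos /= !px. Qed.
Lemma word1_pos : wpos (word1 x). Proof. by rewrite /wpos /= !px. Qed.
Lemma word2_pos : wpos (word2 x). Proof. by rewrite /wpos /= !px. Qed.

Lemma wact_word1 c : wact adj0134 1 c (word1 x) = word1 (e1x c x).
Proof.
have eE : weps adj0134 1 (word1 x) = ep1 x by rewrite /ep1 /=; field; neq0.
by rewrite /wact eE /word1 !co_vec6 //=.
Qed.

Lemma wact_word2 c : wact adj0134 1 c (word2 x) = word2 (e1y c x).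
Proof.
have eE : weps adj0134 1 (word2 x) = ep1y x by rewrite /ep1y /=; field; neq0.
by rewrite /wact eE /word2 !co_vec6 //=.
Qed.

Lemma wact0_word2 c : wact adj0134 0 c (word2 x) = word2 (e0y c x).
Proof.
have eE : weps adj0134 0 (word2 x) = co x 1 * co x 3 / co x 0 by rewrite /=; field; neq0.
rewrite /wact eE /word2 !co_vec6 //=; congr [:: _; _; _; _; (_, _); _].
by field; neq0.
Qed.

Lemma weps1_foldw : weps adj0134 1 (foldw x) = ep1 x.
Proof. by rewrite /ep1 /=; field; neq0. Qed.

Lemma weps2_foldw : weps adj0134 2 (foldw x) = ep2 x.
Proof. by rewrite /ep2 /=; field; neq0. Qed.

Lemma wact3_foldw c : wact3 c (foldw x) = foldw (e1x c x).
Proof.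
have eE : weps adj0134 1 (foldw x) = ep1 x := weps1_foldw.
have eE3 : weps adj0134 3 (foldw x) = ep1 x by rewrite /ep1 /=; field; neq0.
have eE4 : weps adj0134 4 (foldw x) = ep1 x by rewrite /ep1 /=; field; neq0.
rewrite /wact3 /wact !(weps_xact_comm adj0134C) // eE eE3 eE4.
by rewrite /foldw !co_vec6.
Qed.

Lemma wact2_foldw c : 1 < c -> wact adj0134 2 c (foldw x) = foldw (e2x c x).
Proof.
rewrite -subr_gt0 => c0.
rewrite /wact weps2_foldw /foldw !co_vec6 //=.
have -> : c = 1 + (c - 1) by rewrite addrC subrK.
move: (c - 1) c0 => {}c c0; have -> : 1 + c - 1 = c by ring.
congr [:: _; _; _; _; (_, _); _; _; _; (_, _); _; _; _];
  by rewrite /ep2; field; neq0.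
Qed.

End Positive.

Lemma word1_inj : injective word1.
Proof.
by move=> x y [e0 e1 e2 e3 e4 e5]; rewrite [x]vec6_co [y]vec6_co e0 e1 e2 e3 e4 e5.
Qed.

Lemma word2_inj : injective word2.
Proof.
by move=> x y [e2 e1 e4 e3 e0 e5]; rewrite [x]vec6_co [y]vec6_co e0 e1 e2 e3 e4 e5.
Qed.

Lemma foldw_inj : injective foldw.
Proof.
by move=> x y [e0 e1 _ _ e2 e3 _ _ e4 e5 _ _];
  rewrite [x]vec6_co [y]vec6_co e0 e1 e2 e3 e4 e5.
Qed.

Lemma e1x_pos c x : pos6 x -> 1 < c -> pos6 (e1x c x).
Proof.
move=> px c1; apply: unip1x_pos => //.
by rewrite divr_gt0 ?subr_gt0 ?ep1_gt0.
Qed.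

Lemma e1y_pos c y : pos6 y -> 1 < c -> pos6 (e1y c y).
Proof.
move=> py c1; apply: unip1y_pos => //.
by rewrite divr_gt0 ?subr_gt0 ?ep1y_gt0.
Qed.

Lemma e0y_pos c y : pos6 y -> 1 < c -> pos6 (e0y c y).
Proof.
move=> py c1; have c0 := lt_trans ltr01 c1.
by apply: pos6_vec6; rewrite ?mulr_gt0 ?py.
Qed.

Lemma e2x_pos c x : pos6 x -> 1 < c -> pos6 (e2x c x).
Proof.
move=> px c1; have c0 := lt_trans ltr01 c1.
pos_coords px p0 p1 p2 p3 p4 p5.
by apply: pos6_vec6; pos.
Qed.

Lemma e0x_pos c x : pos6 x -> 1 < c -> pos6 (e0x c x).
Proof. by move=> px c1; apply/xhat_pos/e0y_pos => //; apply: yhat_pos. Qed.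

Lemma prop12_unip1 a s x y : pos6 x -> pos6 y -> 0 < s ->
  prop12 a x y -> prop12 a (unip1x s x) (unip1y s y).
Proof.
move=> px py s0 [[e1 e2 e3 eS] [ey0 e3b e2b e1b]].
have [[f1 f2 f3 fS] [f0 f3b f1']] := unip1xE px s0.
have [[g1 g2 g3 gS] [g0 g3b g2b g1b]] := unip1yE py s0.
split; split; rewrite ?(f1, f2, f3, fS, f0, f3b, f1', g1, g2, g3, gS, g0, g3b,
  g2b, g1b) ?(e1, e2, e3, eS, e3b, e2b, e1b, ey0) //; ring.
Qed.

(** Both sides solve the proportionality equation at the point [e1x c x], since
   x_1(s) is linear on vectors and eps_1 agrees on both products. *)
Lemma yhat_e1x c x : pos6 x -> 1 < c -> yhat (e1x c x) = e1y c (yhat x).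
Proof.
move=> px c1; have s0 : 0 < (c - 1) / ep1 x.
  by rewrite divr_gt0 ?subr_gt0 ?ep1_gt0.
have px' := e1x_pos px c1; have py := yhat_pos px; have py' := e1y_pos py c1.
have P := prop12_unip1 px py s0 (yhat_prop px).
have [//|_ ->] := prop12_inj (pos6_nz6 px') (pos6_nz6 (yhat_pos px'))
  (pos6_nz6 py') (lt0r_neq0 (A1_gt0 px')) (lt0r_neq0 (sA_gt0 px'))
  (lt0r_neq0 (yscale_gt0 px')) (lt0r_neq0 (yscale_gt0 px)) (yhat_prop px').
  by move: P; rewrite /e1y ep1_yhat.
by [].
Qed.

(** ** Relations *)

Lemma e0yM c d y : e0y c (e0y d y) = e0y (c * d) y.
Proof. by rewrite /e0y !co_vec6 //= mulrA. Qed.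

Lemma e0xM c d x : pos6 x -> 1 < c -> 1 < d ->
  e0x c (e0x d x) = e0x (c * d) x.
Proof.
move=> px c1 d1; rewrite /e0x yhatK ?e0yM //.
by apply: e0y_pos => //; apply: yhat_pos.
Qed.

Lemma e1xM c d x : pos6 x -> 1 < c -> 1 < d ->
  e1x c (e1x d x) = e1x (c * d) x.
Proof.
move=> px c1 d1; apply: word1_inj; have px' := e1x_pos px d1.
rewrite -(wact_word1 px') -!(wact_word1 px).
by apply: wactM => //; apply: word1_pos.
Qed.

Lemma e2xM c d x : pos6 x -> 1 < c -> 1 < d ->
  e2x c (e2x d x) = e2x (c * d) x.
Proof.
move=> px c1 d1; apply: foldw_inj; have px' := e2x_pos px d1.
have cd1 : 1 < c * d by rewrite mulr_egt1.
rewrite -(wact2_foldw px' c1) -(wact2_foldw px d1) -(wact2_foldw px cd1).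
by apply: wactM => //; apply: foldw_pos.
Qed.

Lemma e1y_e0y_braid p r y : pos6 y -> 1 < p -> 1 < r ->
  e1y p (e0y (p * r) (e1y r y)) = e0y r (e1y (p * r) (e0y p y)).
Proof.
move=> py p1 r1; have pr1 : 1 < p * r by rewrite mulr_egt1.
have q1 := e1y_pos py r1; have q2 := e0y_pos q1 pr1.
have q3 := e0y_pos py p1; have q4 := e1y_pos q3 pr1.
apply: word2_inj.
rewrite -(wact_word2 q2) -(wact0_word2 q1) -(wact_word2 py).
rewrite -(wact0_word2 q4) -(wact_word2 q3) -(wact0_word2 py).
by apply: (wact_braid adj0134C adj0134xx) => //; apply: word2_pos.
Qed.

Lemma e1x_conj c x : pos6 x -> 1 < c -> e1x c x = xhat (e1y c (yhat x)).
Proof. by move=> px c1; rewrite -yhat_e1x // xhatK //; apply: e1x_pos. Qed.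

(** Conjugation by [yhat] moves the relation to the second product, where both
   operators are natural. *)
Lemma e1x_e0x_braid p r x : pos6 x -> 1 < p -> 1 < r ->
  e1x p (e0x (p * r) (e1x r x)) = e0x r (e1x (p * r) (e0x p x)).
Proof.
move=> px p1 r1; have pr1 : 1 < p * r by rewrite mulr_egt1.
have py := yhat_pos px.
have q1 := e1y_pos py r1; have q2 := e0y_pos q1 pr1.
have q3 := e0y_pos py p1; have q4 := e1y_pos q3 pr1.
have xp := xhat_pos.
rewrite /e0x yhat_e1x // [LHS]e1x_conj ?yhatK //; last exact: xp.
rewrite [in RHS]e1x_conj ?yhatK //; last exact: xp.
by rewrite e1y_e0y_braid.
Qed.

Lemma e1x_e2x_braid s t x : pos6 x -> 1 < s -> 1 < t ->
  e1x s (e2x (s ^+ 3 * t) (e1x (s ^+ 2 * t)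
    (e2x (s ^+ 3 * t ^+ 2) (e1x (s * t) (e2x t x)))))
  = e2x t (e1x (s * t) (e2x (s ^+ 3 * t ^+ 2)
      (e1x (s ^+ 2 * t) (e2x (s ^+ 3 * t) (e1x s x))))).
Proof.
move=> px s1 t1; apply: foldw_inj.
have [s2 s3 t2] : [/\ 1 < s ^+ 2, 1 < s ^+ 3 & 1 < t ^+ 2].
  by split; rewrite exprn_egt1.
have [h1 h2 h3 h4] : [/\ 1 < s * t, 1 < s ^+ 2 * t, 1 < s ^+ 3 * t
  & 1 < s ^+ 3 * t ^+ 2] by split; rewrite mulr_egt1.
have l1 := e2x_pos px t1; have l2 := e1x_pos l1 h1; have l3 := e2x_pos l2 h4.
have l4 := e1x_pos l3 h2; have l5 := e2x_pos l4 h3.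
have r1 := e1x_pos px s1; have r2 := e2x_pos r1 h3; have r3 := e1x_pos r2 h2.
have r4 := e2x_pos r3 h4; have r5 := e1x_pos r4 h1.
rewrite -(wact3_foldw l5) -(wact2_foldw l4 h3) -(wact3_foldw l3).
rewrite -(wact2_foldw l2 h4) -(wact3_foldw l1) -(wact2_foldw px t1).
rewrite -(wact2_foldw r5 t1) -(wact3_foldw r4) -(wact2_foldw r3 h4).
rewrite -(wact3_foldw r2) -(wact2_foldw r1 h3) -(wact3_foldw px).
by apply: wact3_braid => //; apply: foldw_pos.
Qed.

(** ** Explicit form of the action of the affine node *)

(** [dP], [fP] and [hP] are D, F and H divided by x_2 x_3.  Apart from x_0, x_1,
   x_3, x_5 they involve only x_4 + x_3^3 / x_2. *)
Definition dP c x := co x 1 * co x 3 * co x 5 + c * co x 0 * sA x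
  + c ^+ 2 * co x 0 ^+ 2.
Definition fP c x := co x 1 * co x 3 * co x 5 + co x 0 * co x 3
  + c * co x 0 * (co x 0 + co x 1 * qA x).
Definition hP c x := co x 1 * co x 3 * co x 5 + co x 0 * co x 3
  + co x 0 * co x 1 * (co x 4 / co x 3 + co x 3 ^+ 2 / co x 2)
  + c * co x 0 * (co x 0 + co x 1 * co x 5).

Lemma dP_gt0 c x : pos6 x -> 0 < c -> 0 < dP c x.
Proof.
move=> px c0; have := sA_gt0 px; rewrite /dP.
by move: (px 0%N isT) (px 1%N isT) (px 3%N isT) (px 5%N isT) => ? ? ? ? ?; pos.
Qed.

Lemma fP_gt0 c x : pos6 x -> 0 < c -> 0 < fP c x.
Proof.
move=> px c0; have := qA_gt0 px; rewrite /fP.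
by move: (px 0%N isT) (px 1%N isT) (px 3%N isT) (px 5%N isT) => ? ? ? ? ?; pos.
Qed.

Lemma hP_gt0 c x : pos6 x -> 0 < c -> 0 < hP c x.
Proof.
move=> px c0; rewrite /hP; move: (px 0%N isT) (px 1%N isT) (px 2%N isT).
by move: (px 3%N isT) (px 4%N isT) (px 5%N isT) => ? ? ? ? ? ?; pos.
Qed.

Definition e0x2 c x :=
  (hP c x ^+ 3 * co x 3 ^+ 3 + fP c x ^+ 3 * (co x 2 * co x 4))
    / (c ^+ 3 * dP 1 x ^+ 3 * (co x 3 ^+ 3 + co x 2 * co x 4)) * co x 2.

(** Scaling y_0 by c multiplies the coordinates on v_{bar 1} and v_{bar 2} and
   the quantity [hB] by the ratios of D, F and H to E, and fixes [kB]; the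
   inverse map is expressed by these four. *)
Lemma e0xE c x : pos6 x -> 0 < c -> e0x c x =
  vec6 (dP c x / (c * dP 1 x) * co x 0) (fP c x / (c * dP 1 x) * co x 1)
    (e0x2 c x) (dP c x * hP c x / (c ^+ 2 * dP 1 x * fP c x) * co x 3)
    (dP c x ^+ 3 / (c ^+ 6 * dP 1 x ^+ 3) * (co x 2 * co x 4) / e0x2 c x)
    (dP c x / (c * hP c x) * co x 5).
Proof.
move=> px c0; have [[e1 e2 e3 eS] [ey0 e3b e2b e1b]] := yhat_prop px.
pos_coords px p0 p1 p2 p3 p4 p5.
have a0 := yscale_gt0 px; have A10 := A1_gt0 px.
have y10 := yhat1_gt0 px; have y20 := yhat2_gt0 px.
have d0 := dP_gt0 px c0; have f0 := fP_gt0 px c0; have h0 := hP_gt0 px c0.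
have d10 := dP_gt0 px ltr01.
have py := yhat_pos px; set y := yhat x in e1 e2 e3 eS ey0 e3b e2b e1b py *.
pos_coords py q0 q1 q2 q3 q4 q5.
have py' : pos6 (e0y c y) by apply: pos6_vec6; rewrite ?mulr_gt0.
have d1E : dP 1 x = A1 x * co x 0 ^+ 2.
  by rewrite mulrC -(A1E (pos6_nz6 px)) /dP; ring.
have y5E : co y 5 = yscale x * (co x 1 * co x 3 * co x 5) / A1 x.
  by rewrite co_vec6.
have b1 : B1 (e0y c y) = yscale x * A1 x by rewrite -e1 /B1 !co_vec6.
have bS : sB (e0y c y) = yscale x * sA x by rewrite -eS /sB !co_vec6.
have b3 : B3 (e0y c y) = yscale x * A3 x by rewrite -e3 /B3 /B1 !co_vec6.
have b1b : B1b (e0y c y) = yscale x * dP c x / A1 x.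
  by rewrite /B1b b1 bS !co_vec6 //= /dP; field; neq0.
have b2b : B2b (e0y c y) = yscale x * co x 1 * fP c x / (co x 0 * A1 x).
  have -> : B2b (e0y c y) = B2b y + (c - 1) * co y 0 * B3 y / B1 y.
    by have B10 := B1_gt0 py; rewrite /B2b /B3 /B1 !co_vec6 //=; field; neq0.
  rewrite e2b ey0 e3 e1 /A3 /fP.
  apply: (mulfI (lt0r_neq0 A10)); apply: (mulfI (lt0r_neq0 p0)).
  have := A1E (pos6_nz6 px) => eA.
  have -> : co x 0 * (A1 x * (yscale x * co x 1 * (co x 1 * co x 3 * co x 5 +
    co x 0 * co x 3 + c * co x 0 * (co x 0 + co x 1 * qA x))
      / (co x 0 * A1 x))) = yscale x * co x 1 * (co x 1 * co x 3 * co x 5 +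
    co x 0 * co x 3 + c * co x 0 * (co x 0 + co x 1 * qA x)).
    by field; neq0.
  have -> : co x 0 * (A1 x * (yscale x * (co x 0 * co x 1) + (c - 1) *
     (yscale x * co x 0) * (yscale x * (co x 1 + co x 1 ^+ 2 * qA x / co x 0))
     / (yscale x * A1 x))) = yscale x * co x 1 * (co x 0 ^+ 2 * A1 x
      + (c - 1) * (co x 0 ^+ 2 + co x 0 * co x 1 * qA x)).
    by field; neq0.
  by rewrite -eA /sA; ring.
have hb : hB (e0y c y) =
    yscale x ^+ 2 * co x 1 * co x 3 * hP c x / (co x 0 * A1 x).
  rewrite (hBE (pos6_nz6 py')) bS b2b b3 b1b !co_vec6 //=.
  rewrite /A3 /dP /fP /hP /sA /qA; field; neq0.
have kb : kB (e0y c y) = kB y by rewrite /kB !co_vec6.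
rewrite /e0x /xhat b1b b2b hb kb kB_yhat // !co_vec6 //= /e0x2 d1E.
congr vec6; field; neq0.
Qed.

Lemma qA_e2x c x : pos6 x -> 0 < c -> qA (e2x c x) = qA x.
Proof.
move=> px c0; move: (px 2%N isT) (px 3%N isT) (px 4%N isT) => p2 p3 p4.
by rewrite /qA !co_vec6 //=; field; neq0.
Qed.

(** In the coordinates x_0, x_1, x_3, x_5, x_2 x_4 and x_4 + x_3^3 / x_2, the
   operator e_2 only multiplies x_2 x_4 by its parameter; e_0 multiplies
   x_2 x_4 by a function of the other five, and transforms these among
   themselves. *)
Lemma e0x_e2x_comm c d x : pos6 x -> 1 < c -> 1 < d ->
  e0x c (e2x d x) = e2x d (e0x c x).
Proof.
move=> px c1 d1; have [c0 d0] := (lt_trans ltr01 c1, lt_trans ltr01 d1).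
have px' := e2x_pos px d1.
have eq := qA_e2x px d0.
pos_coords px p0 p1 p2 p3 p4 p5.
have eS : sA (e2x d x) = sA x by rewrite /sA eq !co_vec6.
have eD b : dP b (e2x d x) = dP b x by rewrite /dP eS !co_vec6.
have eF b : fP b (e2x d x) = fP b x by rewrite /fP eq !co_vec6.
have eH b : hP b (e2x d x) = hP b x.
  by rewrite /hP !co_vec6 //=; field; neq0.
have Dc0 := dP_gt0 px c0; have f0 := fP_gt0 px c0; have h0 := hP_gt0 px c0.
have d10 := dP_gt0 px ltr01.
rewrite !e0xE // /e0x2 !eD !eF !eH /e2x !co_vec6 //=.
congr vec6; field; neq0.
Qed.

Lemma e0x1 x : pos6 x -> e0x 1 x = x.
Proof. by move=> px; rewrite /e0x /e0y mul1r -vec6_co xhatK. Qed.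

Lemma e2x1 x : pos6 x -> e2x 1 x = x.
Proof.
move=> px; move: (px 2%N isT) (px 3%N isT) (px 4%N isT) => p2 p3 p4.
have r1 : co x 2 * co x 4 + co x 3 ^+ 3 != 0 by neq0.
by rewrite /e2x !mul1r divff // invr1 !mul1r -vec6_co.
Qed.

Lemma ep1_e1x c x : pos6 x -> 1 < c -> ep1 (e1x c x) = c^-1 * ep1 x.
Proof.
move=> px c1; have c0 := lt_trans ltr01 c1; have e0 := ep1_gt0 px.
have s0 : 0 < (c - 1) / ep1 x by rewrite divr_gt0 ?subr_gt0.
have eE (z : 'rV[F]_6) : pos6 z -> weps adj0134 1 (word1 z) = ep1 z.
  by move=> pz; have := weps1_foldw pz; rewrite /ep1 /=; move: (pz 1%N isT)
   (pz 3%N isT) (pz 5%N isT) => ? ? ? _; field; neq0.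
rewrite -(eE _ (e1x_pos px c1)) -(wact_word1 px) /wact.
rewrite weps_xact ?word1_pos // eE //.
have -> : 1 + (c - 1) / ep1 x * ep1 x = c by field; neq0.
by rewrite mulrC.
Qed.

Lemma ep2_e2x c x : pos6 x -> 1 < c -> ep2 (e2x c x) = c^-1 * ep2 x.
Proof.
move=> px c1; have c0 := lt_trans ltr01 c1.
move: (px 1%N isT) (px 2%N isT) (px 3%N isT) (px 4%N isT) => p1 p2 p3 p4.
by rewrite /ep2 !co_vec6 //=; field; neq0.
Qed.

(** In the coordinates of the second product eps_0 is y_1 y_3 / y_0. *)
Lemma ep0_e0x c x : pos6 x -> 1 < c -> ep0 (e0x c x) = c^-1 * ep0 x.
Proof.
move=> px c1; have c0 := lt_trans ltr01 c1.
have epE z : pos6 z -> ep0 z = B1 (yhat z) / co (yhat z) 0.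
  move=> pz; have [[-> _ _ _] [-> _ _ _]] := yhat_prop pz.
  have := yscale_gt0 pz; have := pz 0%N isT => ? ?.
  by rewrite /ep0; field; neq0.
have py := yhat_pos px; have px' := e0x_pos px c1.
rewrite !epE // yhatK; last exact: e0y_pos.
have -> : B1 (e0y c (yhat x)) = B1 (yhat x) by rewrite /B1 /e0y !co_vec6.
by rewrite [co (e0y _ _) 0]co_vec6 //= invfM mulrCA.
Qed.

(** ** Weights *)

Definition ga0 x := co x 0 ^+ 2 / (co x 1 * co x 3 * co x 5).
Definition ga1 x := (co x 1 * co x 3 * co x 5) ^+ 2
  / (co x 0 * (co x 2 * co x 4)).
Definition ga2 x := (co x 2 * co x 4) ^+ 2 / (co x 1 * co x 3 * co x 5) ^+ 3.

Lemma e0x_weights c x : pos6 x -> 1 < c ->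
  [/\ ga0 (e0x c x) = c ^+ 2 * ga0 x, ga1 (e0x c x) = c^-1 * ga1 x
    & ga2 (e0x c x) = ga2 x].
Proof.
move=> px c1; have c0 := lt_trans ltr01 c1.
pos_coords px p0 p1 p2 p3 p4 p5.
have Dc0 := dP_gt0 px c0; have f0 := fP_gt0 px c0; have h0 := hP_gt0 px c0.
have d10 := dP_gt0 px ltr01.
have x20 : 0 < e0x2 c x by rewrite /e0x2; pos.
by rewrite e0xE // /ga0 /ga1 /ga2 !co_vec6 //=; split; field; neq0.
Qed.

Lemma e1x_weights c x : pos6 x -> 1 < c ->
  [/\ ga0 (e1x c x) = c^-1 * ga0 x, ga1 (e1x c x) = c ^+ 2 * ga1 x
    & ga2 (e1x c x) = c ^- 3 * ga2 x].
Proof.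
move=> px c1; have c0 := lt_trans ltr01 c1.
pos_coords px p0 p1 p2 p3 p4 p5.
have e0 := ep1_gt0 px; have s0 : 0 < (c - 1) / ep1 x.
  by rewrite divr_gt0 ?subr_gt0.
have M' : co (e1x c x) 1 * co (e1x c x) 3 * co (e1x c x) 5 =
    c * (co x 1 * co x 3 * co x 5).
  have -> : c = 1 + (c - 1) / ep1 x * ep1 x by field; neq0.
  rewrite /e1x !co_vec6 //=; have -> : 1 + (c - 1) / ep1 x * ep1 x - 1 =
    (c - 1) / ep1 x * ep1 x by rewrite addrAC subrr add0r.
  rewrite mulfK ?lt0r_neq0 //; move: ((c - 1) / ep1 x) s0 => s s0.
  by rewrite /ep1; field; neq0.
by rewrite /ga0 /ga1 /ga2 M' !co_vec6 //=; split; field; neq0.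
Qed.

Lemma e2x_weights c x : pos6 x -> 1 < c ->
  [/\ ga0 (e2x c x) = ga0 x, ga1 (e2x c x) = c^-1 * ga1 x
    & ga2 (e2x c x) = c ^+ 2 * ga2 x].
Proof.
move=> px c1; have c0 := lt_trans ltr01 c1.
pos_coords px p0 p1 p2 p3 p4 p5.
by rewrite /ga0 /ga1 /ga2 !co_vec6 //=; split; field; neq0.
Qed.

Lemma ga_yhat x : pos6 x -> ga0 (yhat x) = ga0 x.
Proof.
move=> px; have a0 := yscale_gt0 px; have A10 := A1_gt0 px.
have [p0 p1 p3] : [/\ 0 < co x 0, 0 < co x 1 & 0 < co x 3] by split; apply: px.
have p5 : 0 < co x 5 by apply: px.
have y10 := yhat1_gt0 px; rewrite /ga0 !co_vec6 //=; field; neq0.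
Qed.

End Operators.

(** * The operators Y_i on the fundamental representation *)

Section Coordinates.

Variable R : realType.
Local Notation C := R[i].

Definition row8 (a0 a1 a2 a3 a4 a5 a6 a7 : C) : 'rV[C]_8 :=
  \row_j nth 0 [:: a0; a1; a2; a3; a4; a5; a6; a7] j.

Lemma row8_inj a0 a1 a2 a3 a4 a5 a6 a7 b0 b1 b2 b3 b4 b5 b6 b7 :
  row8 a0 a1 a2 a3 a4 a5 a6 a7 = row8 b0 b1 b2 b3 b4 b5 b6 b7 ->
  [/\ a0 = b0, a1 = b1, a2 = b2 & a3 = b3] /\
  [/\ a4 = b4, a5 = b5, a6 = b6 & a7 = b7].
Proof.
move=> /rowP e; have {}e k : (k < 8)%N ->
    nth 0 [:: a0; a1; a2; a3; a4; a5; a6; a7] k =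
    nth 0 [:: b0; b1; b2; b3; b4; b5; b6; b7] k.
  by move=> k8; have := e (Ordinal k8); rewrite !mxE.
by split; split; [apply: (e 0%N) | apply: (e 1%N) | apply: (e 2%N)
  | apply: (e 3%N) | apply: (e 4%N) | apply: (e 5%N) | apply: (e 6%N)
  | apply: (e 7%N)].
Qed.

Lemma scale_row8 c a0 a1 a2 a3 a4 a5 a6 a7 :
  c *: row8 a0 a1 a2 a3 a4 a5 a6 a7 =
  row8 (c * a0) (c * a1) (c * a2) (c * a3) (c * a4) (c * a5) (c * a6) (c * a7).
Proof.
by apply/rowP=> -[[|[|[|[|[|[|[|[|//]]]]]]]] lj]; rewrite !mxE.
Qed.

Lemma mul_delta_row (w : 'rV[C]_8) (k l : 'I_8) :
  w *m delta_mx k l = w 0 k *: delta_mx 0 l.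
Proof.
apply/rowP=> j; rewrite !mxE (bigD1 k) //= big1 => [|m /negbTE mk].
  by rewrite !mxE eqxx addr0.
by rewrite !mxE mk mulr0.
Qed.

Let f0 a0 a1 a2 a3 a4 a5 a6 a7 :
  row8 a0 a1 a2 a3 a4 a5 a6 a7 *m f_mx R i0 =
  row8 (a3 + 3 / 2 * a4) a5 a6 (a7 / 2) a7 0 0 0.
Proof.
rewrite /f_mx /i0 inordK //= !mulmxDr -!scalemxAr !mul_delta_row !mxE.
rewrite !inordK //=; apply/rowP=> j; rewrite !mxE /= -!val_eqE /= !inordK //.
case: j => -[|[|[|[|[|[|[|[|//]]]]]]]] lj /=;
  by rewrite ?mulr0 ?mulr1 ?addr0 ?add0r // mulrC.
Qed.

Let f1 a0 a1 a2 a3 a4 a5 a6 a7 :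
  row8 a0 a1 a2 a3 a4 a5 a6 a7 *m f_mx R i1 =
  row8 0 a0 0 a2 0 (2 * a3) 0 a6.
Proof.
rewrite /f_mx /i1 inordK //= !mulmxDr -!scalemxAr !mul_delta_row !mxE.
rewrite !inordK //=; apply/rowP=> j; rewrite !mxE /= -!val_eqE /= !inordK //.
case: j => -[|[|[|[|[|[|[|[|//]]]]]]]] lj /=;
  by rewrite ?mulr0 ?mulr1 ?addr0 ?add0r.
Qed.

Let f2 a0 a1 a2 a3 a4 a5 a6 a7 :
  row8 a0 a1 a2 a3 a4 a5 a6 a7 *m f_mx R i2 =
  row8 0 0 a1 0 0 0 a5 0.
Proof.
rewrite /f_mx /i2 inordK //= !mulmxDr !mul_delta_row !mxE.
rewrite !inordK //=; apply/rowP=> j; rewrite !mxE /= -!val_eqE /= !inordK //.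
case: j => -[|[|[|[|[|[|[|[|//]]]]]]]] lj /=;
  by rewrite ?mulr0 ?mulr1 ?addr0 ?add0r.
Qed.

(** The exponential stops after the quadratic term, since no weight string of
   the representation is longer than three. *)
Lemma mul_exp_nilp (w : 'rV[C]_8) (N : 'M[C]_8) c :
  w *m N *m N *m N = 0 ->
  w *m exp_nilp (c *: N) = w + c *: (w *m N) + (c ^+ 2 / 2) *: (w *m N *m N).
Proof.
move=> w3; have wk k : w *m (c *: N) ^+ k.+3 = 0.
  rewrite exprZn -scalemxAr !exprS -!mulmxE !mulmxA w3.
  by rewrite mul0mx scaler0.
rewrite /exp_nilp mulmx_sumr.
rewrite -(big_mkord xpredT (fun k => w *m ((k`!%:R)^-1 *: (c *: N) ^+ k))).
rewrite 3?big_ltn // big_nat_cond big1 => [|[|[|[|k]]] //= _]; last first.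
  by rewrite -scalemxAr wk scaler0.
have -> : w *m ((0`!%:R)^-1 *: (c *: N) ^+ 0) = w.
  by rewrite fact0 invr1 scale1r expr0 -idmxE mulmx1.
have -> : w *m ((1`!%:R)^-1 *: (c *: N) ^+ 1) = c *: (w *m N).
  by rewrite factS fact0 invr1 scale1r expr1 -scalemxAr.
have -> : w *m ((2`!%:R)^-1 *: (c *: N) ^+ 2) = (c ^+ 2 / 2) *: (w *m N *m N).
  rewrite !factS fact0 exprZn scalerA -scalemxAr mulrC.
  by rewrite (expr2 N) -mulmxE mulmxA.
by rewrite addr0 addrA.
Qed.

Let row8D a0 a1 a2 a3 a4 a5 a6 a7 b0 b1 b2 b3 b4 b5 b6 b7 :
  row8 a0 a1 a2 a3 a4 a5 a6 a7 + row8 b0 b1 b2 b3 b4 b5 b6 b7 =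
  row8 (a0 + b0) (a1 + b1) (a2 + b2) (a3 + b3)
       (a4 + b4) (a5 + b5) (a6 + b6) (a7 + b7).
Proof.
by apply/rowP=> -[[|[|[|[|[|[|[|[|//]]]]]]]] lj]; rewrite !mxE.
Qed.

Let row80 : row8 0 0 0 0 0 0 0 0 = 0.
Proof.
by apply/rowP=> -[[|[|[|[|[|[|[|[|//]]]]]]]] lj]; rewrite !mxE.
Qed.

Lemma Y0_row8 c a0 a1 a2 a3 a4 a5 a6 a7 : c != 0 ->
  Y i0 c (row8 a0 a1 a2 a3 a4 a5 a6 a7) =
  row8 (a0 / c ^+ 2 + (a3 + 3 / 2 * a4) / c + a7) (a1 / c + a5) (a2 / c + a6)
       (a3 + c * a7 / 2) (a4 + c * a7) (c * a5) (c * a6) (c ^+ 2 * a7).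
Proof.
move=> c0; have -> : Y i0 c (row8 a0 a1 a2 a3 a4 a5 a6 a7) =
  row8 (a0 / c ^+ 2) (a1 / c) (a2 / c) a3 a4 (c * a5) (c * a6) (c ^+ 2 * a7)
    *m exp_nilp (c^-1 *: f_mx R i0).
  congr (_ *m _); apply/rowP=> -[[|[|[|[|[|[|[|[|//]]]]]]]] lj];
  by rewrite !mxE /wt /i0 /= inordK //= ?mul1r // 1?mulrC.
rewrite mul_exp_nilp !f0; last by rewrite !(mul0r, mulr0, addr0) row80.
rewrite !scale_row8 !row8D; congr row8; field; exact: c0.
Qed.

Lemma Y1_row8 c a0 a1 a2 a3 a4 a5 a6 a7 : c != 0 ->
  Y i1 c (row8 a0 a1 a2 a3 a4 a5 a6 a7) =
  row8 (c * a0) (a1 / c + a0) (c ^+ 2 * a2) (a3 + c * a2) a4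
       (a5 / c ^+ 2 + 2 * a3 / c + a2) (c * a6) (a7 / c + a6).
Proof.
move=> c0; have -> : Y i1 c (row8 a0 a1 a2 a3 a4 a5 a6 a7) =
  row8 (c * a0) (a1 / c) (c ^+ 2 * a2) a3 a4 (a5 / c ^+ 2) (c * a6) (a7 / c)
    *m exp_nilp (c^-1 *: f_mx R i1).
  congr (_ *m _); apply/rowP=> -[[|[|[|[|[|[|[|[|//]]]]]]]] lj];
  by rewrite !mxE /wt /i1 /= inordK //= ?mul1r // 1?mulrC.
rewrite mul_exp_nilp !f1; last by rewrite !(mul0r, mulr0, addr0) row80.
rewrite !scale_row8 !row8D; congr row8; field; exact: c0.
Qed.

Lemma Y2_row8 c a0 a1 a2 a3 a4 a5 a6 a7 : c != 0 ->
  Y i2 c (row8 a0 a1 a2 a3 a4 a5 a6 a7) =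
  row8 a0 (c * a1) (a2 / c + a1) a3 a4 (c * a5) (a6 / c + a5) a7.
Proof.
move=> c0; have -> : Y i2 c (row8 a0 a1 a2 a3 a4 a5 a6 a7) =
  row8 a0 (c * a1) (a2 / c) a3 a4 (c * a5) (a6 / c) a7
    *m exp_nilp (c^-1 *: f_mx R i2).
  congr (_ *m _); apply/rowP=> -[[|[|[|[|[|[|[|[|//]]]]]]]] lj];
  by rewrite !mxE /wt /i2 /= inordK //= ?mul1r // 1?mulrC.
rewrite mul_exp_nilp !f2; last by rewrite row80.
rewrite !scale_row8 !row8D; congr row8; field; exact: c0.
Qed.

End Coordinates.

(** * Rational and subtraction-free functions *)

Section RationalFunctions.
Variable R : realType.
Local Notation C := R[i].
Implicit Types (m n k : nat).

Section Peval.
Variable n : nat.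
Implicit Types (p q : {mpoly C[n]}) (x : 'rV[C]_n).

Lemma pevalD p q x : peval (p + q) x = peval p x + peval q x.
Proof. exact: mevalD. Qed.
Lemma pevalM p q x : peval (p * q) x = peval p x * peval q x.
Proof. exact: mevalM. Qed.
Lemma pevalM_neq0 p q x :
  (peval (p * q) x != 0) = (peval p x != 0) && (peval q x != 0).
Proof. by rewrite pevalM mulf_eq0 negb_or. Qed.
Lemma pevalN p x : peval (- p) x = - peval p x.
Proof. exact: mevalN. Qed.
Lemma pevalC c x : peval (c%:MP : {mpoly C[n]}) x = c.
Proof. exact: mevalC. Qed.
Lemma pevalX j x : peval 'X_j x = x 0 j.
Proof. exact: mevalXU. Qed.
Lemma peval_prod (I : Type) (r : seq I) (P : pred I) (f : I -> {mpoly C[n]}) x :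
  peval (\prod_(i <- r | P i) f i) x = \prod_(i <- r | P i) peval (f i) x.
Proof. exact: rmorph_prod. Qed.

Lemma pevalE p x :
  peval p x = \sum_(u <- msupp p) p@_u * \prod_i x 0 i ^+ u i.
Proof. exact: mevalE. Qed.

Definition pevalS := (pevalD, pevalM, pevalN, pevalC, pevalX).

Definition gt1 x := forall j, 1 < x 0 j.

End Peval.

Lemma poly_dense (p : {poly C}) : (forall t, 1 < t -> p.[t] = 0) -> p = 0.
Proof.
move=> p0; apply: (@roots_geq_poly_eq0 _ _ [seq i.+2%:R | i <- iota 0 (size p)]).
- by apply/allP=> _ /mapP[i _ ->]; apply/rootP/p0; rewrite ltr1n.
- rewrite map_inj_uniq ?iota_uniq // => i j /eqP.
  by rewrite eqr_nat => /eqP[].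
by rewrite size_map size_iota.
Qed.

(** With all variables but the last fixed, p is a polynomial in one variable with
   infinitely many roots, so its coefficients, which are polynomials in the
   other variables, satisfy the same hypothesis. *)
Lemma peval_dense n (p : {mpoly C[n]}) :
  (forall x, gt1 x -> peval p x = 0) -> p = 0.
Proof.
elim: n p => [|n IH] p p0.
  have := p0 (const_mx 2); rewrite [p]nvar0_mpolyC pevalC => -> //.
  by case.
pose tr (u : 'X_{1..n.+1}) : 'X_{1..n} := [multinom u (widen_ord (leqnSn n) i) | i < n].
pose c l : {mpoly C[n]} :=
  \sum_(u <- msupp p | u ord_max == l) p@_u *: 'X_[tr u].
have c0 l : c l = 0.
  apply: IH => x x1; pose qx : {poly C} := \sum_(u <- msupp p)
    (p@_u * \prod_(i < n) x 0 i ^+ u (widen_ord (leqnSn n) i)) *: 'X^(u ord_max).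
  have qx0 : qx = 0.
    apply: poly_dense => t t1.
    pose xt : 'rV[C]_n.+1 := \row_j (if unlift ord_max j is Some i then x 0 i else t).
    have xtw i : xt 0 (widen_ord (leqnSn n) i) = x 0 i.
      have -> : widen_ord (leqnSn n) i = lift ord_max i.
        by apply/val_inj; rewrite /= /bump leqNgt ltn_ord.
      by rewrite mxE liftK.
    have xtm : xt 0 ord_max = t by rewrite mxE unlift_none.
    have <- : peval p xt = qx.[t].
      rewrite pevalE horner_sum; apply: eq_bigr => u _.
      rewrite hornerZ hornerXn big_ord_recr /= xtm mulrA; congr (_ * _ * _).
      by apply: eq_bigr => i _; rewrite xtw.
    apply: p0 => j; rewrite mxE; case: unliftP => [i _|_] //.
  have <- : qx`_l = peval (c l) x.
    rewrite /c /peval raddf_sum /= coef_sum big_mkcond /=.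
    rewrite [RHS]big_mkcond /=; apply: eq_bigr => u _.
    rewrite coefZ coefXn mevalZ mevalX eq_sym; case: eqP => _.
      by rewrite mulr1; congr (_ * _); apply: eq_bigr => i _; rewrite mnmE.
    by rewrite mulr0.
  by rewrite qx0 coef0.
apply/mpolyP => u; rewrite mcoeff0; apply/eqP/negP => pu.
have := congr1 (mcoeff (tr u)) (c0 (u ord_max)); rewrite mcoeff0 raddf_sum /=.
rewrite -big_filter (bigD1_seq u) /=; last first.
- by rewrite filter_uniq // msupp_uniq.
- by rewrite mem_filter eqxx mcoeff_msupp; apply/negP.
rewrite big_filter_cond big_seq_cond big1 => [|v /andP[_ /andP[/eqP vu /negP nvu]]].
  by rewrite addr0 mcoeffZ mcoeffX eqxx mulr1 => /eqP.
rewrite mcoeffZ mcoeffX; case: eqP => [tuv|_]; last by rewrite mulr0.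
case: nvu; apply/eqP/mnmP => i.
case: (unliftP ord_max i) => [j ->|->]; last by rewrite vu.
have -> : lift ord_max j = widen_ord (leqnSn n) j.
  by apply/val_inj; rewrite /= /bump leqNgt ltn_ord.
by have := congr1 (fun w : 'X_{1..n} => w j) tuv; rewrite !mnmE.
Qed.

Lemma peval_neq0 n (p : {mpoly C[n]}) : p != 0 ->
  exists2 x, gt1 x & peval p x != 0.
Proof.
move=> p0; apply: boolp.contrapT => np; case/eqP: p0; apply: peval_dense => x x1.
by apply/eqP; apply: contra_notT np => px; exists x.
Qed.

Lemma gt1_torus n (x : 'rV[C]_n) : gt1 x -> torus x.
Proof. by move=> x1 j; rewrite gt_eqF // (lt_trans ltr01). Qed.

(** ** Functions rational in the coordinates of a map *)

Section Ratl.
Variables (n m : nat) (D : 'rV[C]_n -> Prop) (V : 'rV[C]_n -> 'rV[C]_m).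
Implicit Types (f g : 'rV[C]_n -> C).

(** The fraction is required at every point of D, not only generically, so that
   such functions can be evaluated at special points. *)
Definition ratl f := exists p q : {mpoly C[m]}, forall x, D x ->
  peval q (V x) != 0 /\ f x = peval p (V x) / peval q (V x).

Lemma ratl_eq f g : (forall x, D x -> f x = g x) -> ratl g -> ratl f.
Proof.
by move=> fg [p [q h]]; exists p, q => x Dx; rewrite fg //; apply: h.
Qed.

Lemma ratlC c : ratl (fun=> c).
Proof.
by exists c%:MP, 1%:MP => x _; rewrite !pevalS oner_neq0 divr1.
Qed.

Lemma ratl_coord i : ratl (fun x => V x 0 i).
Proof.
by exists 'X_i, 1%:MP => x _; rewrite !pevalS oner_neq0 divr1.
Qed.

Lemma ratlD f g : ratl f -> ratl g -> ratl (fun x => f x + g x).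
Proof.
move=> [p [q h]] [p' [q' h']]; exists (p * q' + p' * q), (q * q') => x Dx.
have [q0 ->] := h x Dx; have [q0' ->] := h' x Dx.
by rewrite !pevalS mulf_neq0 // addf_div.
Qed.

Lemma ratlM f g : ratl f -> ratl g -> ratl (fun x => f x * g x).
Proof.
move=> [p [q h]] [p' [q' h']]; exists (p * p'), (q * q') => x Dx.
have [q0 ->] := h x Dx; have [q0' ->] := h' x Dx.
by rewrite !pevalS mulf_neq0 // mulf_div.
Qed.

Lemma ratlN f : ratl f -> ratl (fun x => - f x).
Proof.
move=> [p [q h]]; exists (- p), q => x Dx; have [q0 ->] := h x Dx.
by rewrite !pevalS mulNr.
Qed.

Lemma ratlB f g : ratl f -> ratl g -> ratl (fun x => f x - g x).
Proof. by move=> rf rg; apply: ratlD => //; apply: ratlN. Qed.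

Lemma ratlV f : (forall x, D x -> f x != 0) -> ratl f ->
  ratl (fun x => (f x)^-1).
Proof.
move=> f0 [p [q h]]; exists q, p => x Dx; have [q0 e] := h x Dx.
by have := f0 x Dx; rewrite e invf_div mulf_eq0 negb_or => /andP[].
Qed.

Lemma ratlX k f : ratl f -> ratl (fun x => f x ^+ k).
Proof.
move=> rf; elim: k => [|k IH]; first exact: ratlC.
by apply: ratl_eq (ratlM rf IH) => x _; rewrite exprS.
Qed.

Lemma ratl_sum (I : Type) (r : seq I) (P : pred I) (F : I -> 'rV[C]_n -> C) :
  (forall i, ratl (F i)) -> ratl (fun x => \sum_(i <- r | P i) F i x).
Proof.
move=> rF; elim: r => [|i r IH].
  by apply: ratl_eq (ratlC 0) => x _; rewrite big_nil.
case Pi : (P i); last by apply: ratl_eq IH => x _; rewrite big_cons Pi.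
by apply: ratl_eq (ratlD (rF i) IH) => x _; rewrite big_cons Pi.
Qed.

Lemma ratl_prod (I : Type) (r : seq I) (F : I -> 'rV[C]_n -> C) :
  (forall i, ratl (F i)) -> ratl (fun x => \prod_(i <- r) F i x).
Proof.
move=> rF; elim: r => [|i r IH].
  by apply: ratl_eq (ratlC 1) => x _; rewrite big_nil.
by apply: ratl_eq (ratlM (rF i) IH) => x _; rewrite big_cons.
Qed.

Lemma ratl_peval k (p : {mpoly C[k]}) (F : 'rV[C]_n -> 'rV[C]_k) :
  (forall j, ratl (fun x => F x 0 j)) -> ratl (fun x => peval p (F x)).
Proof.
move=> rF; apply: (@ratl_eq _ (fun x =>
  \sum_(u <- msupp p) p@_u * \prod_i F x 0 i ^+ u i)).
  by move=> x _; apply: pevalE.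
apply: ratl_sum => u; apply: ratlM; first exact: ratlC.
by apply: ratl_prod => i; apply: ratlX.
Qed.

End Ratl.

Lemma ratl_sub n m (D D' : 'rV[C]_n -> Prop) (V : 'rV[C]_n -> 'rV[C]_m) f :
  (forall x, D' x -> D x) -> ratl D V f -> ratl D' V f.
Proof. by move=> DD' [p [q h]]; exists p, q => x /DD' /h. Qed.

Lemma ratl_comp n m k (D : 'rV[C]_n -> Prop) (V : 'rV[C]_n -> 'rV[C]_m)
    (E : 'rV[C]_k -> Prop) (F : 'rV[C]_n -> 'rV[C]_k) f :
  ratl E id f -> (forall x, D x -> E (F x)) ->
  (forall j, ratl D V (fun x => F x 0 j)) -> ratl D V (fun x => f (F x)).
Proof.
move=> [p [q h]] DE rF.
apply: (@ratl_eq _ _ _ _ _ (fun x => peval p (F x) * (peval q (F x))^-1)).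
  by move=> x /DE /h[].
apply: ratlM; first exact: ratl_peval.
by apply: ratlV; [move=> x /DE /h[] | apply: ratl_peval].
Qed.

(** ** Subtraction-free functions *)

(** In the partial order of the complex numbers, 0 <= c says that c is real and
   nonnegative. *)
Definition posp n (p : {mpoly C[n]}) := p != 0 /\ forall u, 0 <= p@_u.

Lemma posp_gt0 n (p : {mpoly C[n]}) (x : 'rV[C]_n) :
  posp p -> (forall j, 0 < x 0 j) -> 0 < peval p x.
Proof.
move=> [p0 pc] x0; rewrite pevalE.
have pr0 (v : 'X_{1..n}) : 0 < \prod_i x 0 i ^+ v i.
  by apply: prodr_gt0 => i _; rewrite exprn_gt0.
have [u] : exists u, u \in msupp p.
  move: p0; rewrite -msupp_eq0; case: (msupp p) => // u s _.
  by exists u; rewrite inE eqxx.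
move=> up; rewrite (bigD1_seq u) ?msupp_uniq //=; apply: ltr_wpDr.
  by apply: sumr_ge0 => v _; rewrite mulr_ge0 // ltW.
by rewrite mulr_gt0 // lt_def pc andbT -mcoeff_msupp.
Qed.

Lemma pospD n (p q : {mpoly C[n]}) : posp p -> posp q -> posp (p + q).
Proof.
move=> pp pq; split; last first.
  by move=> u; rewrite mcoeffD addr_ge0 //; [case: pp | case: pq].
apply/eqP => e; have := congr1 (fun r => peval r (const_mx 1)) e.
rewrite /= pevalD /peval meval0 => /eqP; rewrite gt_eqF // addr_gt0 //.
  by apply: (posp_gt0 pp) => j; rewrite mxE.
by apply: (posp_gt0 pq) => j; rewrite mxE.
Qed.

Lemma pospM n (p q : {mpoly C[n]}) : posp p -> posp q -> posp (p * q).
Proof.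
move=> [p0 pp] [q0 pq]; split; first by rewrite mulf_neq0.
move=> u; rewrite mcoeffM; apply: sumr_ge0 => k _; exact: mulr_ge0.
Qed.

Lemma pospC n (c : C) : 0 < c -> posp (c%:MP : {mpoly C[n]}).
Proof.
move=> c0; split; first by rewrite mpolyC_eq0 gt_eqF.
by move=> u; rewrite mcoeffC mulr_ge0 ?ler0n // ltW.
Qed.

Lemma pospX n j : posp ('X_j : {mpoly C[n]}).
Proof.
split; last by move=> u; rewrite mcoeffX ler0n.
apply/eqP => /(congr1 (mcoeff U_(j)%MM)).
by rewrite mcoeffX mcoeff0 eqxx => /eqP; rewrite oner_eq0.
Qed.

(** The dense open set is the complement of the zeros of a polynomial with
   nonnegative coefficients.  Its preimage under a subtraction-free map is never
   empty, whereas that of an arbitrary dense open set can be. *)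
Definition pgen n (P : 'rV[C]_n -> Prop) :=
  exists2 k, posp k & forall t, peval k t != 0 -> P t.

Lemma pgenT n (P : 'rV[C]_n -> Prop) : (forall t, P t) -> pgen P.
Proof. by move=> PT; exists 1%:MP => //; apply: pospC. Qed.

Lemma pgen_mono n (P Q : 'rV[C]_n -> Prop) :
  (forall t, P t -> Q t) -> pgen P -> pgen Q.
Proof. by move=> PQ [k kp h]; exists k => // t /h /PQ. Qed.

Lemma pgen_and n (P Q : 'rV[C]_n -> Prop) :
  pgen P -> pgen Q -> pgen (fun t => P t /\ Q t).
Proof.
move=> [k kp h] [l lp g]; exists (k * l); first exact: pospM.
by move=> t; rewrite pevalM_neq0 => /andP[/h ? /g].
Qed.

Lemma pgen_all n (I : finType) (P : I -> 'rV[C]_n -> Prop) :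
  (forall i, pgen (P i)) -> pgen (fun t => forall i, P i t).
Proof.
move=> h; suff: pgen (fun t => forall i, i \in enum I -> P i t).
  by apply: pgen_mono => t g i; apply: g; rewrite mem_enum.
elim: (enum I) => [|i s IH]; first by apply: pgenT.
apply: pgen_mono (pgen_and (h i) IH) => t [gi gs] j.
by rewrite inE => /predU1P[->|/gs].
Qed.

Lemma pgen_torus n : pgen (@torus R n).
Proof.
apply: pgen_all => j; exists 'X_j; first exact: pospX.
by move=> t; rewrite pevalX.
Qed.

Lemma pgen_gt1 n (P : 'rV[C]_n -> Prop) : pgen P -> forall t, gt1 t -> P t.
Proof.
move=> [k kp h] t t1; apply: h; rewrite gt_eqF //.
by apply: posp_gt0 => // j; apply: lt_trans (t1 j).
Qed.

Lemma pgen_pos n (P : 'rV[C]_n -> Prop) :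
  pgen P -> forall t : 'rV[C]_n, (forall j, 0 < t 0 j) -> P t.
Proof. by move=> [k kp h] t t0; apply: h; rewrite gt_eqF // posp_gt0. Qed.

(** The subtraction-free functions.  The numerator is kept away from zero as
   well, so that they form a group under multiplication up to [pgen]. *)
Definition PF n (f : 'rV[C]_n -> C) :=
  exists g h : {mpoly C[n]}, [/\ posp g, posp h & pgen (fun t =>
    [/\ peval g t != 0, peval h t != 0 & f t = peval g t / peval h t])].

Definition PFmap n m (F : 'rV[C]_n -> 'rV[C]_m) :=
  forall j, PF (fun t => F t 0 j).

Section PF.
Variable n : nat.
Implicit Types (f g : 'rV[C]_n -> C).

Lemma PF_pgen f g : pgen (fun t => f t = g t) -> PF g -> PF f.
Proof.
move=> fg [p [q [pp pq h]]]; exists p, q; split=> //.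
by apply: pgen_mono (pgen_and fg h) => t [-> []].
Qed.

Lemma PF_eq f g : (forall t, f t = g t) -> PF g -> PF f.
Proof. by move=> fg; apply: PF_pgen; apply: pgenT. Qed.

Lemma PFC c : 0 < c -> PF (fun _ : 'rV[C]_n => c).
Proof.
move=> c0; exists c%:MP, 1%:MP; split; [exact: pospC | exact: pospC |].
by apply: pgenT => t; rewrite !pevalS gt_eqF // oner_neq0 divr1.
Qed.

Lemma PF_coord j : PF (fun t : 'rV[C]_n => t 0 j).
Proof.
exists 'X_j, 1%:MP; split; [exact: pospX | exact: pospC |].
apply: pgen_mono (pgen_torus n) => t tt.
by rewrite !pevalS tt oner_neq0 divr1.
Qed.

Lemma PFD f g : PF f -> PF g -> PF (fun t => f t + g t).
Proof.
move=> [p [q [pp pq h]]] [p' [q' [pp' pq' h']]].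
have ps : posp (p * q' + p' * q) by apply: pospD; apply: pospM.
exists (p * q' + p' * q), (q * q'); split=> //; first exact: pospM.
have : pgen (fun t => peval (p * q' + p' * q) t != 0) by exists (p * q' + p' * q).
move=> hs; apply: pgen_mono (pgen_and hs (pgen_and h h')) => t.
move=> [s0 [[p0 q0 ->] [p0' q0' ->]]]; split=> //.
  by rewrite pevalM mulf_neq0.
by rewrite !pevalS addf_div.
Qed.

Lemma PFM f g : PF f -> PF g -> PF (fun t => f t * g t).
Proof.
move=> [p [q [pp pq h]]] [p' [q' [pp' pq' h']]].
exists (p * p'), (q * q'); split; [exact: pospM | exact: pospM |].
apply: pgen_mono (pgen_and h h') => t.
move=> [[p0 q0 ->] [p0' q0' ->]].
by rewrite !pevalS !mulf_neq0 // mulf_div.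
Qed.

Lemma PFV f : PF f -> PF (fun t => (f t)^-1).
Proof.
move=> [p [q [pp pq h]]]; exists q, p; split=> //.
by apply: pgen_mono h => t [p0 q0 ->]; rewrite invf_div.
Qed.

Lemma PFdiv f g : PF f -> PF g -> PF (fun t => f t / g t).
Proof. by move=> pf pg; apply: PFM => //; apply: PFV. Qed.

Lemma PFX f k : PF f -> PF (fun t => f t ^+ k).
Proof.
move=> pf; elim: k => [|k IH]; first by apply: PFC.
by apply: PF_eq (PFM pf IH) => t; rewrite exprS.
Qed.

Lemma PFXz f (z : int) : PF f -> PF (fun t => f t ^ z).
Proof. by move=> pf; case: z => k; [|apply: PFV]; apply: PFX. Qed.

Lemma PF_prod (I : Type) (r : seq I) (F : I -> 'rV[C]_n -> C) :
  (forall i, PF (F i)) -> PF (fun t => \prod_(i <- r) F i t).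
Proof.
move=> pF; elim: r => [|i r IH].
  by apply: PF_eq (PFC ltr01) => t; rewrite big_nil.
by apply: PF_eq (PFM (pF i) IH) => t; rewrite big_cons.
Qed.

Lemma PF_sum (I : eqType) (r : seq I) (F : I -> 'rV[C]_n -> C) :
  r != [::] -> {in r, forall i, PF (F i)} -> PF (fun t => \sum_(i <- r) F i t).
Proof.
case: r => // i r _; elim: r i => [|j r IH] i pF.
  by apply: PF_eq (pF i _) => [t|]; rewrite ?big_seq1 ?inE.
have pr : PF (fun t => \sum_(l <- j :: r) F l t).
  by apply: IH => l lr; apply: pF; rewrite inE lr orbT.
by apply: PF_eq (PFD (pF i _) pr) => [t|]; rewrite ?big_cons ?inE ?eqxx.
Qed.

Lemma PF_gt0 f (t : 'rV[C]_n) : PF f -> (forall j, 0 < t 0 j) -> 0 < f t.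
Proof.
move=> [p [q [pp pq h]]] t0; have [_ _ ->] := pgen_pos h t0.
by rewrite divr_gt0 ?posp_gt0.
Qed.

Lemma PF_neq0 f : PF f -> pgen (fun t => f t != 0).
Proof.
move=> [p [q [pp pq h]]]; apply: pgen_mono h => t [p0 q0 ->].
by rewrite mulf_neq0 // invr_neq0.
Qed.

Lemma PF_peval k (p : {mpoly C[k]}) (F : 'rV[C]_n -> 'rV[C]_k) :
  posp p -> PFmap F -> PF (fun t => peval p (F t)).
Proof.
move=> [p0 pp] pF; apply: (@PF_eq _ (fun t =>
  \sum_(u <- msupp p) p@_u * \prod_i F t 0 i ^+ u i)).
  by move=> t; apply: pevalE.
apply: PF_sum => [|u]; first by rewrite msupp_eq0.
rewrite mcoeff_msupp => pu; apply: PFM; first by apply: PFC; rewrite lt_def pu pp.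
by apply: PF_prod => i; apply: PFX.
Qed.

(** After clearing denominators this is a polynomial identity, and the points
   with real coordinates greater than 1 are Zariski dense. *)
Lemma PF_eq_gt1 f g : PF f -> PF g -> (forall t, gt1 t -> f t = g t) ->
  pgen (fun t => f t = g t).
Proof.
move=> [p [q [pp pq h]]] [p' [q' [pp' pq' h']]] fg.
have e : p * q' - p' * q = 0.
  apply: peval_dense => t t1; have := fg t t1.
  have [_ q0 ->] := pgen_gt1 h t1; have [_ q0' ->] := pgen_gt1 h' t1.
  by move/eqP; rewrite eqr_div // !pevalS => /eqP->; rewrite subrr.
apply: pgen_mono (pgen_and h h') => t [[_ q0 ->] [_ q0' ->]].
apply/eqP; rewrite eqr_div // -!pevalM; apply/eqP.
by rewrite (subr0_eq e).
Qed.

End PF.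

Lemma pgen_comp n m (F : 'rV[C]_n -> 'rV[C]_m) (P : 'rV[C]_m -> Prop) :
  PFmap F -> pgen P -> pgen (fun t => P (F t)).
Proof.
move=> pF [k kp h]; have := PF_neq0 (PF_peval kp pF).
by apply: pgen_mono => t /h.
Qed.

Lemma PF_comp n m (F : 'rV[C]_n -> 'rV[C]_m) f :
  PFmap F -> PF f -> PF (fun t => f (F t)).
Proof.
move=> pF [p [q [pp pq h]]].
apply: PF_pgen (PFdiv (PF_peval pp pF) (PF_peval pq pF)).
by apply: pgen_mono (pgen_comp pF h) => t [].
Qed.

Lemma PFmap_comp n m k (F : 'rV[C]_n -> 'rV[C]_m) (G : 'rV[C]_m -> 'rV[C]_k) :
  PFmap F -> PFmap G -> PFmap (fun t => G (F t)).
Proof. by move=> pF pG j; apply: (PF_comp pF (pG j)). Qed.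

Lemma PFmap_id n : PFmap (@id 'rV[C]_n).
Proof. by move=> j; apply: PF_coord. Qed.

Lemma PFmap_eq_gt1 n m (F G : 'rV[C]_n -> 'rV[C]_m) : PFmap F -> PFmap G ->
  (forall t, gt1 t -> F t = G t) -> pgen (fun t => F t = G t).
Proof.
move=> pF pG FG; have : pgen (fun t => forall j, F t 0 j = G t 0 j).
  by apply: pgen_all => j; apply: PF_eq_gt1 => // t /FG ->.
by apply: pgen_mono => t FGt; apply/rowP.
Qed.

End RationalFunctions.

(** * Generic statements on tori and on parametrized varieties *)

Section Generic.
Variable R : realType.
Local Notation C := R[i].
Implicit Types (m n k : nat).

Lemma generic_mono n (X Y P Q : 'rV[C]_n -> Prop) :
  (forall x, X x <-> Y x) -> (forall x, X x -> P x -> Q x) ->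
  generic X P -> generic Y Q.
Proof.
move=> XY PQ [h [x /XY Yx hx] hP]; exists h; first by exists x.
by move=> z /XY Xz hz; apply: PQ => //; apply: hP.
Qed.

Lemma generic_weaken n (X P Q : 'rV[C]_n -> Prop) :
  (forall x, P x -> Q x) -> generic X P -> generic X Q.
Proof. by move=> PQ [h hX hP]; exists h => // x Xx /(hP _ Xx)/PQ. Qed.

Definition irreducible n (X : 'rV[C]_n -> Prop) :=
  forall p q : {mpoly C[n]}, (forall x, X x -> peval (p * q) x = 0) ->
  (forall x, X x -> peval p x = 0) \/ (forall x, X x -> peval q x = 0).

Lemma generic_and n (X P Q : 'rV[C]_n -> Prop) : irreducible X ->
  generic X P -> generic X Q -> generic X (fun x => P x /\ Q x).
Proof.
move=> iX [h [x Xx hx] hP] [g [y Xy gy] gQ]; exists (h * g).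
  apply: boolp.contrapT => nz; case: (iX h g).
  - move=> z Xz; apply/eqP; apply: boolp.contra_notT nz => hz; by exists z.
  - by move=> h0; rewrite h0 ?eqxx in hx.
  - by move=> g0; rewrite g0 ?eqxx in gy.
by move=> z Xz; rewrite pevalM_neq0 => /andP[/hP ? /gQ ?]; split; auto.
Qed.

Lemma torus_eq0 n (p : {mpoly C[n]}) :
  (forall x, torus x -> peval p x = 0) -> p = 0.
Proof. by move=> p0; apply: peval_dense => x /gt1_torus /p0. Qed.

Lemma torus_irr n : irreducible (@torus R n).
Proof.
move=> p q /torus_eq0 /eqP; rewrite mulf_eq0 => /orP[] /eqP->; [left|right];
  by move=> x _; rewrite /peval meval0.
Qed.

Lemma gt1_const n : gt1 (const_mx 2 : 'rV[C]_n).
Proof. by move=> j; rewrite mxE ltr1n. Qed.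

Lemma pgen_generic n (P : 'rV[C]_n -> Prop) : pgen P -> generic (@torus R n) P.
Proof.
move=> [k kp h]; exists k; last by move=> x _; apply: h.
exists (const_mx 2); first exact/gt1_torus/gt1_const.
by rewrite gt_eqF // posp_gt0 // => j; rewrite mxE.
Qed.

Lemma generic_torus_all n (P : 'rV[C]_n -> Prop) :
  (forall x, torus x -> P x) -> generic (@torus R n) P.
Proof.
move=> TP; exists 1%:MP; last by move=> x tx _; apply: TP.
exists (const_mx 2); first exact/gt1_torus/gt1_const.
by rewrite pevalC oner_neq0.
Qed.

Lemma ratl_torus_eq n (f g : 'rV[C]_n -> C) :
  ratl (@torus R n) id f -> ratl (@torus R n) id g ->
  generic (@torus R n) (fun x => f x = g x) -> forall x, torus x -> f x = g x.
Proof.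
move=> rf rg [h [x0 tx0 hx0] hfg].
have [p [q pq]] := ratlB rf rg.
have e : p * h = 0.
  apply: torus_eq0 => x tx; rewrite pevalM.
  have [->|hx] := eqVneq (peval h x) 0; first by rewrite mulr0.
  have [q0] := pq x tx; rewrite (hfg _ tx hx) subrr => /esym/eqP.
  by rewrite mulf_eq0 invr_eq0 (negbTE q0) orbF => /eqP->; rewrite mul0r.
have p0 : p = 0.
  apply/eqP; move/eqP: e; rewrite mulf_eq0 => /orP[//|/eqP h0].
  by rewrite h0 /peval meval0 eqxx in hx0.
move=> x tx; have [_] := pq x tx.
by rewrite p0 /peval meval0 mul0r => /subr0_eq.
Qed.

Lemma PF_ratl n (f : 'rV[C]_n -> C) : PF f ->
  exists2 k : {mpoly C[n]}, posp k & ratl (fun x => peval k x != 0) id f.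
Proof.
move=> [p [q [pp pq [k kp h]]]]; exists k => //; exists p, q => x kx.
by have [] := h x kx.
Qed.

Lemma PFmap_ratl n m (F : 'rV[C]_n -> 'rV[C]_m) : PFmap F ->
  exists2 k : {mpoly C[n]}, posp k &
    forall j, ratl (fun x => peval k x != 0) id (fun x => F x 0 j).
Proof.
move=> pF; suff [k kp h] : exists2 k : {mpoly C[n]}, posp k &
    forall j, j \in enum 'I_m ->
      ratl (fun x => peval k x != 0) id (fun x => F x 0 j).
  by exists k => // j; apply: h; rewrite mem_enum.
elim: (enum _) => [|i s [k kp IH]].
  by exists 1%:MP => //; apply: pospC.
have [l lp r] := PF_ratl (pF i); exists (l * k); first exact: pospM.
have hl x : peval (l * k) x != 0 -> peval l x != 0.
  by rewrite pevalM_neq0 => /andP[].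
have hk x : peval (l * k) x != 0 -> peval k x != 0.
  by rewrite pevalM_neq0 => /andP[].
by move=> j; rewrite inE => /predU1P[->|/IH]; [apply: ratl_sub r | apply: ratl_sub].
Qed.

(** The right inverse shows that the image of F is dense: a nonzero polynomial on
   the target is nonzero at some y with real coordinates greater than 1, and y
   is the image of [G y], whose coordinates are positive. *)
Lemma generic_pull n m (F : 'rV[C]_n -> 'rV[C]_m) (G : 'rV[C]_m -> 'rV[C]_n)
    (P : 'rV[C]_m -> Prop) :
  PFmap F -> PFmap G -> pgen (fun y => F (G y) = y) ->
  generic (@torus R m) P -> generic (@torus R n) (fun x => P (F x)).
Proof.
move=> pF pG FG [h [y0 _ hy0] hP].
have [k kp rF] := PFmap_ratl pF.
have [p [q pq]] := ratl_peval h rF.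
have h0 : h != 0.
  by apply: contraNneq hy0 => ->; rewrite /peval meval0.
have [y y1 hy] := peval_neq0 h0.
have Gy0 j : 0 < G y 0 j.
  by apply: PF_gt0 (pG j) _ => i; apply: lt_trans (y1 i).
have ht : pgen (fun x => @torus R m (F x)) := pgen_comp pF (pgen_torus R m).
have [l lp hl] := ht.
exists (k * p * l).
  exists (G y); first by move=> j; rewrite gt_eqF.
  have kG : peval k (G y) != 0 by rewrite gt_eqF // posp_gt0.
  rewrite !pevalM !mulf_neq0 //; last by rewrite gt_eqF // posp_gt0.
  have [_ e] := pq (G y) kG; move: hy; rewrite -{1}(pgen_gt1 FG y1) e.
  by rewrite mulf_eq0 negb_or => /andP[].
move=> x tx; rewrite !pevalM !mulf_eq0 !negb_or => /andP[/andP[kx px] lx].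
have [q0 e] := pq x kx; apply: hP; first exact: hl.
by rewrite e mulf_neq0 // invr_neq0.
Qed.

Lemma ratl_rational n (f : 'rV[C]_n -> C) :
  ratl (@torus R n) id f -> rational_fun (@torus R n) f.
Proof.
by move=> [p [q pq]]; exists p, q; apply: generic_torus_all => x /pq.
Qed.

Lemma PF_rational n (f : 'rV[C]_n -> C) : PF f -> rational_fun (@torus R n) f.
Proof.
move=> [p [q [_ _ h]]]; exists p, q; apply: pgen_generic.
by apply: pgen_mono h => t [].
Qed.

(** ** Parametrized varieties *)

(** The inverse of a parametrization need only be rational: the denominators
   that recover a parameter are allowed to vanish at some points of X. *)
Definition param k m (X : 'rV[C]_m -> Prop) (V : 'rV[C]_k -> 'rV[C]_m) :=
  [/\ forall w, X w <-> exists2 x, torus x & w = V x,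
      forall i, ratl (@torus R k) id (fun x => V x 0 i) &
      forall j, exists p q : {mpoly C[m]},
        (exists2 x, torus x & peval q (V x) != 0) /\
        (forall x, torus x -> peval p (V x) = x 0 j * peval q (V x))].

Section Param.
Variables (k m : nat) (X : 'rV[C]_m -> Prop) (V : 'rV[C]_k -> 'rV[C]_m).
Hypothesis pV : param X V.

Lemma param_in x : torus x -> X (V x).
Proof. by case: pV => XV _ _ tx; apply/XV; exists x. Qed.

Lemma param_pull (h : {mpoly C[m]}) :
  exists p q : {mpoly C[k]}, forall x, torus x ->
    peval q x != 0 /\ peval h (V x) = peval p x / peval q x.
Proof. by case: pV => _ rV _; apply: (ratl_peval h rV). Qed.

Lemma param_irr : irreducible X.
Proof.
move=> p q pq0; case: pV => XV _ _.
have [p1 [p2 hp]] := param_pull p; have [q1 [q2 hq]] := param_pull q.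
have : forall x, torus x -> peval (p1 * q1) x = 0.
  move=> x tx; have := pq0 _ (param_in tx); rewrite !pevalM.
  have [p0 ->] := hp x tx; have [q0 ->] := hq x tx.
  rewrite mulf_div => /eqP; rewrite mulf_eq0 invr_eq0 mulf_eq0.
  by rewrite [in X in _ || X]mulf_eq0 (negbTE p0) (negbTE q0) !orbF -mulf_eq0 => /eqP.
case/torus_irr => h0; [left|right] => w /XV[x tx ->].
  by have [_ ->] := hp x tx; rewrite h0 // mul0r.
by have [_ ->] := hq x tx; rewrite h0 // mul0r.
Qed.

Lemma param_open : exists D : {mpoly C[m]},
  generic (@torus R k) (fun x => peval D (V x) != 0) /\
  forall j, ratl (fun x => torus x /\ peval D (V x) != 0) V (fun x => x 0 j).
Proof.
have gq (q : {mpoly C[m]}) : (exists2 x, torus x & peval q (V x) != 0) ->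
    generic (@torus R k) (fun x => peval q (V x) != 0).
  move=> [x0 tx0 qx0]; have [q1 [q2 hq]] := param_pull q.
  exists q1.
    exists x0 => //; have [q20 e] := hq x0 tx0; move: qx0; rewrite e.
    by rewrite mulf_eq0 negb_or => /andP[].
  by move=> x tx q1x; have [q20 ->] := hq x tx; rewrite mulf_neq0 // invr_neq0.
suff [D [gD rD]] : exists D : {mpoly C[m]},
    generic (@torus R k) (fun x => peval D (V x) != 0) /\
    forall j, j \in enum 'I_k ->
      ratl (fun x => torus x /\ peval D (V x) != 0) V (fun x => x 0 j).
  by exists D; split=> // j; apply: rD; rewrite mem_enum.
elim: (enum _) => [|i s [D [gD rD]]].
  exists 1%:MP; split=> //; apply: generic_torus_all => x _.
  by rewrite pevalC oner_neq0.
case: pV => _ _ /(_ i)[p [q [/gq gq' pq]]].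
exists (q * D); split.
  apply: generic_mono (generic_and (@torus_irr k) gq' gD) => // x _ [? ?].
  by rewrite pevalM mulf_neq0.
move=> j; rewrite inE => /predU1P[->|/rD]; last first.
  apply: ratl_sub => x [tx]; rewrite pevalM_neq0.
  by case/andP.
exists p, q => x [tx]; rewrite pevalM_neq0 => /andP[qx _].
by rewrite pq // mulfK.
Qed.

(** A condition on x can be expressed by polynomials in the coordinates of V x
   outside the zeros of one denominator, hence dense open subsets of the torus
   and of X correspond to each other. *)
Lemma param_generic (P : 'rV[C]_m -> Prop) :
  generic X P <-> generic (@torus R k) (fun x => P (V x)).
Proof.
case: (pV) => XV _ _; split=> [[h [w Xw hw] hP]|].
  have [p [q pq]] := param_pull h; exists p.
    case/XV: Xw hw => x tx -> hw; exists x => //.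
    by have [q0 e] := pq x tx; move: hw; rewrite e mulf_eq0 negb_or => /andP[].
  move=> x tx px; apply: hP; first exact: param_in.
  by have [q0 ->] := pq x tx; rewrite mulf_neq0 // invr_neq0.
move=> [h [x0 tx0 hx0] hP]; have [D [gD rD]] := param_open.
have [p [q pq]] := ratl_peval h rD.
have [l [x tx lx] hl] : generic (@torus R k)
    (fun x => peval D (V x) != 0 /\ peval h x != 0).
  by apply: generic_and => //; [apply: torus_irr | exists h => //; exists x0].
exists (D * p).
  have [Dx hx] := hl x tx lx; exists (V x); first exact: param_in.
  have [q0 e] := pq x (conj tx Dx); rewrite pevalM mulf_neq0 //.
  by move: hx; rewrite e mulf_eq0 negb_or => /andP[].
move=> _ /XV[z tz ->]; rewrite pevalM_neq0 => /andP[Dz pz].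
apply: hP => //; have [q0 ->] := pq z (conj tz Dz).
by rewrite mulf_neq0 // invr_neq0.
Qed.

Lemma param_rational f g : rational_fun (@torus R k) g ->
  generic (@torus R k) (fun x => f (V x) = g x) -> rational_fun X f.
Proof.
move=> [p [q pq]] fg; have [D [gD rD]] := param_open.
have [p1 [p2 hp]] := ratl_peval p rD; have [q1 [q2 hq]] := ratl_peval q rD.
exists (p1 * q2), (p2 * q1); apply/param_generic.
have tI := @torus_irr k.
apply: generic_mono (generic_and tI gD (generic_and tI pq fg)) => // x tx.
move=> [Dx [[qx gx] fx]]; rewrite fx gx.
have [p20 ->] := hp x (conj tx Dx); have [q20 qE] := hq x (conj tx Dx).
have q10 : peval q1 (V x) != 0.
  by move: qx; rewrite qE mulf_eq0 negb_or => /andP[].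
by rewrite !pevalM mulf_neq0 //; split=> //; rewrite qE invf_div mulf_div.
Qed.

End Param.

Lemma Gm_torus n (z : 'rV[C]_(1 + n)) : Gm (@torus R n) z <-> torus z.
Proof.
split=> [[z0 zr] j|tz]; last first.
  by split=> [|j]; rewrite mxE; apply: tz.
case: (splitP j) => [i ij|i ij].
  have -> : j = lshift n 0 by apply/val_inj; rewrite /= ij ord1.
  by move: z0; rewrite mxE.
have -> : j = rshift 1 i by apply/val_inj.
by have := zr i; rewrite mxE.
Qed.

Lemma peval_rsub n (p : {mpoly C[n]}) : exists p' : {mpoly C[1 + n]},
  forall z, peval p' z = peval p (rsubmx z).
Proof.
exists (p \mPo [tuple 'X_(rshift 1 j) | j < n]) => z.
rewrite /peval comp_mpoly_meval; apply: meval_eq => j.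
by rewrite tnth_mktuple mevalXU mxE.
Qed.

Definition Gmap k m (V : 'rV[C]_k -> 'rV[C]_m) (z : 'rV[C]_(1 + k)) :
  'rV[C]_(1 + m) := row_mx (lsubmx z) (V (rsubmx z)).

Lemma param_Gm k m (X : 'rV[C]_m -> Prop) (V : 'rV[C]_k -> 'rV[C]_m) :
  param X V -> param (Gm X) (Gmap V).
Proof.
move=> pV; have [XV rV iV] := pV; split=> [w|i|j].
- split=> [[w0 /XV[x tx wx]]|[z /Gm_torus[z0 zr] ->]]; last first.
    rewrite /Gmap; split; rewrite ?row_mxKl ?row_mxKr //.
    exact: (param_in pV).
  exists (row_mx (lsubmx w) x).
    by apply/Gm_torus; split; rewrite ?row_mxKl ?row_mxKr.
  by rewrite /Gmap row_mxKl row_mxKr -wx hsubmxK.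
- rewrite /Gmap; case: (splitP i) => [i' ij|i' ij].
    have -> : i = lshift m i' by apply/val_inj.
    apply: (@ratl_eq _ _ _ _ _ _ (fun z => z 0 (lshift k i'))).
      by move=> z _; rewrite row_mxEl mxE.
    exact: ratl_coord.
  have -> : i = rshift 1 i' by apply/val_inj.
  apply: (@ratl_eq _ _ _ _ _ _ (fun z => V (rsubmx z) 0 i')).
    by move=> z _; rewrite row_mxEr.
  apply: (ratl_comp (rV i')) => [z /Gm_torus[]|j] //.
  apply: (@ratl_eq _ _ _ _ _ _ (fun z => z 0 (rshift 1 j))).
    by move=> z _; rewrite mxE.
  exact: ratl_coord.
case: (splitP j) => [i' ij|i' ij].
  have -> : j = lshift k i' by apply/val_inj.
  exists 'X_(lshift m i'), 1%:MP; split.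
    exists (const_mx 2); first exact/gt1_torus/gt1_const.
    by rewrite pevalC oner_neq0.
  by move=> z _; rewrite pevalX pevalC mulr1 /Gmap row_mxEl mxE.
have -> : j = rshift 1 i' by apply/val_inj.
have [p [q [[x tx qx] pq]]] := iV i'.
have [p' p'E] := peval_rsub p; have [q' q'E] := peval_rsub q.
exists p', q'; split.
  exists (row_mx 1%:M x).
    apply/Gm_torus; split; rewrite ?row_mxKl ?row_mxKr //.
    by rewrite mxE eqxx oner_neq0.
  by rewrite q'E /Gmap !row_mxKr.
move=> z /Gm_torus[_ tz]; rewrite p'E q'E /Gmap row_mxKr pq //.
by rewrite [rsubmx z 0 i']mxE.
Qed.

End Generic.

(** ** Statements with parameters in the multiplicative group *)

Section Families.
Variable R : realType.
Local Notation C := R[i].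
Implicit Types (m n k : nat).

Definition pgen1 n (P : C -> 'rV[C]_n -> Prop) := pgen (uncurry_Gm P).
Definition pgen2 n (P : C -> C -> 'rV[C]_n -> Prop) :=
  pgen (uncurry_Gm (fun c => uncurry_Gm (P c))).

Lemma uncurry_row n T (P : C -> 'rV[C]_n -> T) c x :
  uncurry_Gm P (row_mx c%:M x) = P c x.
Proof. by rewrite /uncurry_Gm row_mxKl row_mxKr mxE eqxx mulr1n. Qed.

Lemma PF_head n : PF (fun z : 'rV[C]_(1 + n) => lsubmx z 0 0).
Proof.
by apply: PF_eq (PF_coord R (lshift n 0)) => z; rewrite mxE.
Qed.

Lemma PFmap_tail n : PFmap (fun z : 'rV[C]_(1 + n) => rsubmx z).
Proof.
by move=> j; apply: PF_eq (PF_coord R (rshift 1 j)) => z; rewrite mxE.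
Qed.

Lemma PF_head2 n : PF (fun z : 'rV[C]_(1 + (1 + n)) => lsubmx (rsubmx z) 0 0).
Proof. exact: (PF_comp (@PFmap_tail _) (@PF_head n)). Qed.

Lemma PFmap_tail2 n : PFmap (fun z : 'rV[C]_(1 + (1 + n)) => rsubmx (rsubmx z)).
Proof. exact: (PFmap_comp (@PFmap_tail _) (@PFmap_tail n)). Qed.

Lemma PFmap_row n l (c : 'rV[C]_l -> C) (F : 'rV[C]_l -> 'rV[C]_n) :
  PF c -> PFmap F -> PFmap (fun t => row_mx (c t)%:M (F t)).
Proof.
move=> pc pF j; case: (splitP j) => [i ij|i ij].
  have -> : j = lshift n i by apply/val_inj.
  by apply: PF_eq pc => t; rewrite row_mxEl ord1 mxE eqxx mulr1n.
have -> : j = rshift 1 i by apply/val_inj.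
by apply: PF_eq (pF i) => t; rewrite row_mxEr.
Qed.

Lemma PFmap_act n l m (e : C -> 'rV[C]_n -> 'rV[C]_m) (c : 'rV[C]_l -> C)
    (F : 'rV[C]_l -> 'rV[C]_n) :
  PFmap (uncurry_Gm e) -> PF c -> PFmap F -> PFmap (fun t => e (c t) (F t)).
Proof.
move=> pe pc pF j; apply: PF_eq (PFmap_comp (PFmap_row pc pF) pe j) => t.
by rewrite uncurry_row.
Qed.

Lemma pgen1_at n l (P : C -> 'rV[C]_n -> Prop) (c : 'rV[C]_l -> C)
    (F : 'rV[C]_l -> 'rV[C]_n) :
  PF c -> PFmap F -> pgen1 P -> pgen (fun t => P (c t) (F t)).
Proof.
move=> pc pF gP; apply: pgen_mono (pgen_comp (PFmap_row pc pF) gP) => t.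
by rewrite uncurry_row.
Qed.

Lemma pgen2_at n l (P : C -> C -> 'rV[C]_n -> Prop) (c d : 'rV[C]_l -> C)
    (F : 'rV[C]_l -> 'rV[C]_n) :
  PF c -> PF d -> PFmap F -> pgen2 P -> pgen (fun t => P (c t) (d t) (F t)).
Proof.
move=> pc pd pF gP.
apply: pgen_mono (pgen_comp (PFmap_row pc (PFmap_row pd pF)) gP) => t.
by rewrite !uncurry_row.
Qed.

Lemma PF1 n : PF (fun _ : 'rV[C]_n => 1).
Proof. exact: PFC. Qed.

Lemma generic1_torus n (P : C -> 'rV[C]_n -> Prop) :
  generic1 (@torus R n) P <-> generic (@torus R (1 + n)) (uncurry_Gm P).
Proof.
split; apply: generic_mono => // z; first exact: Gm_torus.
by split=> /Gm_torus.
Qed.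

Lemma generic2_torus n (P : C -> C -> 'rV[C]_n -> Prop) :
  generic2 (@torus R n) P <->
  generic (@torus R (1 + (1 + n))) (uncurry_Gm (fun c => uncurry_Gm (P c))).
Proof.
have e (z : 'rV[C]_(1 + (1 + n))) : Gm (Gm (@torus R n)) z <-> torus z.
  split=> [[z0 zr]|/Gm_torus[z0 zr]]; last by split=> //; apply/Gm_torus.
  by apply/Gm_torus; split=> //; apply/Gm_torus.
by split; apply: generic_mono => // z; rewrite e.
Qed.

Lemma pgen_generic1 n (P : C -> 'rV[C]_n -> Prop) :
  pgen1 P -> generic1 (@torus R n) P.
Proof. by move=> gP; apply/generic1_torus/pgen_generic. Qed.

Lemma pgen_generic2 n (P : C -> C -> 'rV[C]_n -> Prop) :
  pgen2 P -> generic2 (@torus R n) P.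
Proof. by move=> gP; apply/generic2_torus/pgen_generic. Qed.

Lemma generic1_and n (P Q : C -> 'rV[C]_n -> Prop) :
  generic1 (@torus R n) P -> generic1 (@torus R n) Q ->
  generic1 (@torus R n) (fun c x => P c x /\ Q c x).
Proof.
move=> /generic1_torus gP /generic1_torus gQ; apply/generic1_torus.
exact: generic_and (@torus_irr _ _) gP gQ.
Qed.

Lemma generic2_and n (P Q : C -> C -> 'rV[C]_n -> Prop) :
  generic2 (@torus R n) P -> generic2 (@torus R n) Q ->
  generic2 (@torus R n) (fun c d x => P c d x /\ Q c d x).
Proof.
move=> /generic2_torus gP /generic2_torus gQ; apply/generic2_torus.
exact: generic_and (@torus_irr _ _) gP gQ.
Qed.

Lemma generic1_mono n (P Q : C -> 'rV[C]_n -> Prop) :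
  (forall c x, P c x -> Q c x) -> generic1 (@torus R n) P ->
  generic1 (@torus R n) Q.
Proof. by move=> PQ; apply: generic_mono => // z _; apply: PQ. Qed.

Lemma generic2_mono n (P Q : C -> C -> 'rV[C]_n -> Prop) :
  (forall c d x, P c d x -> Q c d x) -> generic2 (@torus R n) P ->
  generic2 (@torus R n) Q.
Proof. by move=> PQ; apply: generic_mono => // z _; apply: PQ. Qed.

Lemma param_generic1 k m (X : 'rV[C]_m -> Prop) (V : 'rV[C]_k -> 'rV[C]_m) P :
  param X V -> generic1 X P <-> generic1 (@torus R k) (fun c x => P c (V x)).
Proof.
move=> pV; split=> [/(param_generic (param_Gm pV)) g|/generic1_torus g].
  by apply/generic1_torus; apply: generic_mono g => // z _;
    rewrite /Gmap /uncurry_Gm row_mxKl row_mxKr.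
apply/(param_generic (param_Gm pV)); apply: generic_mono g => // z _.
by rewrite /Gmap /uncurry_Gm row_mxKl row_mxKr.
Qed.

Lemma param_generic2 k m (X : 'rV[C]_m -> Prop) (V : 'rV[C]_k -> 'rV[C]_m) P :
  param X V ->
  generic2 X P <-> generic2 (@torus R k) (fun c d x => P c d (V x)).
Proof.
move=> pV; have pV2 := param_Gm (param_Gm pV).
have e z : uncurry_Gm (fun c => uncurry_Gm (P c)) (Gmap (Gmap V) z) <->
    uncurry_Gm (fun c => uncurry_Gm (fun d x => P c d (V x))) z.
  by rewrite /Gmap /uncurry_Gm row_mxKl row_mxKr row_mxKl row_mxKr.
split=> [/(param_generic pV2) g|/generic2_torus g].
  by apply/generic2_torus; apply: generic_mono g => // z _ /e.
by apply/(param_generic pV2); apply: generic_mono g => // z _ /e.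
Qed.

Lemma generic1_pull n (P : 'rV[C]_n -> Prop) (e : C -> 'rV[C]_n -> 'rV[C]_n) :
  PFmap (uncurry_Gm e) -> pgen (fun x => e 1 x = x) ->
  generic (@torus R n) P -> generic1 (@torus R n) (fun c x => P (e c x)).
Proof.
move=> pe e1 gP; apply/generic1_torus.
have h : pgen (fun x => uncurry_Gm e (row_mx 1%:M (id x)) = x).
  by apply: pgen_mono e1 => x; rewrite uncurry_row.
exact: generic_pull pe (PFmap_row (PF1 n) (@PFmap_id R n)) h gP.
Qed.

Lemma generic_tail n (P : 'rV[C]_n -> Prop) :
  generic (@torus R n) P ->
  generic (@torus R (1 + n)) (fun z => P (rsubmx z)).
Proof.
have h : pgen (fun x : 'rV[C]_n => rsubmx (row_mx (1%:M : 'M[C]_1) x) = x).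
  by apply: pgenT => x; rewrite row_mxKr.
exact: generic_pull (@PFmap_tail n) (PFmap_row (PF1 n) (@PFmap_id R n)) h.
Qed.

Lemma generic1_tail n (P : 'rV[C]_n -> Prop) :
  generic (@torus R n) P -> generic1 (@torus R n) (fun _ x => P x).
Proof. by move=> gP; apply/generic1_torus; apply: generic_tail gP. Qed.

Lemma generic_eq0 n (X : 'rV[C]_n -> Prop) (p : {mpoly C[n]}) :
  irreducible X -> generic X (fun x => peval p x = 0) ->
  forall x, X x -> peval p x = 0.
Proof.
move=> iX [h [x0 Xx0 hx0] hp]; case: (iX h p) => [x Xx|h0|//].
  rewrite pevalM; have [->|hx] := eqVneq (peval h x) 0; first by rewrite mul0r.
  by rewrite hp // mulr0.
by rewrite h0 ?eqxx in hx0.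
Qed.

(** The denominators of a subtraction-free map have nonnegative coefficients, and
   V is regular on the torus, so the composition is regular off the zeros of one
   polynomial with nonnegative coefficients. *)
Lemma ratl_param_comp n k m (X : 'rV[C]_m -> Prop) (V : 'rV[C]_k -> 'rV[C]_m)
    (F : 'rV[C]_n -> 'rV[C]_k) : param X V -> PFmap F ->
  exists2 l : {mpoly C[n]}, posp l &
    forall j, ratl (fun z => peval l z != 0) id (fun z => V (F z) 0 j).
Proof.
move=> [_ rV _] pF; have [k0 k0p rE] := PFmap_ratl pF.
have [l0 l0p lE] := pgen_comp pF (pgen_torus R k).
exists (k0 * l0) => [|j]; first exact: pospM.
apply: (ratl_comp (rV j)) => [z|l].
  by rewrite pevalM_neq0 => /andP[_ /lE].
apply: ratl_sub (rE l) => z.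
by rewrite pevalM_neq0 => /andP[].
Qed.

Lemma rational_param_comp n k m (X : 'rV[C]_m -> Prop) (V : 'rV[C]_k -> 'rV[C]_m)
    (F : 'rV[C]_n -> 'rV[C]_k) j : param X V -> PFmap F ->
  rational_fun (@torus R n) (fun z => V (F z) 0 j).
Proof.
move=> pV pF; have [l lp /(_ j)[p [q pq]]] := ratl_param_comp pV pF.
exists p, q; apply: pgen_generic; exists l => // z; exact: pq.
Qed.

End Families.

(** * Birationality and positivity of a parametrization *)

Section Birational.
Variable R : realType.
Local Notation C := R[i].

Lemma posp_char n (p : {mpoly C[n]}) : posp p ->
  exists2 s, pos_comb s & forall t : 'rV[C]_n, char_comb s t = peval p t.
Proof.
move=> [p0 pc].
exists [seq (p@_u, \row_j ((u j)%:Z)) | u <- msupp p].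
  split=> [|_ /mapP[u up ->]] /=; last first.
    by rewrite lt_def pc andbT -mcoeff_msupp.
  move/(congr1 size); rewrite size_map /= => /eqP; rewrite size_eq0 msupp_eq0.
  exact/negP.
move=> t; rewrite /char_comb big_map pevalE; apply: eq_bigr => u _ /=.
by congr (_ * _); apply: eq_bigr => j _; rewrite mxE.
Qed.

Lemma PF_positive n (f f' : 'rV[C]_n -> C) : PF f' ->
  generic (@torus R n) (fun t => f t = f' t) -> positive_fun f.
Proof.
move=> [p [q [pp pq h]]] ff'.
have [s sp sE] := posp_char pp; have [s' sp' sE'] := posp_char pq.
exists s, s'; split=> //.
have := generic_and (@torus_irr R n) ff' (pgen_generic h).
by apply: generic_mono => // t _ [-> [_ q0 ->]]; rewrite sE sE'.
Qed.

Lemma PF_character n m (u : 'rV[int]_m) (F : 'rV[C]_n -> 'rV[C]_m) : PFmap F ->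
  PF (fun t => character u (F t)).
Proof. by move=> pF; apply: PF_prod => j; apply: PFXz. Qed.

Lemma param_birational k m (X : 'rV[C]_m -> Prop) (V : 'rV[C]_k -> 'rV[C]_m) :
  param X V -> exists theta, birational_inverse (@torus R k) X V theta.
Proof.
move=> pV; have [D [gD rD]] := param_open pV.
have /boolp.choice[f fE] : forall j, exists pq : {mpoly C[m]} * {mpoly C[m]},
    forall x, torus x /\ peval D (V x) != 0 ->
    peval pq.2 (V x) != 0 /\ x 0 j = peval pq.1 (V x) / peval pq.2 (V x).
  by move=> j; have [p [q h]] := rD j; exists (p, q).
pose theta (w : 'rV[C]_m) : 'rV[C]_k := \row_j (peval (f j).1 w / peval (f j).2 w).
have tE x : torus x -> peval D (V x) != 0 -> theta (V x) = x.
  by move=> tx Dx; apply/rowP => j; rewrite mxE; have [_ <-] := fE j x (conj tx Dx).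
have gE : generic (@torus R k) (fun x => theta (V x) = x).
  by apply: generic_mono gD => // x tx; apply: tE.
have tI := @torus_irr R k.
exists theta; split=> //.
- split; split=> [j|].
  + by case: pV => _ rV _; apply: ratl_rational.
  + by apply: generic_torus_all => x; apply: (param_in pV).
  + exists (f j).1, (f j).2; apply/(param_generic pV).
    apply: generic_mono gD => // x tx Dx; rewrite mxE.
    by have [] := fE j x (conj tx Dx).
  by apply/(param_generic pV); apply: generic_mono gE => // x tx ->.
- split=> P gP; first by apply/(param_generic pV).
  apply/(param_generic pV); apply: generic_mono (generic_and tI gE gP) => //.
  by move=> x _ [->].
by apply/(param_generic pV); apply: generic_mono gE => // x tx ->.
Qed.

Lemma param_birational_conj k m m' (X : 'rV[C]_m -> Prop)
    (V : 'rV[C]_k -> 'rV[C]_m) (X' : 'rV[C]_m' -> Prop)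
    (V' : 'rV[C]_k -> 'rV[C]_m') (F G : 'rV[C]_k -> 'rV[C]_k) theta theta' :
  param X V -> param X' V' -> PFmap F -> PFmap G ->
  pgen (fun x => G (F x) = x) -> pgen (fun y => F (G y) = y) ->
  generic (@torus R k) (fun x => theta (V x) = x) ->
  generic (@torus R k) (fun y => theta' (V' y) = y) ->
  birational_inverse X X' (fun w => V' (F (theta w))) (fun w => V (G (theta' w))).
Proof.
move=> pV pV' pF pG GF FG gt gt'.
have tI := @torus_irr R k.
have gF : generic (@torus R k) (fun x => torus (F x)).
  by apply: pgen_generic; apply: pgen_comp pF (pgen_torus R k).
have gG : generic (@torus R k) (fun x => torus (G x)).
  by apply: pgen_generic; apply: pgen_comp pG (pgen_torus R k).
have gt'F := generic_pull pF pG FG gt'.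
have gtG := generic_pull pG pF GF gt.
split.
- split; split=> [j|].
  + apply: (param_rational pV (rational_param_comp j pV' pF)).
    by apply: generic_mono gt => // x _ ->.
  + apply/(param_generic pV); apply: generic_mono (generic_and tI gF gt) => //.
    by move=> x _ [tF ->]; apply: (param_in pV').
  + apply: (param_rational pV' (rational_param_comp j pV pG)).
    by apply: generic_mono gt' => // x _ ->.
  apply/(param_generic pV'); apply: generic_mono (generic_and tI gG gt') => //.
  by move=> x _ [tG ->]; apply: (param_in pV).
- split=> P gP.
    move/(param_generic pV'): gP => /(generic_pull pF pG FG) gP.
    apply/(param_generic pV); apply: generic_mono (generic_and tI gt gP) => //.
    by move=> x _ [->].
  move/(param_generic pV): gP => /(generic_pull pG pF GF) gP.
  apply/(param_generic pV'); apply: generic_mono (generic_and tI gt' gP) => //.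
  by move=> x _ [->].
- apply/(param_generic pV); apply: generic_mono
    (generic_and tI gt (generic_and tI gt'F (pgen_generic GF))) => //.
  by move=> x _ [-> [-> ->]].
apply/(param_generic pV'); apply: generic_mono
  (generic_and tI gt' (generic_and tI gtG (pgen_generic FG))) => //.
by move=> x _ [-> [-> ->]].
Qed.

(** When all parameters are recovered without exceptional points, X is cut out of
   its closure by the denominators and by the condition that the recovered
   parameters be nonzero: the equations z = V (phi z), with phi the inverse,
   hold on X and therefore on its closure. *)
Lemma param_variety k m (X : 'rV[C]_m -> Prop) (V : 'rV[C]_k -> 'rV[C]_m) :
  (forall w, X w <-> exists2 x, torus x & w = V x) ->
  (forall i, ratl (@torus R k) id (fun x => V x 0 i)) ->
  (forall j, ratl (@torus R k) V (fun x => x 0 j)) ->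
  param X V /\ variety X.
Proof.
move=> XV rV iV; have t2 := gt1_torus (@gt1_const R k).
have pV : param X V.
  split=> // j; have [p [q pq]] := iV j; exists p, q; split.
    by exists (const_mx 2) => //; have [] := pq _ t2.
  by move=> x /pq[q0 ->]; rewrite divfK.
split=> //; split; last first.
- have /boolp.choice[f fE] : forall j, exists pq : {mpoly C[m]} * {mpoly C[m]},
      forall x, torus x ->
      peval pq.2 (V x) != 0 /\ x 0 j = peval pq.1 (V x) / peval pq.2 (V x).
    by move=> j; have [p [q h]] := iV j; exists (p, q).
  pose phi (z : 'rV[C]_m) : 'rV[C]_k := \row_j (peval (f j).1 z / peval (f j).2 z).
  pose Dz (z : 'rV[C]_m) :=
    forall j, peval (f j).1 z != 0 /\ peval (f j).2 z != 0.
  have phiV x : torus x -> phi (V x) = x.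
    by move=> tx; apply/rowP=> j; rewrite mxE; have [_ <-] := fE j x tx.
  have DV x : torus x -> Dz (V x).
    move=> tx j; have [q0 xj] := fE j x tx; split=> //.
    by have := tx j; rewrite xj mulf_eq0 negb_or => /andP[].
  have tphi z : Dz z -> torus (phi z).
    by move=> Dzz j; have [p0 q0] := Dzz j; rewrite mxE mulf_neq0 // invr_neq0.
  have rphi j : ratl Dz id (fun z => phi z 0 j).
    by exists (f j).1, (f j).2 => z /(_ j)[_ q0]; rewrite mxE.
  have rT i : ratl Dz id (fun z => V (phi z) 0 i - z 0 i).
    apply: ratlB; last exact: ratl_coord.
    exact: ratl_comp (rV i) tphi rphi.
  move=> w /XV[x tx ->].
  exists (\prod_j ((f j).1 * (f j).2)).
    rewrite peval_prod; apply/prodf_neq0 => j _; rewrite pevalM.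
    by have [p0 q0] := DV x tx j; rewrite mulf_neq0.
  move=> z Xz; rewrite peval_prod => /prodf_neq0 hz.
  have Dzz : Dz z.
    by move=> j; apply/andP; rewrite -negb_or -mulf_eq0 -pevalM hz.
  apply/XV; exists (phi z); first exact: tphi.
  apply/rowP=> i; have [p [q pq]] := rT i; have [q0 e] := pq z Dzz.
  apply/esym/subr0_eq; rewrite e Xz ?mul0r // => _ /XV[y ty ->].
  have [qy ey] := pq _ (DV y ty); move: ey; rewrite phiV // subrr => /esym/eqP.
  by rewrite mulf_eq0 invr_eq0 (negbTE qy) orbF => /eqP.
- exact: param_irr pV.
by exists (V (const_mx 2)); apply: (param_in pV).
Qed.

End Birational.

(** * Crystals on a parametrized variety *)

(** The form in which the Verma relations are established on the torus, and from
   which [verma_act] deduces the generic relations on X. *)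
Definition pverma (R : realType) (r k : nat) (A : 'M[int]_r)
    (e : 'I_r -> R[i] -> 'rV[R[i]]_k -> 'rV[R[i]]_k) : Prop := forall i j,
  [/\ A i j = 0 -> A j i = 0 -> pgen2 (fun c1 c2 x =>
        e i c1 (e j c2 x) = e j c2 (e i c1 x)),
      A i j = -1 -> A j i = -1 -> pgen2 (fun c1 c2 x =>
        e i c1 (e j (c1 * c2) (e i c2 x))
        = e j c2 (e i (c1 * c2) (e j c1 x))),
      A i j = -2 -> A j i = -1 -> pgen2 (fun c1 c2 x =>
        e i c1 (e j (c1 ^+ 2 * c2) (e i (c1 * c2) (e j c2 x)))
        = e j c2 (e i (c1 * c2) (e j (c1 ^+ 2 * c2) (e i c1 x)))) &
      A i j = -3 -> A j i = -1 -> pgen2 (fun c1 c2 x =>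
        e i c1 (e j (c1 ^+ 3 * c2) (e i (c1 ^+ 2 * c2)
          (e j (c1 ^+ 3 * c2 ^+ 2) (e i (c1 * c2) (e j c2 x)))))
        = e j c2 (e i (c1 * c2) (e j (c1 ^+ 3 * c2 ^+ 2)
          (e i (c1 ^+ 2 * c2) (e j (c1 ^+ 3 * c2) (e i c1 x))))))].

Section Crystal.
Variables (R : realType) (r k m : nat) (A : 'M[int]_r).
Local Notation C := R[i].
Variables (X : 'rV[C]_m -> Prop) (V : 'rV[C]_k -> 'rV[C]_m).
Variable (chi : crystal_data R r m).
Variable (e : 'I_r -> C -> 'rV[C]_k -> 'rV[C]_k) (g ep : 'I_r -> 'rV[C]_k -> C).

Hypothesis pV : param X V.
Hypothesis pe : forall i, PFmap (uncurry_Gm (e i)).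
Hypothesis pg : forall i, PF (g i).
Hypothesis pep : forall i, PF (ep i).
Hypothesis actE : forall i,
  generic1 (@torus R k) (fun c x => act chi i c (V x) = V (e i c x)).
Hypothesis gamE : forall i,
  generic (@torus R k) (fun x => gam chi i (V x) = g i x).
Hypothesis epsE : forall i,
  generic (@torus R k) (fun x => eps chi i (V x) = ep i x).
Hypothesis e1 : forall i, pgen (fun x => e i 1 x = x).
Hypothesis eM : forall i,
  pgen2 (fun c1 c2 x => e i c1 (e i c2 x) = e i (c1 * c2) x).

(** ** Compositions of actions with monomial parameters *)

Definition mstep := ('I_r * (nat * nat))%type.
Implicit Type (s : seq mstep).

Definition mpar (u : mstep) (c1 c2 : C) := c1 ^+ u.2.1 * c2 ^+ u.2.2.

Definition mrun (Z : Type) (f : 'I_r -> C -> Z -> Z) s c1 c2 x :=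
  foldr (fun u => f u.1 (mpar u c1 c2)) x s.

(** A right inverse of the run, see [mrunK]. *)
Definition mrunV s c1 c2 (x : 'rV[C]_k) :=
  foldl (fun x u => e u.1 (mpar u c1 c2)^-1 x) x s.

(** The exponents form a primitive vector, so the parameter takes any prescribed
   value d at suitable powers of d. *)
Definition primitive_par (u : mstep) :=
  exists v w : int, u.2.1%:Z * v + u.2.2%:Z * w = 1.

Section PFruns.
Variables (l : nat) (c1 c2 : 'rV[C]_l -> C) (F : 'rV[C]_l -> 'rV[C]_k).
Hypotheses (p1 : PF c1) (p2 : PF c2) (pF : PFmap F).

Lemma PF_mpar u : PF (fun t => mpar u (c1 t) (c2 t)).
Proof. by apply: PFM; apply: PFX. Qed.

Lemma PFmap_mrun s : PFmap (fun t => mrun e s (c1 t) (c2 t) (F t)).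
Proof.
by elim: s => //= u s IH; apply: (PFmap_act (pe u.1)) => //; apply: PF_mpar.
Qed.

Lemma PFmap_mrunV s : PFmap (fun t => mrunV s (c1 t) (c2 t) (F t)).
Proof.
rewrite /mrunV; elim: s F pF => //= u s IH G pG.
apply: (IH (fun t => e u.1 (mpar u (c1 t) (c2 t))^-1 (G t))).
by apply: (PFmap_act (pe u.1)) => //; apply/PFV/PF_mpar.
Qed.

Lemma mrunK s :
  pgen (fun t => mrun e s (c1 t) (c2 t) (mrunV s (c1 t) (c2 t) (F t)) = F t).
Proof.
rewrite /mrunV; elim: s F pF => [|u s IH] G pG /=; first exact: pgenT.
have pu := PF_mpar u.
pose H t := e u.1 (mpar u (c1 t) (c2 t))^-1 (G t).
have pH : PFmap H by apply: (PFmap_act (pe u.1)) => //; apply: PFV.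
have := pgen2_at pu (PFV pu) pG (eM u.1).
have := pgen_comp pG (e1 u.1).
move=> g1 g2.
apply: pgen_mono (pgen_and (pgen_and g1 g2) (pgen_and (PF_neq0 pu) (IH H pH))) => t.
by move=> [[h1 h2] [h3 h4]]; rewrite h4 /H h2 mulfV.
Qed.

End PFruns.

(** The action is known at generic pairs (c, z) only.  That the pair formed by the
   parameter of u and the point reached by the run s is generic when c1, c2 and
   x are follows from a right inverse of this substitution, which the inverse
   operators and primitivity provide. *)
Lemma generic2_act u s : primitive_par u ->
  generic2 (@torus R k) (fun c1 c2 x =>
    act chi u.1 (mpar u c1 c2) (V (mrun e s c1 c2 x))
    = V (e u.1 (mpar u c1 c2) (mrun e s c1 c2 x))).
Proof.
move=> [v [w vw]]; apply/generic2_torus.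
have p1 := @PF_head R (1 + k).
have p2 := @PF_head2 R k; have p3 := @PFmap_tail2 R k.
pose F (z : 'rV[C]_(1 + (1 + k))) : 'rV[C]_(1 + k) :=
  row_mx (mpar u (lsubmx z 0 0) (lsubmx (rsubmx z) 0 0))%:M
    (mrun e s (lsubmx z 0 0) (lsubmx (rsubmx z) 0 0) (rsubmx (rsubmx z))).
pose d (z : 'rV[C]_(1 + k)) : C := lsubmx z 0 0.
pose G (z : 'rV[C]_(1 + k)) : 'rV[C]_(1 + (1 + k)) :=
  row_mx (d z ^ v)%:M (row_mx (d z ^ w)%:M
    (mrunV s (d z ^ v) (d z ^ w) (rsubmx z))).
have pF : PFmap F by apply: PFmap_row; [apply: PF_mpar | apply: PFmap_mrun].
have pd : PF d := @PF_head R k.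
have pdv z : PF (fun t => d t ^ z) := PFXz z pd.
have pG : PFmap G.
  apply: PFmap_row => //; apply: PFmap_row => //.
  by apply: PFmap_mrunV => //; apply: PFmap_tail.
have /generic1_torus gA := actE u.1.
apply: generic_mono (generic_pull pF pG _ gA) => //.
  by move=> z _; rewrite uncurry_row.
have := mrunK (pdv v) (pdv w) (@PFmap_tail R k) s.
move/(pgen_and (PF_neq0 pd)); apply: pgen_mono => z [d0 h].
rewrite /F /G !(row_mxKl, row_mxKr) !mxE eqxx !mulr1n h.
have -> : mpar u (d z ^ v) (d z ^ w) = d z.
  by rewrite /mpar !exprnP !exprz_exp -expfzDr // ![_ * Posz _]mulrC vw expr1z.
rewrite -[RHS]hsubmxK; congr row_mx; apply/matrixP => a b.
by rewrite !ord1 !mxE eqxx mulr1n /d mxE.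
Qed.

Lemma mrun_generic s : (forall u, u \in s -> primitive_par u) ->
  generic2 (@torus R k) (fun c1 c2 x =>
    mrun (act chi) s c1 c2 (V x) = V (mrun e s c1 c2 x)).
Proof.
elim: s => [|u s IH] us.
  by apply: pgen_generic2; apply: pgenT.
have /IH g1 : forall u, u \in s -> primitive_par u.
  by move=> w ws; apply: us; rewrite inE ws orbT.
have := generic2_act s (us u (mem_head _ _)).
move/(generic2_and g1); apply: generic2_mono => c1 c2 x [h1 h2].
by rewrite /= h1 h2.
Qed.

Lemma mrun_relation s s' :
  (forall u, u \in s -> primitive_par u) ->
  (forall u, u \in s' -> primitive_par u) ->
  pgen2 (fun c1 c2 x => mrun e s c1 c2 x = mrun e s' c1 c2 x) ->
  generic2 X (fun c1 c2 x =>
    mrun (act chi) s c1 c2 x = mrun (act chi) s' c1 c2 x).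
Proof.
move=> us us' /pgen_generic2 h; apply/(param_generic2 _ pV).
have := generic2_and (mrun_generic us) (mrun_generic us').
move/(generic2_and h); apply: generic2_mono => c1 c2 x [h0 [h1 h2]].
by rewrite h1 h2 h0.
Qed.

(** ** Regularity at the identity *)

(** In the coordinates of the torus, the denominators of the action have
   nonnegative coefficients, so they do not vanish at (1, x) for generic x. *)
Lemma act_regular i : generic (@torus R k) (fun x => forall j,
  exists p q, [/\ represents (Gm X) p q
      (fun z => uncurry_Gm (act chi i) z 0 j),
    peval q (row_mx 1%:M (V x)) != 0 &
    V x 0 j = peval p (row_mx 1%:M (V x)) / peval q (row_mx 1%:M (V x))]).
Proof.
have [l0 l0p rVe] := ratl_param_comp pV (pe i).
have [D [gD rD]] := param_open pV.
pose good (z : 'rV[C]_(1 + k)) := peval l0 z != 0.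
pose DD (z : 'rV[C]_(1 + k)) := torus z /\ peval D (V (rsubmx z)) != 0.
have rz j : ratl DD (Gmap V) (fun z => z 0 j).
  case: (splitP j) => [i' ij|i' ij].
    have -> : j = lshift k i' by apply/val_inj.
    apply: ratl_eq (ratl_coord DD (Gmap V) (lshift m i')) => z _.
    by rewrite row_mxEl mxE.
  have -> : j = rshift 1 i' by apply/val_inj.
  have [p [q pq]] := rD i'.
  have [p' p'E] := peval_rsub p; have [q' q'E] := peval_rsub q.
  exists p', q' => z [/Gm_torus[_ tz] Dz].
  have -> : z 0 (rshift 1 i') = rsubmx z 0 i' by rewrite mxE.
  by rewrite p'E q'E /Gmap row_mxKr; apply: pq.
have gcond : generic (@torus R k) (fun x =>
    [/\ good (row_mx 1%:M x), peval D (V x) != 0 & e i 1 x = x]).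
  have h1 : pgen (fun x : 'rV[C]_k => good (row_mx 1%:M x)).
    have gg : pgen good by exists l0.
    exact: pgen_comp (PFmap_row (PF1 R k) (@PFmap_id R k)) gg.
  have := generic_and (@torus_irr R k) gD (pgen_generic (pgen_and h1 (e1 i))).
  by apply: generic_mono => // x _ [? []].
have gDD : generic (@torus R (1 + k)) DD.
  by apply: generic_mono (generic_tail gD) => // z tz Dz.
have ggood : generic (@torus R (1 + k)) good.
  by apply: pgen_generic; exists l0.
apply: generic_mono gcond => // x tx [g1 Dx ex] j.
have [P [Q PQ]] := rVe j.
have [P1 [P2 hP]] := ratl_peval P rz; have [Q1 [Q2 hQ]] := ratl_peval Q rz.
have key z : good z -> DD z -> peval (P2 * Q1) (Gmap V z) != 0 /\
    V (uncurry_Gm (e i) z) 0 j =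
    peval (P1 * Q2) (Gmap V z) / peval (P2 * Q1) (Gmap V z).
  move=> gz Dz; have [Qz ->] := PQ z gz.
  have [P2z ->] := hP z Dz; have [Q2z QE] := hQ z Dz.
  have Q1z : peval Q1 (Gmap V z) != 0.
    by move: Qz; rewrite QE mulf_eq0 negb_or => /andP[].
  by rewrite !pevalM mulf_neq0 //; split=> //; rewrite QE invf_div mulf_div.
have t1x : torus (row_mx 1%:M x : 'rV[C]_(1 + k)).
  apply/Gm_torus; split; rewrite ?row_mxKl ?row_mxKr //.
  by rewrite mxE eqxx oner_neq0.
have G1x : Gmap V (row_mx 1%:M x) = row_mx 1%:M (V x).
  by rewrite /Gmap row_mxKl row_mxKr.
have DD1 : DD (row_mx 1%:M x) by split=> //; rewrite row_mxKr.
exists (P1 * Q2), (P2 * Q1); split.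
- rewrite /represents; apply/(param_generic (param_Gm pV)).
  have /generic1_torus gA := actE i.
  have tI := @torus_irr R (1 + k).
  apply: generic_mono (generic_and tI gA (generic_and tI ggood gDD)) => // z _.
  move=> [az [gz Dz]]; have [q0 VE] := key z gz Dz; split=> //.
  by rewrite -VE -az /Gmap /uncurry_Gm row_mxKl row_mxKr.
- by have [] := key _ g1 DD1; rewrite G1x.
by have [_] := key _ g1 DD1; rewrite G1x uncurry_row ex.
Qed.

(** Two fractions that agree on a dense set agree wherever both denominators are
   nonzero; this makes the value at the identity unambiguous. *)
Lemma act_rational i : rational_action X (act chi i).
Proof.
have iG := param_irr (param_Gm pV).
split.
- split; last first.
    suff h : generic1 X (fun c x => X (act chi i c x)) by exact: h.
    apply/(param_generic1 _ pV).
    have ht : pgen1 (fun c x => torus (e i c x)).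
      exact: pgen_comp (pe i) (pgen_torus R k).
    have := generic1_and (actE i) (pgen_generic1 ht).
    by apply: generic1_mono => c x [-> /(param_in pV)].
  move=> j; apply: (param_rational (param_Gm pV)
    (rational_param_comp j pV (pe i))).
  have /generic1_torus := actE i; apply: generic_mono => // z _ az.
  by rewrite -az /Gmap /uncurry_Gm row_mxKl row_mxKr.
- pose s : seq mstep := [:: (i, (1, 0)); (i, (0, 1))]%N.
  pose s' : seq mstep := [:: (i, (1, 1))]%N.
  have us u : u \in s -> primitive_par u.
    by rewrite !inE => /orP[] /eqP->; [exists 1, 0 | exists 0, 1].
  have us' u : u \in s' -> primitive_par u.
    by rewrite !inE => /eqP->; exists 1, 0.
  have srel : pgen2 (fun c1 c2 x => mrun e s c1 c2 x = mrun e s' c1 c2 x).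
    apply: pgen_mono (eM i) => z.
    by rewrite /uncurry_Gm /= /mpar /= !expr0 !mulr1 !mul1r !expr1.
  have := mrun_relation us us' srel; apply: generic_mono => // z _.
  by rewrite /uncurry_Gm /= /mpar /= !expr0 !mulr1 !mul1r !expr1.
apply/(param_generic pV); apply: generic_mono (act_regular i) => // x tx reg v hv.
apply/rowP => j; have [p [q [rep q0 ->]]] := reg j.
have [p' [q' [rep' q0' ->]]] := hv j.
have : generic (Gm X) (fun z => peval (p * q' - p' * q) z = 0).
  apply: generic_mono (generic_and iG rep rep') => // z _ [[h1 h2] [h3 h4]].
  by rewrite !pevalS; move: h2; rewrite h4 => /eqP; rewrite eqr_div // => /eqP->;
    rewrite subrr.
move/(generic_eq0 iG)/(_ (row_mx 1%:M (V x))).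
rewrite !pevalS => e0; apply/eqP; rewrite eqr_div //.
apply/eqP/esym/subr0_eq/e0; split; rewrite ?row_mxKl ?row_mxKr.
  by rewrite mxE eqxx oner_neq0.
exact: (param_in pV).
Qed.

(** ** The crystal and its positive structure *)

Hypothesis verma_e : pverma A e.
Hypothesis gam_e : forall i j,
  pgen1 (fun c x => g j (e i c x) = c ^ A i j * g j x).
Hypothesis eps_e : forall i, pgen1 (fun c x => ep i (e i c x) = c^-1 * ep i x).
Hypothesis varX : variety X.

Let primitive_cases (i : 'I_r) a b :
  (a, b) \in [:: (1, 0); (0, 1); (1, 1); (2, 1); (3, 1); (3, 2)]%N ->
  primitive_par (i, (a, b)).
Proof.
rewrite !inE => /or4P[|||/or3P[]] /eqP[-> ->].
- by exists 1, 0.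
- by exists 0, 1.
- by exists 1, 0.
- by exists 0, 1.
- by exists 0, 1.
- by exists 1, (-1).
Qed.

Let mrun_verma s s' :
  all (fun u => u.2 \in [:: (1, 0); (0, 1); (1, 1); (2, 1); (3, 1); (3, 2)]%N)
    (s ++ s') ->
  pgen2 (fun c1 c2 x => mrun e s c1 c2 x = mrun e s' c1 c2 x) ->
  generic2 X (fun c1 c2 x =>
    mrun (act chi) s c1 c2 x = mrun (act chi) s' c1 c2 x).
Proof.
rewrite all_cat => /andP[/allP us /allP us']; apply: mrun_relation => u.
  by move/us; case: u => i [a b]; apply: primitive_cases.
by move/us'; case: u => i [a b]; apply: primitive_cases.
Qed.

Let pgen2_mono P Q : (forall c1 c2 x, P c1 c2 x -> Q c1 c2 x) ->
  @pgen2 R k P -> pgen2 Q.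
Proof. by move=> PQ; apply: pgen_mono => z; apply: PQ. Qed.

Let generic2_weaken P Q : (forall c1 c2 x, P c1 c2 x -> Q c1 c2 x) ->
  generic2 X P -> generic2 X Q.
Proof. by move=> PQ; apply: generic_weaken => z; apply: PQ. Qed.

Ltac by_runs h s s' :=
  let expand := (move=> c1 c2 x;
    rewrite /= /mpar /= !expr0 !mulr1 !mul1r !expr1; by []) in
  refine (generic2_weaken _ (@mrun_verma s s' isT (pgen2_mono _ h))); expand.

(** The parameters of all the Verma relations have primitive exponents. *)
Lemma verma_act : verma A X (act chi).
Proof.
move=> i j; have [h0 h1 h2 h3] := verma_e i j; split=> a1 a2.
- by_runs (h0 a1 a2) ([:: (i, (1, 0)); (j, (0, 1))]%N)
    ([:: (j, (0, 1)); (i, (1, 0))]%N).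
- by_runs (h1 a1 a2) ([:: (i, (1, 0)); (j, (1, 1)); (i, (0, 1))]%N)
    ([:: (j, (0, 1)); (i, (1, 1)); (j, (1, 0))]%N).
- by_runs (h2 a1 a2) ([:: (i, (1, 0)); (j, (2, 1)); (i, (1, 1)); (j, (0, 1))]%N)
    ([:: (j, (0, 1)); (i, (1, 1)); (j, (2, 1)); (i, (1, 0))]%N).
by_runs (h3 a1 a2) ([:: (i, (1, 0)); (j, (3, 1)); (i, (2, 1));
    (j, (3, 2)); (i, (1, 1)); (j, (0, 1))]%N)
    ([:: (j, (0, 1)); (i, (1, 1)); (j, (3, 2));
    (i, (2, 1)); (j, (3, 1)); (i, (1, 0))]%N).
Qed.

Theorem param_crystal : geometric_crystal A X chi.
Proof.
have iX := param_irr pV; split=> //.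
- split; [|split] => i; last exact: act_rational.
    exact: (param_rational pV (PF_rational (pg i)) (gamE i)).
  exact: (param_rational pV (PF_rational (pep i)) (epsE i)).
- move=> i; apply/(param_generic pV); apply: generic_mono (act_regular i) => //.
  move=> x tx reg; have Xx := param_in pV tx; split.
    by split; rewrite ?row_mxKl ?row_mxKr // mxE eqxx oner_neq0.
  by exists (V x) => // j; have [p [q [? ? ?]]] := reg j; exists p, q.
- move=> i j; apply/(param_generic1 _ pV).
  have := generic1_pull (pe i) (e1 i) (gamE j).
  have gj := generic1_tail (gamE j).
  move/(generic1_and gj)/(generic1_and (actE i)).
  move/(generic1_and (pgen_generic1 (gam_e i j))).
  by apply: generic1_mono => c x [h1 [-> [h2 ->]]]; rewrite h1 -h2.
split; first exact: verma_act.
move=> i; apply/(param_generic1 _ pV).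
have := generic1_pull (pe i) (e1 i) (epsE i).
have gj := generic1_tail (epsE i).
move/(generic1_and gj)/(generic1_and (actE i)).
move/(generic1_and (pgen_generic1 (eps_e i))).
by apply: generic1_mono => c x [h1 [-> [h2 ->]]]; rewrite h1 -h2.
Qed.

Theorem param_positive_structure : positive_structure X chi V.
Proof.
have [theta bt] := param_birational pV.
exists theta => // i; split.
- exact: PF_positive (pg i) (gamE i).
- exact: PF_positive (pep i) (epsE i).
move=> u; apply: (PF_positive (PF_character u (pe i))).
have [_ _ gt _] := bt; have /generic1_torus h := generic1_pull (pe i) (e1 i) gt.
have /generic1_torus h' := actE i.
apply: generic_mono (generic_and (@torus_irr R (1 + k)) h h') => // z _ [h1 h2].
by congr character; rewrite -[RHS]h1; rewrite /uncurry_Gm; congr theta.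
Qed.

End Crystal.

(** * The two products as parametrized varieties *)

Section Parametrizations.
Variable R : realType.
Local Notation C := R[i].

Lemma torus_nz6 (x : 'rV[C]_6) : torus x -> nz6 x.
Proof. by move=> tx k k6; apply: tx. Qed.

Lemma torus_co (x : 'rV[C]_6) k : torus x -> co x k != 0.
Proof. by move=> tx; apply: tx. Qed.

Lemma delta0_row8 : (delta_mx 0 (inord 0) : 'rV[C]_8) = row8 1 0 0 0 0 0 0 0.
Proof.
apply/rowP=> j; rewrite !mxE eqxx /= -val_eqE /= inordK //.
by case: j => -[|[|[|[|[|[|[|[|//]]]]]]]].
Qed.

Lemma delta6_row8 : (delta_mx 0 (inord 6) : 'rV[C]_8) = row8 0 0 0 0 0 0 1 0.
Proof.
apply/rowP=> j; rewrite !mxE eqxx /= -val_eqE /= inordK //.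
by case: j => -[|[|[|[|[|[|[|[|//]]]]]]]].
Qed.

Lemma V1E (x : 'rV[C]_6) : torus x -> V1 x =
  row8 (A1 x) (A2 x) (A3 x) (A0 x) (co x 0) (A3b x) (co x 0 * co x 1)
       (co x 0 ^+ 2).
Proof.
move=> tx; have n k : co x k != 0 by apply: torus_co.
rewrite /V1 -[xc x 0]/(co x 0) -[xc x 1]/(co x 1) -[xc x 2]/(co x 2).
rewrite -[xc x 3]/(co x 3) -[xc x 4]/(co x 4) -[xc x 5]/(co x 5) delta0_row8.
rewrite Y1_row8 // Y2_row8 // Y1_row8 // Y2_row8 // Y1_row8 // Y0_row8 //.
rewrite /A1 /A2 /A3 /A0 /A3b /pA /sA /qA.
move: (n 0%N) (n 1%N) (n 2%N) (n 3%N) (n 4%N) (n 5%N).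
move: (co x 0) (co x 1) (co x 2) (co x 3) (co x 4) (co x 5).
move=> x0 x1 x2 x3 x4 x5 n0 n1 n2 n3 n4 n5.
by congr row8; field; rewrite ?n0 ?n1 ?n2 ?n3 ?n4 ?n5.
Qed.

Lemma V2E (y : 'rV[C]_6) : torus y -> V2 y =
  row8 (B1 y) (B2 y) (B3 y) (B0 y) (co y 0) (B3b y) (B2b y) (B1b y).
Proof.
move=> ty; have n k : co y k != 0 by apply: torus_co.
rewrite /V2 -[xc y 0]/(co y 0) -[xc y 1]/(co y 1) -[xc y 2]/(co y 2).
rewrite -[xc y 3]/(co y 3) -[xc y 4]/(co y 4) -[xc y 5]/(co y 5) delta6_row8.
rewrite Y1_row8 // Y0_row8 // Y1_row8 // Y2_row8 // Y1_row8 // Y2_row8 //.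
rewrite /B1b /B2b /B3b /B0 /B3 /B2 /B1 /sB.
move: (n 0%N) (n 1%N) (n 2%N) (n 3%N) (n 4%N) (n 5%N).
move: (co y 0) (co y 1) (co y 2) (co y 3) (co y 4) (co y 5).
move=> x0 x1 x2 x3 x4 x5 n0 n1 n2 n3 n4 n5.
by congr row8; field; rewrite ?n0 ?n1 ?n2 ?n3 ?n4 ?n5.
Qed.

Ltac ratl_step := first
  [ exact: ratlC | exact: ratl_coord | assumption | apply: ratlD | apply: ratlN
  | apply: ratlM | apply: ratlX | apply: ratlV ].

Lemma ratl_row8 n k (D : 'rV[C]_n -> Prop) (U : 'rV[C]_n -> 'rV[C]_k)
    (a0 a1 a2 a3 a4 a5 a6 a7 : 'rV[C]_n -> C) :
  ratl D U a0 -> ratl D U a1 -> ratl D U a2 -> ratl D U a3 ->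
  ratl D U a4 -> ratl D U a5 -> ratl D U a6 -> ratl D U a7 ->
  forall j, ratl D U (fun x => row8 (a0 x) (a1 x) (a2 x) (a3 x) (a4 x) (a5 x)
    (a6 x) (a7 x) 0 j).
Proof.
move=> r0 r1 r2 r3 r4 r5 r6 r7 j.
case: j => -[|[|[|[|[|[|[|[|//]]]]]]]] lj;
  [move: r0|move: r1|move: r2|move: r3|move: r4|move: r5|move: r6|move: r7];
  by apply: ratl_eq => x _; rewrite mxE.
Qed.

Lemma ratl_vec6 n k (D : 'rV[C]_n -> Prop) (U : 'rV[C]_n -> 'rV[C]_k)
    (a0 a1 a2 a3 a4 a5 : 'rV[C]_n -> C) :
  ratl D U a0 -> ratl D U a1 -> ratl D U a2 -> ratl D U a3 ->
  ratl D U a4 -> ratl D U a5 ->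
  forall j, ratl D U (fun x =>
    vec6 (a0 x) (a1 x) (a2 x) (a3 x) (a4 x) (a5 x) 0 j).
Proof.
move=> r0 r1 r2 r3 r4 r5 j.
case: j => -[|[|[|[|[|[|//]]]]]] lj;
  [move: r0|move: r1|move: r2|move: r3|move: r4|move: r5];
  by apply: ratl_eq => x _; rewrite mxE.
Qed.

Lemma ratl_co n k (D : 'rV[C]_n -> Prop) (U : 'rV[C]_n -> 'rV[C]_k)
    (F : 'rV[C]_n -> 'rV[C]_6) :
  (forall l, (l < 6)%N -> ratl D U (fun x => co (F x) l)) ->
  forall j, ratl D U (fun x => F x 0 j).
Proof.
move=> h j; have := h j (ltn_ord j); apply: ratl_eq => x _.
by rewrite /co inord_val.
Qed.

Lemma calV1_ratl i : ratl (@torus R 6) id (fun x => V1 x 0 i).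
Proof.
have r k : ratl (@torus R 6) id (fun x => co x k) by apply: ratl_coord.
have nz k (x : 'rV[C]_6) : torus x -> co x k != 0 by move=> tx; apply: tx.
apply: ratl_eq => [x tx|]; first by rewrite V1E.
move: i; apply: ratl_row8; rewrite /A1 /A2 /A3 /A0 /A3b /pA /sA /qA;
  repeat ratl_step; move=> x tx; by rewrite ?mulf_neq0 ?expf_neq0 ?nz ?pnatr_eq0.
Qed.

Lemma calV2_ratl i : ratl (@torus R 6) id (fun x => V2 x 0 i).
Proof.
have r k : ratl (@torus R 6) id (fun x => co x k) by apply: ratl_coord.
have nz k (x : 'rV[C]_6) : torus x -> co x k != 0 by move=> tx; apply: tx.
apply: ratl_eq => [x tx|]; first by rewrite V2E.
move: i; apply: ratl_row8; rewrite /B1b /B2b /B3b /B0 /B3 /B2 /B1 /sB;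
  repeat ratl_step; move=> x tx; by rewrite ?mulf_neq0 ?expf_neq0 ?nz ?pnatr_eq0.
Qed.

(** The eight coordinates of the vector give in turn x_0, x_1, the auxiliary
   quantities [pA] and [qA], and then x_3, x_2, x_5, x_4, dividing only by
   parameters already found. *)
Lemma calV1_inverse j : ratl (@torus R 6) (@V1 R) (fun x => x 0 j).
Proof.
pose rt := ratl (@torus R 6) (@V1 R).
have nz k (x : 'rV[C]_6) : torus x -> co x k != 0 by move=> tx; apply: tx.
have W l : (l < 8)%N -> rt (fun x => nth 0 [:: A1 x; A2 x; A3 x; A0 x; co x 0;
    A3b x; co x 0 * co x 1; co x 0 ^+ 2] l).
  move=> l8; apply: ratl_eq (ratl_coord _ _ (inord l)) => x tx.
  by rewrite V1E // mxE inordK.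
have rA1 : rt (@A1 _) := W 0%N isT.
have rA2 : rt (@A2 _) := W 1%N isT.
have rA3 : rt (@A3 _) := W 2%N isT.
have rA0 : rt (@A0 _) := W 3%N isT.
have r0 : rt (fun x => co x 0) := W 4%N isT.
have rA3b : rt (@A3b _) := W 5%N isT.
have r01 : rt (fun x => co x 0 * co x 1) := W 6%N isT.
have r1 : rt (fun x => co x 1).
  apply: (@ratl_eq _ _ _ _ _ _ (fun x => co x 0 * co x 1 * (co x 0)^-1)).
    by move=> x tx; rewrite mulrAC mulfV ?mul1r ?nz.
  by apply: ratlM => //; apply: ratlV => // x tx; apply: nz.
have rp : rt (@pA _).
  apply: (@ratl_eq _ _ _ _ _ _ (fun x => A3b x * (co x 0)^-1)).
    by move=> x tx; rewrite /A3b mulrAC mulfV ?mul1r ?nz.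
  by apply: ratlM => //; apply: ratlV => // x tx; apply: nz.
have rq : rt (@qA _).
  apply: (@ratl_eq _ _ _ _ _ _
    (fun x => (A3 x - co x 1) * co x 0 * (co x 1 ^+ 2)^-1)).
    by move=> x tx; rewrite /A3; field; rewrite !nz.
  repeat ratl_step; by move=> x tx; rewrite expf_neq0 ?nz.
have r3 : rt (fun x => co x 3).
  apply: (@ratl_eq _ _ _ _ _ _
    (fun x => A0 x - co x 0 * (2%:R)^-1 - co x 1 * qA x)).
    by move=> x tx; rewrite /A0 /sA; field.
  repeat ratl_step; by move=> x tx; rewrite pnatr_eq0.
have r2 : rt (fun x => co x 2).
  apply: (@ratl_eq _ _ _ _ _ _
    (fun x => co x 1 ^+ 2 * (pA x - qA x) - 2%:R * co x 1 * co x 3)).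
    by move=> x tx; rewrite /pA; field; rewrite !nz.
  repeat ratl_step.
have r5 : rt (fun x => co x 5).
  apply: (@ratl_eq _ _ _ _ _ _ (fun x => (co x 0 * (A2 x - pA x)
    - (co x 2 * qA x - co x 3 ^+ 2) * (co x 1)^-1) * (co x 3)^-1)).
    by move=> x tx; rewrite /A2 /pA /qA; field; rewrite !nz.
  repeat ratl_step; by move=> x tx; rewrite nz.
have r4 : rt (fun x => co x 4).
  apply: (@ratl_eq _ _ _ _ _ _
    (fun x => co x 3 * (qA x - co x 5) - co x 3 ^+ 3 * (co x 2)^-1)).
    by move=> x tx; rewrite /qA; field; rewrite !nz.
  repeat ratl_step; by move=> x tx; rewrite nz.
by move: j; apply: ratl_co => -[|[|[|[|[|[|]]]]]].
Qed.

Lemma calV1_param_variety : param (@calV1 R) (@V1 R) /\ variety (@calV1 R).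
Proof.
by apply: param_variety => //; [apply: calV1_ratl | apply: calV1_inverse].
Qed.

End Parametrizations.

(** * Positivity of the explicit maps *)

Ltac pf := lazymatch goal with
  | |- PF (fun t => @GRing.add _ (@?f t) (@?g t)) =>
      apply: (@PFD _ _ f g); [pf | pf]
  | |- PF (fun t => @GRing.mul _ (@?f t) (@?g t)) =>
      apply: (@PFM _ _ f g); [pf | pf]
  | |- PF (fun t => @GRing.inv _ (@?f t)) => apply: (@PFV _ _ f); pf
  | |- PF (fun t => @GRing.exp _ (@?f t) ?k) => apply: (@PFX _ _ f k); pf
  | |- PF (fun t => @GRing.natmul _ _ _) => apply: PFC; rewrite ltr0n; reflexivity
  | |- PF (fun t => @GRing.one _) => exact: PF1
  | _ => first [ assumption
      | match goal with h : PFmap _ |- _ => exact: (h _) end ]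
  end.

Section Subtraction_free.
Variable R : realType.
Local Notation C := R[i].

Lemma PFmap_vec6 n (a0 a1 a2 a3 a4 a5 : 'rV[C]_n -> C) :
  PF a0 -> PF a1 -> PF a2 -> PF a3 -> PF a4 -> PF a5 ->
  PFmap (fun t => vec6 (a0 t) (a1 t) (a2 t) (a3 t) (a4 t) (a5 t)).
Proof.
move=> r0 r1 r2 r3 r4 r5 j.
case: j => -[|[|[|[|[|[|//]]]]]] lj;
  [move: r0|move: r1|move: r2|move: r3|move: r4|move: r5];
  by apply: PF_eq => x; rewrite mxE.
Qed.

Section Along.
Variables (n : nat) (c : 'rV[C]_n -> C) (F : 'rV[C]_n -> 'rV[C]_6).
Hypotheses (pc : PF c) (pF : PFmap F).
Lemma PF_qA : PF (fun t => qA (F t)). Proof. by rewrite /qA; pf. Qed.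
Lemma PF_sA : PF (fun t => sA (F t)).
Proof. by have := PF_qA; rewrite /sA => ?; pf. Qed.
Lemma PF_A1 : PF (fun t => A1 (F t)).
Proof. by have := PF_sA; rewrite /A1 => ?; pf. Qed.
Lemma PF_yscale : PF (fun t => yscale (F t)).
Proof. by rewrite /yscale /tA; pf. Qed.
Lemma PF_yhat1 : PF (fun t => yhat1 (F t)).
Proof. by have := PF_qA; rewrite /yhat1 /tA /bA => ?; pf. Qed.
Lemma PF_yhat2 : PF (fun t => yhat2 (F t)).
Proof. by have := PF_qA; rewrite /yhat2 /bA => ?; pf. Qed.

Lemma PFmap_yhat : PFmap (fun t => yhat (F t)).
Proof.
have := PF_A1; have := PF_yscale; have := PF_yhat1; have := PF_yhat2.
by move=> ? ? ? ?; apply: PFmap_vec6; pf.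
Qed.

Lemma PF_B1 : PF (fun t => B1 (F t)). Proof. by rewrite /B1; pf. Qed.
Lemma PF_sB : PF (fun t => sB (F t)). Proof. by rewrite /sB; pf. Qed.
Lemma PF_B2b : PF (fun t => B2b (F t)).
Proof. by rewrite /B2b /B3 /B1; pf. Qed.
Lemma PF_B1b : PF (fun t => B1b (F t)).
Proof. by rewrite /B1b /sB /B1; pf. Qed.
Lemma PF_hB : PF (fun t => hB (F t)). Proof. by rewrite /hB; pf. Qed.
Lemma PF_kB : PF (fun t => kB (F t)). Proof. by rewrite /kB; pf. Qed.

Lemma PFmap_xhat : PFmap (fun t => xhat (F t)).
Proof.
have := PF_B1b; have := PF_B2b; have := PF_hB; have := PF_kB.
by move=> ? ? ? ?; apply: PFmap_vec6; pf.
Qed.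

Lemma PFmap_e0y : PFmap (fun t => e0y (c t) (F t)).
Proof. by apply: PFmap_vec6; pf. Qed.

Lemma PFmap_e1 : PFmap (fun t => e1_formula (c t) (F t)).
Proof. by rewrite /e1_formula /=; apply: PFmap_vec6; pf. Qed.

Lemma PFmap_e2 : PFmap (fun t => e2_formula (c t) (F t)).
Proof. by rewrite /e2_formula /=; apply: PFmap_vec6; pf. Qed.

Lemma PF_polyD : PF (fun t => polyD (c t) (F t)).
Proof. by rewrite /polyD /=; pf. Qed.
Lemma PF_polyE : PF (fun t => polyE (F t)).
Proof. by rewrite /polyE /=; pf. Qed.
Lemma PF_polyF : PF (fun t => polyF (c t) (F t)).
Proof. by rewrite /polyF /=; pf. Qed.
Lemma PF_polyH : PF (fun t => polyH (c t) (F t)).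
Proof. by rewrite /polyH /=; pf. Qed.
Lemma PF_polyG : PF (fun t => polyG (c t) (F t)).
Proof. by rewrite /polyG /=; pf. Qed.

Lemma PFmap_e0 : PFmap (fun t => e0_formula (c t) (F t)).
Proof.
have := PF_polyD; have := PF_polyE; have := PF_polyF; have := PF_polyG.
have := PF_polyH => ? ? ? ? ?.
by rewrite /e0_formula /=; apply: PFmap_vec6; pf.
Qed.

Lemma PF_gam0 : PF (fun t => gam0_formula (F t)).
Proof. by rewrite /gam0_formula; pf. Qed.
Lemma PF_gam1 : PF (fun t => gam1_formula (F t)).
Proof. by rewrite /gam1_formula /=; pf. Qed.
Lemma PF_gam2 : PF (fun t => gam2_formula (F t)).
Proof. by rewrite /gam2_formula /=; pf. Qed.
Lemma PF_eps0 : PF (fun t => eps0_formula (F t)).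
Proof. by have := PF_polyE; rewrite /eps0_formula /= => ?; pf. Qed.
Lemma PF_eps1 : PF (fun t => eps1_formula (F t)).
Proof. by rewrite /eps1_formula /=; pf. Qed.
Lemma PF_eps2 : PF (fun t => eps2_formula (F t)).
Proof. by rewrite /eps2_formula /=; pf. Qed.

End Along.

Lemma gt1_pos6 (x : 'rV[C]_6) : gt1 x -> pos6 x.
Proof. by move=> x1 k k6; apply: lt_trans (x1 _). Qed.

Lemma PF_eq_pos6 (f g : 'rV[C]_6 -> C) : PF f -> PF g ->
  (forall x, pos6 x -> f x = g x) -> pgen (fun x => f x = g x).
Proof. by move=> pf pg fg; apply: PF_eq_gt1 => // x /gt1_pos6 /fg. Qed.

Lemma PFmap_eq_pos6 (f g : 'rV[C]_6 -> 'rV[C]_6) : PFmap f -> PFmap g ->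
  (forall x, pos6 x -> f x = g x) -> pgen (fun x => f x = g x).
Proof. by move=> pf pg fg; apply: PFmap_eq_gt1 => // x /gt1_pos6 /fg. Qed.

Lemma PFmap_id6 : PFmap (fun x : 'rV[C]_6 => x).
Proof. exact: PFmap_id. Qed.

Lemma xhat_yhat : pgen (fun x : 'rV[C]_6 => xhat (yhat x) = x).
Proof.
apply: PFmap_eq_pos6; [|exact: PFmap_id6|exact: xhatK].
exact: PFmap_xhat (PFmap_yhat PFmap_id6).
Qed.

Lemma yhat_xhat : pgen (fun y : 'rV[C]_6 => yhat (xhat y) = y).
Proof.
apply: PFmap_eq_pos6; [|exact: PFmap_id6|exact: yhatK].
exact: PFmap_yhat (PFmap_xhat PFmap_id6).
Qed.

(** ** The second product as a parametrization *)

Ltac ratl_tac := lazymatch goal with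
  | |- ratl _ _ (fun t => @GRing.add _ (@?f t) (@?g t)) =>
      apply: (@ratlD _ _ _ _ _ f g); [ratl_tac | ratl_tac]
  | |- ratl _ _ (fun t => @GRing.mul _ (@?f t) (@?g t)) =>
      apply: (@ratlM _ _ _ _ _ f g); [ratl_tac | ratl_tac]
  | |- ratl _ _ (fun t => @GRing.inv _ (@?f t)) =>
      apply: (@ratlV _ _ _ _ _ f); [idtac | ratl_tac]
  | |- ratl _ _ (fun t => @GRing.opp _ (@?f t)) =>
      apply: (@ratlN _ _ _ _ _ f); ratl_tac
  | |- ratl _ _ (fun t => @GRing.exp _ (@?f t) ?k) =>
      apply: (@ratlX _ _ _ _ _ k f); ratl_tac
  | _ => first [assumption | exact: ratlC]
  end.

Lemma param_of_ratl k m (X : 'rV[C]_m -> Prop) (V : 'rV[C]_k -> 'rV[C]_m)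
    (D : 'rV[C]_k -> Prop) :
  (forall w, X w <-> exists2 x, torus x & w = V x) ->
  (forall i, ratl (@torus R k) id (fun x => V x 0 i)) ->
  pgen D -> (forall j, ratl D V (fun x => x 0 j)) -> param X V.
Proof.
move=> XV rV gD rD; split=> // j; have [p [q pq]] := rD j.
exists p, q; split.
  exists (const_mx 2); first exact/gt1_torus/gt1_const.
  by have [] := pq _ (pgen_gt1 gD (@gt1_const R k)).
apply: ratl_torus_eq; first exact: ratl_peval.
  by apply: ratlM; [exact: ratl_coord | apply: ratl_peval].
apply: pgen_generic; apply: pgen_mono gD => x Dx.
by have [q0 ->] := pq x Dx; rewrite divfK.
Qed.

(** The nonvanishing conditions are those of the denominators of [yhat]. *)
Lemma yhat_ratl n k (D : 'rV[C]_n -> Prop) (U : 'rV[C]_n -> 'rV[C]_k)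
    (F : 'rV[C]_n -> 'rV[C]_6) :
  (forall z, D z -> [/\ torus (F z), A1 (F z) != 0, yhat1 (F z) != 0
    & yhat2 (F z) != 0]) ->
  (forall l, (l < 6)%N -> ratl D U (fun z => co (F z) l)) ->
  forall j, ratl D U (fun z => yhat (F z) 0 j).
Proof.
move=> DF rF.
have nz l z : D z -> co (F z) l != 0 by move=> /DF[tF _ _ _]; apply: tF.
have nA z : D z -> A1 (F z) != 0 by case/DF.
have n1 z : D z -> yhat1 (F z) != 0 by case/DF.
have n2 z : D z -> yhat2 (F z) != 0 by case/DF.
have r0 : ratl D U (fun z => co (F z) 0) by apply: rF.
have r1 : ratl D U (fun z => co (F z) 1) by apply: rF.
have r2 : ratl D U (fun z => co (F z) 2) by apply: rF.
have r3 : ratl D U (fun z => co (F z) 3) by apply: rF.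
have r4 : ratl D U (fun z => co (F z) 4) by apply: rF.
have r5 : ratl D U (fun z => co (F z) 5) by apply: rF.
have rq : ratl D U (fun z => qA (F z)).
  by rewrite /qA; ratl_tac; move=> z Dz; rewrite ?nz.
have rA : ratl D U (fun z => A1 (F z)).
  rewrite /A1 /sA; ratl_tac; move=> z Dz;
  by rewrite ?mulf_neq0 ?expf_neq0 ?nz.
have ra : ratl D U (fun z => yscale (F z)).
  rewrite /yscale /tA; ratl_tac; move=> z Dz;
  by rewrite ?mulf_neq0 ?expf_neq0 ?nz.
have s1 : ratl D U (fun z => yhat1 (F z)).
  rewrite /yhat1 /tA /bA; ratl_tac; move=> z Dz;
  by rewrite ?mulf_neq0 ?expf_neq0 ?nz.
have s2 : ratl D U (fun z => yhat2 (F z)).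
  rewrite /yhat2 /bA; ratl_tac; move=> z Dz;
  by rewrite ?mulf_neq0 ?expf_neq0 ?nz.
apply: ratl_vec6; by ratl_tac.
Qed.

(** The inverse is found through the first product: the identities for [sB],
   [hB], y_1 y_3 y_5, [kB] and y_2 y_4 express them in turn by the coordinates
   of the vector, hence also [xhat y], and y is [yhat (xhat y)]. *)
Lemma calV2_param : param (@calV2 R) (@V2 R).
Proof.
pose g3 (y : 'rV[C]_6) := hB y ^+ 3 + co y 2 * co y 4 * B2b y ^+ 3.
pose D y := [/\ torus y, B1b y != 0, B2b y != 0 & hB y != 0] /\
  [/\ kB y != 0, g3 y != 0 & yhat (xhat y) = y] /\
  [/\ torus (xhat y), A1 (xhat y) != 0, yhat1 (xhat y) != 0
    & yhat2 (xhat y) != 0].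
have i6 := PFmap_id6; have px := PFmap_xhat i6.
have pg3 : PF g3.
  have := PF_hB i6; have := PF_B2b i6 => pb ph.
  by rewrite /g3; pf.
have gD : pgen D.
  have h1 := pgen_and (pgen_torus R 6) (PF_neq0 (PF_B1b i6)).
  have h2 := pgen_and (PF_neq0 (PF_B2b i6)) (PF_neq0 (PF_hB i6)).
  have h3 := pgen_and (PF_neq0 (PF_kB i6)) (PF_neq0 pg3).
  have h4 := pgen_and yhat_xhat (pgen_comp px (pgen_torus R 6)).
  have h5 := pgen_and (PF_neq0 (PF_A1 px)) (PF_neq0 (PF_yhat1 px)).
  have h6 := pgen_and h5 (PF_neq0 (PF_yhat2 px)).
  have := pgen_and (pgen_and h1 h2) (pgen_and (pgen_and h3 h4) h6).
  by apply: pgen_mono => y [[[? ?] [? ?]] [[[? ?] [? ?]] [[? ?] ?]]].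
apply: (param_of_ratl _ (@calV2_ratl R) gD) => //.
pose rt := ratl D (@V2 R).
have VD y : D y -> torus y by case=> [[]].
have W l : (l < 8)%N -> rt (fun y => nth 0 [:: B1 y; B2 y; B3 y; B0 y; co y 0;
    B3b y; B2b y; B1b y] l).
  move=> l8; apply: ratl_eq (ratl_coord _ _ (inord l)) => y /VD ty.
  by rewrite V2E // mxE inordK.
have rv1 : rt (@B1 _) := W 0%N isT.
have rv3 : rt (@B3 _) := W 2%N isT.
have rv0 : rt (@B0 _) := W 3%N isT.
have re : rt (fun y => co y 0) := W 4%N isT.
have rw3 : rt (@B3b _) := W 5%N isT.
have rw2 : rt (@B2b _) := W 6%N isT.
have rw1 : rt (@B1b _) := W 7%N isT.
have n0 y : D y -> co y 0 != 0 by move/VD => ty; apply: ty.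
have nw1 y : D y -> B1b y != 0 by case=> [[]].
have nw2 y : D y -> B2b y != 0 by case=> [[]].
have nh y : D y -> hB y != 0 by case=> [[]].
have nk y : D y -> kB y != 0 by case=> [_ [[]]].
have n3 y : D y -> g3 y != 0 by case=> [_ [[]]].
have rS : rt (@sB _).
  apply: (@ratl_eq _ _ _ _ _ _ (fun y => B0 y - co y 0 * (2%:R)^-1)).
    by move=> y _; rewrite /B0; field.
  by rewrite /rt; ratl_tac; move=> y _; rewrite pnatr_eq0.
have rh : rt (@hB _).
  apply: (@ratl_eq _ _ _ _ _ _ (fun y => (sB y + co y 0) * B2b y - B3 y * B1b y)).
    by move=> y /VD/torus_nz6/hBE.
  by rewrite /rt; ratl_tac.
pose M (y : 'rV[C]_6) := co y 1 * co y 3 * co y 5.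
have rM : rt M.
  apply: (@ratl_eq _ _ _ _ _ _ (fun y => B1b y * B1 y - co y 0 ^+ 2 - co y 0 * sB y)).
    by move=> y /VD/torus_nz6/B1E <-; rewrite /M; ring.
  by rewrite /rt; ratl_tac.
have rk : rt (@kB _).
  apply: (@ratl_eq _ _ _ _ _ _ (fun y =>
    (hB y * (sB y * B2b y - hB y) - M y * B2b y ^+ 2) * (B1b y)^-1)).
    move=> y Dy; have /torus_nz6/kBE -> := VD y Dy.
    by rewrite /M addrAC subrr add0r mulfK ?nw1.
  by rewrite /rt; ratl_tac.
pose ka (y : 'rV[C]_6) := co y 2 * co y 4.
have rka : rt ka.
  apply: (@ratl_eq _ _ _ _ _ _ (fun y => (kB y * B3b y - hB y * sB y ^+ 2
    + M y * B2b y * sB y + M y * hB y) * (B2b y)^-1)).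
    move=> y Dy; have /torus_nz6/kB_B3b -> := VD y Dy.
    by rewrite /ka /M; field; rewrite nw2.
  by rewrite /rt; ratl_tac.
have rg3 : rt g3 := ratlD (ratlX 3 rh) (ratlM rka (ratlX 3 rw2)).
have rx l : (l < 6)%N -> rt (fun y => co (xhat y) l).
  move=> l6; have : rt (fun y => vec6 (B1b y / co y 0) (B2b y / co y 0)
      (g3 y / (co y 0 ^+ 3 * kB y)) (B1b y * hB y / (co y 0 ^+ 2 * B2b y))
      (B1b y ^+ 3 * ka y / (co y 0 ^+ 3 * (g3 y / kB y)))
      (M y * B1b y / (co y 0 * hB y)) 0 (inord l)).
    rewrite /rt; apply: ratl_vec6; ratl_tac;
    by move=> y Dy; rewrite ?mulf_neq0 ?expf_neq0 ?invr_neq0 ?n0 ?nw1 ?nw2 ?nh ?nk ?n3.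
  by [].
move=> j; apply: (@ratl_eq _ _ _ _ _ _ (fun y => yhat (xhat y) 0 j)).
  by move=> y [_ [[_ _ ->]]].
by apply: yhat_ratl => // z [_ []].
Qed.

End Subtraction_free.

(** * The explicit formulas at positive points *)

Section Formulas.
Variable R : realType.
Local Notation C := R[i].
Implicit Types (x : 'rV[C]_6) (c : C).

Lemma row6E (a0 a1 a2 a3 a4 a5 : C) :
  row6 a0 a1 a2 a3 a4 a5 = vec6 a0 a1 a2 a3 a4 a5.
Proof. by []. Qed.

Section Positive.
Variable x : 'rV[C]_6.
Hypothesis px : pos6 x.
Let p0 : 0 < co x 0 := @px 0%N isT.
Let p1 : 0 < co x 1 := @px 1%N isT.
Let p2 : 0 < co x 2 := @px 2%N isT.
Let p3 : 0 < co x 3 := @px 3%N isT.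
Let p4 : 0 < co x 4 := @px 4%N isT.
Let p5 : 0 < co x 5 := @px 5%N isT.

Ltac coords := rewrite -?[xc x 0]/(co x 0) -?[xc x 1]/(co x 1)
  -?[xc x 2]/(co x 2) -?[xc x 3]/(co x 3) -?[xc x 4]/(co x 4)
  -?[xc x 5]/(co x 5).

Ltac gen := move: p0 p1 p2 p3 p4 p5;
  move: (co x 0) (co x 1) (co x 2) (co x 3) (co x 4) (co x 5);
  move=> x0 x1 x2 x3 x4 x5 q0 q1 q2 q3 q4 q5.

Lemma e1_formulaE c : 1 < c -> e1_formula c x = e1x c x.
Proof.
rewrite -subr_gt0 => c0; have -> : c = 1 + (c - 1) by rewrite addrC subrK.
move: (c - 1) c0 => {}c c0; rewrite /e1_formula /e1x /unip1x /ep1 /=; coords.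
have -> : 1 + c - 1 = c by ring.
gen; rewrite row6E; congr vec6; field; neq0.
Qed.

Lemma e2_formulaE c : 0 < c -> e2_formula c x = e2x c x.
Proof.
move=> c0; rewrite /e2_formula /e2x /=; coords.
gen; rewrite row6E; congr vec6; field; neq0.
Qed.

Lemma polyDE c : polyD c x = co x 2 * co x 3 * dP c x.
Proof. by rewrite /polyD /dP /sA /qA /=; coords; gen; field; neq0. Qed.

Lemma polyEE : polyE x = co x 2 * co x 3 * dP 1 x.
Proof. by rewrite /polyE /dP /sA /qA /=; coords; gen; field; neq0. Qed.

Lemma polyFE c : polyF c x = co x 2 * co x 3 * fP c x.
Proof. by rewrite /polyF /fP /sA /qA /=; coords; gen; field; neq0. Qed.

Lemma polyHE c : polyH c x = co x 2 * co x 3 * hP c x.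
Proof. by rewrite /polyH /hP /sA /qA /=; coords; gen; field; neq0. Qed.

(** The cubes are those of the third coordinate of [xhat], where [hB] and [B2b]
   become proportional to H and F; the division by x_2 x_4 + x_3^3 is exact. *)
Lemma polyG_cubes c :
  polyG c x * (co x 2 * co x 4 + co x 3 ^+ 3) =
  polyF c x ^+ 3 * (co x 2 * co x 4) + polyH c x ^+ 3 * co x 3 ^+ 3.
Proof. by rewrite /polyG /polyF /polyH /=; coords; gen; ring. Qed.

Lemma e0_formulaE c : 0 < c -> e0_formula c x = e0x c x.
Proof.
move=> c0; have d0 := dP_gt0 px c0; have f0 := fP_gt0 px c0.
have h0 := hP_gt0 px c0; have d1 := dP_gt0 px ltr01.
have gE : polyG c x = (co x 2 * co x 3) ^+ 3 * (hP c x ^+ 3 * co x 3 ^+ 3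
    + fP c x ^+ 3 * (co x 2 * co x 4)) / (co x 3 ^+ 3 + co x 2 * co x 4).
  have n0 : co x 2 * co x 4 + co x 3 ^+ 3 != 0 by neq0.
  rewrite [co x 3 ^+ 3 + co x 2 * _]addrC; apply: (mulIf n0).
  by rewrite divfK // polyG_cubes polyFE polyHE; ring.
rewrite e0xE // /e0_formula /= gE polyDE polyEE polyFE polyHE row6E /e0x2; coords.
by congr vec6; field; neq0.
Qed.

Lemma e0_formula1 : e0_formula 1 x = x.
Proof. by rewrite e0_formulaE // e0x1. Qed.

Lemma e1_formula1 : e1_formula 1 x = x.
Proof.
rewrite [RHS]vec6_co /e1_formula /= row6E; coords; gen.
by congr vec6; field; neq0.
Qed.

Lemma e2_formula1 : e2_formula 1 x = x.
Proof. by rewrite e2_formulaE // e2x1. Qed.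

Lemma gam0_formulaE : gam0_formula x = ga0 x.
Proof. by []. Qed.

Lemma gam1_formulaE : gam1_formula x = ga1 x.
Proof. by rewrite /gam1_formula /ga1 /=; coords; gen; field; neq0. Qed.

Lemma gam2_formulaE : gam2_formula x = ga2 x.
Proof. by rewrite /gam2_formula /ga2 /=; coords; gen; field; neq0. Qed.

Lemma eps0_formulaE : eps0_formula x = ep0 x.
Proof.
rewrite /eps0_formula polyEE /ep0 /dP /A1 /sA /qA; coords; gen; field; neq0.
Qed.

Lemma eps1_formulaE : eps1_formula x = ep1 x.
Proof. by []. Qed.

Lemma eps2_formulaE : eps2_formula x = ep2 x.
Proof. by []. Qed.

End Positive.
End Formulas.

(** * The natural structures *)

Section Natural.
Variable R : realType.
Local Notation C := R[i].
Implicit Types (x : 'rV[C]_6) (c : C).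

Lemma big_inord6 (T : Type) (idx : T) (op : T -> T -> T) (P : pred 'I_6)
    (F : 'I_6 -> T) :
  \big[op/idx]_(m < 6 | P m) F m =
  \big[op/idx]_(k <- [:: 0; 1; 2; 3; 4; 5]%N | P (inord k)) F (inord k).
Proof.
have -> : index_enum 'I_6 = [seq inord k | k <- [:: 0; 1; 2; 3; 4; 5]%N].
  apply: (inj_map val_inj); rewrite -map_comp /index_enum -enumT val_enum_ord.
  by rewrite /= !inordK.
by rewrite big_map.
Qed.

Lemma I3_cases (i : 'I_3) : [\/ i = i0, i = i1 | i = i2].
Proof.
case: i => -[|[|[|//]]] i3; [apply: Or31|apply: Or32|apply: Or33];
  by apply/val_inj; rewrite /= inordK.
Qed.

Lemma letterE : [/\ letter (inord 0) = i0, letter (inord 1) = i1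
    & letter (inord 2) = i2] /\ [/\ letter (inord 3) = i1,
    letter (inord 4) = i2 & letter (inord 5) = i1].
Proof. by rewrite /letter !inordK. Qed.

Lemma cartanE : [/\ cartan i0 i0 = 2, cartan i0 i1 = -1 & cartan i0 i2 = 0] /\
  [/\ cartan i1 i0 = -1, cartan i1 i1 = 2 & cartan i1 i2 = -3] /\
  [/\ cartan i2 i0 = 0, cartan i2 i1 = -1 & cartan i2 i2 = 2].
Proof. by do 3?[split]; rewrite mxE /i0 /i1 /i2 !inordK. Qed.

Lemma exp_cartan (t : C) :
  [/\ t ^ cartan i0 i0 = t ^+ 2, t ^ cartan i0 i1 = t^-1
    & t ^ cartan i0 i2 = 1] /\
  [/\ t ^ cartan i1 i0 = t^-1, t ^ cartan i1 i1 = t ^+ 2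
    & t ^ cartan i1 i2 = t ^- 3] /\
  [/\ t ^ cartan i2 i0 = 1, t ^ cartan i2 i1 = t^-1
    & t ^ cartan i2 i2 = t ^+ 2].
Proof.
by have [[-> -> ->] [[-> -> ->] [-> -> ->]]] := cartanE; do 3?[split].
Qed.

Lemma i_neq : [/\ (i0 == i1) = false, (i0 == i2) = false & (i1 == i2) = false]
  /\ [/\ (i1 == i0) = false, (i2 == i0) = false & (i2 == i1) = false].
Proof. by do 2?[split]; rewrite -val_eqE /i0 /i1 /i2 /= !inordK. Qed.

Definition exp_cartanE (t : C) :=
  let: conj (And3 a b c) (conj (And3 d e f) (And3 g h i)) := exp_cartan t in
  (a, b, c, d, e, f, g, h, i).

Definition letterS :=
  let: conj (And3 a b c) (And3 d e f) := letterE in (a, b, c, d, e, f).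

Definition i_neqS :=
  let: conj (And3 a b c) (And3 d e f) := i_neq in (a, b, c, d, e, f).

Lemma xcE x k : x 0 (inord k) = xc x k. Proof. by []. Qed.

Ltac expand := rewrite !big_inord6 !big_cons !big_nil /pos1 /pos2 /= ?inordK //=
  ?letterS ?i_neqS ?eqxx /= ?exp_cartanE ?xcE.

Ltac gen6 x px :=
  move: (px 0%N isT : 0 < xc x 0) (px 1%N isT : 0 < xc x 1)
    (px 2%N isT : 0 < xc x 2) (px 3%N isT : 0 < xc x 3)
    (px 4%N isT : 0 < xc x 4) (px 5%N isT : 0 < xc x 5);
  move: (xc x 0) (xc x 1) (xc x 2) (xc x 3) (xc x 4) (xc x 5);
  move=> x0 x1 x2 x3 x4 x5 q0 q1 q2 q3 q4 q5.

Lemma nat_gamE x : torus x -> [/\ nat_gam i0 x = gam0_formula x,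
  nat_gam i1 x = gam1_formula x & nat_gam i2 x = gam2_formula x].
Proof.
move=> tx; have n k : xc x k != 0 by apply: tx.
rewrite /nat_gam /gam0_formula /gam1_formula /gam2_formula /=.
by split; expand; field; rewrite ?n.
Qed.

Section Terms.
Variable x : 'rV[C]_6.

(** The t_m are kept in the shape in which the products over the letters unfold,
   so that the expansions below hold at every point, positive or not. *)
Definition t1_1 := ((xc x 0)^-1 * 1 * xc x 1)^-1.
Definition t1_3 :=
  ((xc x 0)^-1 * (xc x 1 ^+ 2 * ((xc x 2)^-1 * 1)) * xc x 3)^-1.
Definition t1_5 := ((xc x 0)^-1 * (xc x 1 ^+ 2 * ((xc x 2)^-1 *
  (xc x 3 ^+ 2 * ((xc x 4)^-1 * 1)))) * xc x 5)^-1.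
Definition t2_2 := (1 * (xc x 1 ^- 3 * 1) * xc x 2)^-1.
Definition t2_4 := (1 * (xc x 1 ^- 3 * (xc x 2 ^+ 2 * (xc x 3 ^- 3 * 1)))
  * xc x 4)^-1.

Lemma nat_t1E : [/\ nat_t pos1 i1 x (inord 1) = t1_1,
  nat_t pos1 i1 x (inord 3) = t1_3 & nat_t pos1 i1 x (inord 5) = t1_5].
Proof. by split; rewrite /nat_t; expand. Qed.

Lemma nat_t2E : [/\ nat_t pos1 i2 x (inord 2) = t2_2
  & nat_t pos1 i2 x (inord 4) = t2_4].
Proof. by split; rewrite /nat_t; expand. Qed.

Lemma nat_t0E : nat_t pos2 i0 x (inord 0) = xc x 1 * xc x 3 / xc x 0.
Proof.
rewrite /nat_t; expand; rewrite ?mul1r ?mulr1 !invfM !invrK.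
by rewrite ?mulrA.
Qed.

Lemma nat_epsE : [/\ nat_eps pos1 i1 x = t1_1 + (t1_3 + t1_5),
  nat_eps pos1 i2 x = t2_2 + t2_4 &
  nat_eps pos2 i0 x = xc x 1 * xc x 3 / xc x 0].
Proof.
rewrite /nat_eps; have [e1 e3 e5] := nat_t1E; have [e2 e4] := nat_t2E.
split; rewrite big_inord6 !big_cons big_nil ?letterS ?i_neqS ?eqxx addr0.
- by rewrite e1 e3 e5.
- by rewrite e2 e4.
by rewrite nat_t0E.
Qed.

Ltac sums := rewrite /co mxE !big_inord6 !big_cons !big_nil ?letterS ?i_neqS
  ?eqxx /= /pos1 /pos2 !inordK //= ?addr0 ?add0r.

Lemma nat_act1E c : nat_act pos1 i1 c x =
  let s := t1_1 + (t1_3 + t1_5) in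
  let s1 := c * t1_1 + (t1_3 + t1_5) in
  let s3 := c * t1_1 + c * t1_3 + t1_5 in
  let s5 := c * t1_1 + (c * t1_3 + c * t1_5) in
  vec6 (xc x 0 * (s / s)) (xc x 1 * (s1 / s)) (xc x 2 * (s1 / s1))
    (xc x 3 * (s3 / s1)) (xc x 4 * (s3 / s3)) (xc x 5 * (s5 / s3)).
Proof.
have [e1 e3 e5] := nat_t1E.
by rewrite [LHS]vec6_co /=; congr vec6; sums; rewrite ?e1 ?e3 ?e5.
Qed.

Lemma nat_act2E c : nat_act pos1 i2 c x =
  let s := t2_2 + t2_4 in
  let s2 := c * t2_2 + t2_4 in
  let s4 := c * t2_2 + c * t2_4 in
  vec6 (xc x 0 * (s / s)) (xc x 1 * (s / s)) (xc x 2 * (s2 / s))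
    (xc x 3 * (s2 / s2)) (xc x 4 * (s4 / s2)) (xc x 5 * (s4 / s4)).
Proof.
have [e2 e4] := nat_t2E.
by rewrite [LHS]vec6_co /=; congr vec6; sums; rewrite ?e2 ?e4.
Qed.

Lemma nat_act0E c : nat_act pos2 i0 c x =
  let t := xc x 1 * xc x 3 / xc x 0 in
  vec6 (xc x 0 * (c * t / t)) (xc x 1 * (t / t)) (xc x 2 * (t / t))
    (xc x 3 * (t / t)) (xc x 4 * (t / t)) (xc x 5 * (c * t / (c * t))).
Proof.
by rewrite [LHS]vec6_co /=; congr vec6; sums; rewrite ?nat_t0E.
Qed.

End Terms.

Lemma nat_act1_pos x c : pos6 x -> 0 < c -> nat_act pos1 i1 c x = e1_formula c x.
Proof.
move=> px c0; rewrite nat_act1E /e1_formula /t1_1 /t1_3 /t1_5 /= row6E.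
gen6 x px; congr vec6; field; neq0.
Qed.

Lemma nat_act2_pos x c : pos6 x -> 0 < c -> nat_act pos1 i2 c x = e2_formula c x.
Proof.
move=> px c0; rewrite nat_act2E /e2_formula /t2_2 /t2_4 /= row6E.
gen6 x px; congr vec6; field; neq0.
Qed.

Lemma nat_act0_pos x c : pos6 x -> 0 < c -> nat_act pos2 i0 c x = e0y c x.
Proof.
move=> px c0; rewrite nat_act0E /e0y /= -![co x _]/(xc x _).
gen6 x px; congr vec6; field; neq0.
Qed.

Lemma nat_eps_pos x : pos6 x -> [/\ nat_eps pos1 i1 x = eps1_formula x,
  nat_eps pos1 i2 x = eps2_formula x & nat_eps pos2 i0 x = B1 x / co x 0].
Proof.
move=> px; have [-> -> ->] := nat_epsE x.
rewrite /t1_1 /t1_3 /t1_5 /t2_2 /t2_4 /eps1_formula /eps2_formula /=.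
by split=> //; gen6 x px; field; neq0.
Qed.

End Natural.

(** * The relations of the crystal as identities of maps *)

Section Main.
Variable R : realType.
Local Notation C := R[i].

Definition efun (i : 'I_3) : C -> 'rV[C]_6 -> 'rV[C]_6 :=
  match val i with
  | 0%N => @e0_formula R | 1%N => @e1_formula R | _ => @e2_formula R
  end.
Definition gamfun (i : 'I_3) : 'rV[C]_6 -> C :=
  match val i with
  | 0%N => @gam0_formula R | 1%N => @gam1_formula R | _ => @gam2_formula R
  end.
Definition epsfun (i : 'I_3) : 'rV[C]_6 -> C :=
  match val i with
  | 0%N => @eps0_formula R | 1%N => @eps1_formula R | _ => @eps2_formula R
  end.

Lemma efunE : [/\ efun i0 = @e0_formula R, efun i1 = @e1_formula R
  & efun i2 = @e2_formula R].
Proof. by rewrite /efun /i0 /i1 /i2 /= !inordK. Qed.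

Lemma gamfunE : [/\ gamfun i0 = @gam0_formula R, gamfun i1 = @gam1_formula R
  & gamfun i2 = @gam2_formula R].
Proof. by rewrite /gamfun /i0 /i1 /i2 /= !inordK. Qed.

Lemma epsfunE : [/\ epsfun i0 = @eps0_formula R, epsfun i1 = @eps1_formula R
  & epsfun i2 = @eps2_formula R].
Proof. by rewrite /epsfun /i0 /i1 /i2 /= !inordK. Qed.

Lemma PFmap_efun i : PFmap (uncurry_Gm (efun i)).
Proof.
have [e0 e1 e2] := efunE; have h := @PF_head R 6; have t := @PFmap_tail R 6.
by case: (I3_cases i) => ->; rewrite ?e0 ?e1 ?e2;
  [apply: PFmap_e0 | apply: PFmap_e1 | apply: PFmap_e2].
Qed.

Lemma PF_gamfun n i (F : 'rV[C]_n -> 'rV[C]_6) :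
  PFmap F -> PF (fun t => gamfun i (F t)).
Proof.
move=> pF; have [e0 e1 e2] := gamfunE.
by case: (I3_cases i) => ->; rewrite ?e0 ?e1 ?e2;
  [apply: PF_gam0 | apply: PF_gam1 | apply: PF_gam2].
Qed.

Lemma PF_epsfun n i (F : 'rV[C]_n -> 'rV[C]_6) :
  PFmap F -> PF (fun t => epsfun i (F t)).
Proof.
move=> pF; have [e0 e1 e2] := epsfunE.
by case: (I3_cases i) => ->; rewrite ?e0 ?e1 ?e2;
  [apply: PF_eps0 | apply: PF_eps1 | apply: PF_eps2].
Qed.

Lemma efun_pos i c (x : 'rV[C]_6) : pos6 x -> 1 < c -> pos6 (efun i c x).
Proof.
move=> px c1; have c0 := lt_trans ltr01 c1; have [e0 e1 e2] := efunE.
case: (I3_cases i) => ->; rewrite ?e0 ?e1 ?e2.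
- by rewrite e0_formulaE //; apply: e0x_pos.
- by rewrite e1_formulaE //; apply: e1x_pos.
by rewrite e2_formulaE //; apply: e2x_pos.
Qed.

Lemma efun_ex c (x : 'rV[C]_6) : pos6 x -> 1 < c ->
  [/\ efun i0 c x = e0x c x, efun i1 c x = e1x c x & efun i2 c x = e2x c x].
Proof.
move=> px c1; have c0 := lt_trans ltr01 c1; have [-> -> ->] := efunE.
by rewrite e0_formulaE // e1_formulaE // e2_formulaE.
Qed.

Lemma efun1 i : pgen (fun x => efun i 1 x = x).
Proof.
have p1 := @PF1 R 6; have id6 := @PFmap_id6 R; have [e0 e1 e2] := efunE.
case: (I3_cases i) => ->; rewrite ?e0 ?e1 ?e2.
- by apply: PFmap_eq_pos6; [apply: PFmap_e0 | | apply: e0_formula1].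
- by apply: PFmap_eq_pos6; [apply: PFmap_e1 | | apply: e1_formula1].
by apply: PFmap_eq_pos6; [apply: PFmap_e2 | | apply: e2_formula1].
Qed.

Lemma gt1_head n (z : 'rV[C]_(1 + n)) : gt1 z -> 1 < lsubmx z 0 0.
Proof. by move=> z1; rewrite mxE. Qed.

Lemma gt1_tail n (z : 'rV[C]_(1 + n)) : gt1 z -> gt1 (rsubmx z).
Proof. by move=> z1 j; rewrite mxE. Qed.

Lemma pgen1_pos6 (f g : C -> 'rV[C]_6 -> C) :
  PF (uncurry_Gm f) -> PF (uncurry_Gm g) ->
  (forall c x, pos6 x -> 1 < c -> f c x = g c x) ->
  pgen1 (fun c x => f c x = g c x).
Proof.
move=> pf pg fg; apply: PF_eq_gt1 => // z z1.
by apply: fg; [apply/gt1_pos6/gt1_tail | apply: gt1_head].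
Qed.

Lemma pgen1_map_pos6 (f g : C -> 'rV[C]_6 -> 'rV[C]_6) :
  PFmap (uncurry_Gm f) -> PFmap (uncurry_Gm g) ->
  (forall c x, pos6 x -> 1 < c -> f c x = g c x) ->
  pgen1 (fun c x => f c x = g c x).
Proof.
move=> pf pg fg; apply: PFmap_eq_gt1 => // z z1.
by apply: fg; [apply/gt1_pos6/gt1_tail | apply: gt1_head].
Qed.

Lemma pgen2_pos6 (f g : C -> C -> 'rV[C]_6 -> 'rV[C]_6) :
  PFmap (uncurry_Gm (fun c => uncurry_Gm (f c))) ->
  PFmap (uncurry_Gm (fun c => uncurry_Gm (g c))) ->
  (forall c d x, pos6 x -> 1 < c -> 1 < d -> f c d x = g c d x) ->
  pgen2 (fun c d x => f c d x = g c d x).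
Proof.
move=> pf pg fg; apply: PFmap_eq_gt1 => // z z1.
have z2 := gt1_tail z1.
by apply: fg; [apply/gt1_pos6/gt1_tail | apply: gt1_head | apply: gt1_head].
Qed.

Ltac by_pos6 :=
  have p1 := @PF_head R (1 + 6);
  have p2 := @PF_head2 R 6; have p3 := @PFmap_tail2 R 6;
  apply: pgen2_pos6; rewrite /uncurry_Gm;
    [do ?[apply: (PFmap_act (PFmap_efun _))]; do ?[apply: PFM | apply: PFX] => //
    |do ?[apply: (PFmap_act (PFmap_efun _))]; do ?[apply: PFM | apply: PFX] => //
    |].

Lemma efunM i :
  pgen2 (fun c1 c2 x => efun i c1 (efun i c2 x) = efun i (c1 * c2) x).
Proof.
by_pos6 => c d x px c1 d1; have cd1 : 1 < c * d by rewrite mulr_egt1.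
have px' := efun_pos i px d1.
have [h0 h1 h2] := efun_ex px d1; have [k0 k1 k2] := efun_ex px cd1.
have [l0 l1 l2] := efun_ex px' c1.
case: (I3_cases i) px' l0 l1 l2 => -> px' l0 l1 l2.
- by rewrite k0 -(e0xM px c1 d1) -h0; apply: l0.
- by rewrite k1 -(e1xM px c1 d1) -h1; apply: l1.
by rewrite k2 -(e2xM px c1 d1) -h2; apply: l2.
Qed.

Lemma efun_comm02 : pgen2 (fun c1 c2 x =>
  efun i0 c1 (efun i2 c2 x) = efun i2 c2 (efun i0 c1 x)).
Proof.
by_pos6 => c d x px c1 d1.
have [k0 _ k2] := efun_ex px c1; have [l0 _ l2] := efun_ex px d1.
have pc := efun_pos i0 px c1; have pd := efun_pos i2 px d1.
have [_ _ ->] := efun_ex pc d1; have [-> _ _] := efun_ex pd c1.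
rewrite k0 l2; exact: e0x_e2x_comm.
Qed.

Lemma efun_braid10 : pgen2 (fun c1 c2 x =>
  efun i1 c1 (efun i0 (c1 * c2) (efun i1 c2 x))
  = efun i0 c2 (efun i1 (c1 * c2) (efun i0 c1 x))).
Proof.
by_pos6 => c d x px c1 d1; have cd1 : 1 < c * d by rewrite mulr_egt1.
have q1 := efun_pos i1 px d1; have q2 := efun_pos i0 q1 cd1.
have r1 := efun_pos i0 px c1; have r2 := efun_pos i1 r1 cd1.
have [_ -> _] := efun_ex q2 c1; have [-> _ _] := efun_ex q1 cd1.
have [_ -> _] := efun_ex px d1.
have [-> _ _] := efun_ex r2 d1; have [_ -> _] := efun_ex r1 cd1.
by have [-> _ _] := efun_ex px c1; apply: e1x_e0x_braid.
Qed.

Lemma efun_braid12 : pgen2 (fun c1 c2 x =>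
  efun i1 c1 (efun i2 (c1 ^+ 3 * c2) (efun i1 (c1 ^+ 2 * c2)
    (efun i2 (c1 ^+ 3 * c2 ^+ 2) (efun i1 (c1 * c2) (efun i2 c2 x)))))
  = efun i2 c2 (efun i1 (c1 * c2) (efun i2 (c1 ^+ 3 * c2 ^+ 2)
    (efun i1 (c1 ^+ 2 * c2) (efun i2 (c1 ^+ 3 * c2) (efun i1 c1 x)))))).
Proof.
by_pos6 => s t x px s1 t1.
have [s2 s3 t2] : [/\ 1 < s ^+ 2, 1 < s ^+ 3 & 1 < t ^+ 2].
  by split; rewrite exprn_egt1.
have [h1 h2 h3 h4] : [/\ 1 < s * t, 1 < s ^+ 2 * t, 1 < s ^+ 3 * t
  & 1 < s ^+ 3 * t ^+ 2] by split; rewrite mulr_egt1.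
have E1 z c : pos6 z -> 1 < c -> efun i1 c z = e1x c z.
  by move=> pz c1; have [] := efun_ex pz c1.
have E2 z c : pos6 z -> 1 < c -> efun i2 c z = e2x c z.
  by move=> pz c1; have [] := efun_ex pz c1.
have l1 := e2x_pos px t1; have l2 := e1x_pos l1 h1; have l3 := e2x_pos l2 h4.
have l4 := e1x_pos l3 h2; have l5 := e2x_pos l4 h3.
have r1 := e1x_pos px s1; have r2 := e2x_pos r1 h3; have r3 := e1x_pos r2 h2.
have r4 := e2x_pos r3 h4; have r5 := e1x_pos r4 h1.
rewrite (E2 _ _ px t1) (E1 _ _ l1 h1) (E2 _ _ l2 h4) (E1 _ _ l3 h2).
rewrite (E2 _ _ l4 h3) (E1 _ _ l5 s1).
rewrite (E1 _ _ px s1) (E2 _ _ r1 h3) (E1 _ _ r2 h2) (E2 _ _ r3 h4).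
rewrite (E1 _ _ r4 h1) (E2 _ _ r5 t1).
exact: e1x_e2x_braid.
Qed.

Lemma swap12 (P : C -> C -> 'rV[C]_6 -> Prop) :
  pgen2 P -> pgen2 (fun c d x => P d c x).
Proof.
exact: (pgen2_at (@PF_head2 R 6) (@PF_head R (1 + 6)) (@PFmap_tail2 R 6)).
Qed.

Lemma efun_verma : pverma cartan efun.
Proof.
have [[c00 c01 c02] [[c10 c11 c12] [c20 c21 c22]]] := cartanE.
move=> i j; case: (I3_cases i) => ->; case: (I3_cases j) => ->;
  rewrite ?c00 ?c01 ?c02 ?c10 ?c11 ?c12 ?c20 ?c21 ?c22; split=> // _ _.
- apply: pgen_mono (swap12 efun_braid10) => z; rewrite /uncurry_Gm.
  by rewrite mulrC => <-; rewrite mulrC.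
- exact: efun_comm02.
- exact: efun_braid10.
- exact: efun_braid12.
apply: pgen_mono (swap12 efun_comm02) => z; rewrite /uncurry_Gm.
by move=> ->.
Qed.

Lemma gamfun_efun i j :
  pgen1 (fun c x => gamfun j (efun i c x) = c ^ cartan i j * gamfun j x).
Proof.
have h := @PF_head R 6; have t := @PFmap_tail R 6.
apply: pgen1_pos6; first exact: PF_gamfun (PFmap_efun i).
  by apply: PFM; [apply: PFXz | apply: PF_gamfun].
move=> c x px c1; have px' := efun_pos i px c1.
have [g0 g1 g2] := gamfunE; have [e0 e1 e2] := efun_ex px c1.
have [[x00 x01 x02] [[x10 x11 x12] [x20 x21 x22]]] := exp_cartan c.
have [w0 w1 w2] := e0x_weights px c1; have [u0 u1 u2] := e1x_weights px c1.
have [v0 v1 v2] := e2x_weights px c1.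
case: (I3_cases i) px' => -> px'; case: (I3_cases j) => ->;
  rewrite ?g0 ?g1 ?g2 ?gam0_formulaE ?gam1_formulaE ?gam2_formulaE //
  ?(x00, x01, x02, x10, x11, x12, x20, x21, x22) ?e0 ?e1 ?e2
  ?(w0, w1, w2, u0, u1, u2, v0, v1, v2) ?mul1r //.
Qed.

Lemma epsfun_efun i :
  pgen1 (fun c x => epsfun i (efun i c x) = c^-1 * epsfun i x).
Proof.
have h := @PF_head R 6; have t := @PFmap_tail R 6.
apply: pgen1_pos6; first exact: PF_epsfun (PFmap_efun i).
  by apply: PFM; [apply: PFV | apply: PF_epsfun].
move=> c x px c1; have px' := efun_pos i px c1.
have [g0 g1 g2] := epsfunE; have [e0 e1 e2] := efun_ex px c1.
case: (I3_cases i) px' => -> px'; rewrite ?g0 ?g1 ?g2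
  ?eps0_formulaE ?eps1_formulaE ?eps2_formulaE // ?e0 ?e1 ?e2.
- exact: ep0_e0x.
- exact: ep1_e1x.
exact: ep2_e2x.
Qed.

End Main.

(** * The map sigma and the crystal it induces *)

Section Sigma.
Variable R : realType.
Local Notation C := R[i].
Local Notation T6 := (@torus R 6).

Lemma PF_prop12 : pgen (fun x : 'rV[C]_6 => prop12 (yscale x) x (yhat x)).
Proof.
have id6 := @PFmap_id6 R; have py := PFmap_yhat id6.
have pa := PF_yscale id6.
have rq := PF_qA id6; have rs := PF_sA id6; have rA1 := PF_A1 id6.
have rA2 : PF (@A2 C) by rewrite /A2 /pA; pf.
have rA3 : PF (@A3 C) by rewrite /A3; pf.
have rA3b : PF (@A3b C) by rewrite /A3b /pA; pf.
have rB1 := PF_B1 py; have rsB := PF_sB py.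
have rB2 : PF (fun x : 'rV[C]_6 => B2 (yhat x)) by rewrite /B2; pf.
have rB3 : PF (fun x : 'rV[C]_6 => B3 (yhat x)) by rewrite /B3; pf.
have rB3b : PF (fun x : 'rV[C]_6 => B3b (yhat x)) by rewrite /B3b; pf.
have rB2b := PF_B2b py; have rB1b := PF_B1b py.
have h1 := PF_eq_pos6 rB1 (PFM pa rA1)
  (fun x px => let: conj (And4 e _ _ _) _ := yhat_prop px in e).
have h2 := PF_eq_pos6 rB2 (PFM pa rA2)
  (fun x px => let: conj (And4 _ e _ _) _ := yhat_prop px in e).
have h3 := PF_eq_pos6 rB3 (PFM pa rA3)
  (fun x px => let: conj (And4 _ _ e _) _ := yhat_prop px in e).
have h4 := PF_eq_pos6 rsB (PFM pa rs)
  (fun x px => let: conj (And4 _ _ _ e) _ := yhat_prop px in e).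
have h5 := PF_eq_pos6 (py _) (PFM pa (id6 _))
  (fun x px => let: conj _ (And4 e _ _ _) := yhat_prop px in e).
have h6 := PF_eq_pos6 rB3b (PFM pa rA3b)
  (fun x px => let: conj _ (And4 _ e _ _) := yhat_prop px in e).
have h7 := PF_eq_pos6 rB2b (PFM pa (PFM (id6 _) (id6 _)))
  (fun x px => let: conj _ (And4 _ _ e _) := yhat_prop px in e).
have h8 := PF_eq_pos6 rB1b (PFM pa (PFX 2 (id6 _)))
  (fun x px => let: conj _ (And4 _ _ _ e) := yhat_prop px in e).
have := pgen_and (pgen_and (pgen_and h1 h2) (pgen_and h3 h4))
  (pgen_and (pgen_and h5 h6) (pgen_and h7 h8)).
by apply: pgen_mono => x [[[? ?] [? ?]] [[? ?] [? ?]]].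
Qed.

Lemma prop12_scale a (x y : 'rV[C]_6) : torus x -> torus y ->
  (V2 y = a *: V1 x <-> prop12 a x y).
Proof.
move=> tx ty; rewrite V1E // V2E // scale_row8; split.
  move=> /row8_inj[[e1 e2 e3 e0] [ee e3b e2b e1b]]; split; split=> //.
  have -> : sB y = B0 y - co y 0 / 2 by rewrite /B0; field.
  by rewrite e0 ee /A0; field.
move=> [[e1 e2 e3 eS] [ee e3b e2b e1b]].
by congr row8 => //; rewrite /B0 /A0 eS ee; field.
Qed.

Lemma V2_yhat : pgen (fun x : 'rV[C]_6 =>
  [/\ torus x, torus (yhat x), yscale x != 0 & V2 (yhat x) = yscale x *: V1 x]).
Proof.
have id6 := @PFmap_id6 R.
have ty := pgen_comp (PFmap_yhat id6) (pgen_torus R 6).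
have := pgen_and (pgen_and (pgen_torus R 6) ty)
  (pgen_and (PF_neq0 (PF_yscale id6)) PF_prop12).
by apply: pgen_mono => x [[tx tyx] [a0 px]]; split=> //; apply/prop12_scale.
Qed.

(** At a generic point the solution of V_2(y) = a V_1(x) is unique, so any
   rational solution is [yhat]. *)
Lemma sigma_unique (y : 'rV[C]_6 -> 'rV[C]_6) a :
  generic T6 (fun x => torus (y x)) ->
  generic T6 (fun x => V2 (y x) = a x *: V1 x) ->
  generic T6 (fun x => y x = yhat x).
Proof.
move=> gy gV; have tI := @torus_irr R 6; have id6 := @PFmap_id6 R.
have n1 := pgen_generic (pgen_and (PF_neq0 (PF_A1 id6)) (PF_neq0 (PF_sA id6))).
apply: generic_mono (generic_and tI (generic_and tI gy gV)
  (generic_and tI n1 (pgen_generic V2_yhat))) => // x _.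
move=> [[ty Vy] [[A0 s0] [tx tyh ya0 Vyh]]].
have P := (prop12_scale (a x) tx ty).1 Vy.
have P' := (prop12_scale (yscale x) tx tyh).1 Vyh.
have a0 : a x != 0.
  have := torus_co 0 ty; have [_ [-> _ _ _]] := P.
  by rewrite mulf_eq0 negb_or => /andP[].
by have [] := prop12_inj (torus_nz6 tx) (torus_nz6 ty) (torus_nz6 tyh) A0 s0
  a0 ya0 P P'.
Qed.

(** A rational inverse of sigma is determined by sigma, and in coordinates sigma
   is [yhat], which [xhat] inverts. *)
Lemma sigma_coordinates sigma sigma' : is_sigma (R := R) sigma sigma' ->
  generic T6 (fun x => sigma (V1 x) = V2 (yhat x)) /\
  generic T6 (fun y => sigma' (V2 y) = V1 (xhat y)).
Proof.
move=> [[y [a [[_ gy] _ gV gs]]] [_ _ gs' _]].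
have tI := @torus_irr R 6; have id6 := @PFmap_id6 R.
have [pV1 _] := calV1_param_variety R.
have gs1 : generic T6 (fun x => sigma (V1 x) = V2 (yhat x)).
  by apply: generic_weaken (generic_and tI gs (sigma_unique gy gV)) => x [-> ->].
split; first exact: gs1.
move/(param_generic pV1): gs' => gs'.
have g : generic T6 (fun x => sigma' (V2 (yhat x)) = V1 x).
  by apply: generic_weaken (generic_and tI gs1 gs') => x [<-].
have px := PFmap_xhat id6; have py := PFmap_yhat id6.
have := generic_pull px py (@xhat_yhat R) g.
move=> g'; apply: generic_mono (generic_and tI g' (pgen_generic (@yhat_xhat R))) => //.
by move=> z _ [h1 h2]; rewrite -h1 h2.
Qed.

Lemma PFmap_nat_act1 n c (F : 'rV[C]_n -> 'rV[C]_6) : PF c -> PFmap F ->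
  PFmap (fun t => nat_act pos1 i1 (c t) (F t)).
Proof.
move=> pc pF j; apply: (PF_eq (fun t => congr1 (fun w : 'rV[C]_6 => w 0 j)
  (nat_act1E (F t) (c t)))).
move: j; rewrite /t1_1 /t1_3 /t1_5 /=; apply: PFmap_vec6; pf.
Qed.

Lemma PFmap_nat_act2 n c (F : 'rV[C]_n -> 'rV[C]_6) : PF c -> PFmap F ->
  PFmap (fun t => nat_act pos1 i2 (c t) (F t)).
Proof.
move=> pc pF j; apply: (PF_eq (fun t => congr1 (fun w : 'rV[C]_6 => w 0 j)
  (nat_act2E (F t) (c t)))).
move: j; rewrite /t2_2 /t2_4 /=; apply: PFmap_vec6; pf.
Qed.

Lemma PFmap_nat_act0 n c (F : 'rV[C]_n -> 'rV[C]_6) : PF c -> PFmap F ->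
  PFmap (fun t => nat_act pos2 i0 (c t) (F t)).
Proof.
move=> pc pF j; apply: (PF_eq (fun t => congr1 (fun w : 'rV[C]_6 => w 0 j)
  (nat_act0E (F t) (c t)))).
move: j; rewrite /=; apply: PFmap_vec6; pf.
Qed.

Lemma nat_formulas : [/\
  pgen1 (fun c (x : 'rV[C]_6) => nat_act pos1 i1 c x = e1_formula c x),
  pgen1 (fun c (x : 'rV[C]_6) => nat_act pos1 i2 c x = e2_formula c x) &
  pgen1 (fun c (y : 'rV[C]_6) => nat_act pos2 i0 c y = e0y c y)].
Proof.
have h := @PF_head R 6; have t := @PFmap_tail R 6.
have c0 (c : C) : 1 < c -> 0 < c by apply: lt_trans.
split; apply: pgen1_map_pos6.
- exact: PFmap_nat_act1.
- exact: PFmap_e1.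
- by move=> c x px /c0; apply: nat_act1_pos.
- exact: PFmap_nat_act2.
- exact: PFmap_e2.
- by move=> c x px /c0; apply: nat_act2_pos.
- exact: PFmap_nat_act0.
- exact: PFmap_e0y.
by move=> c x px /c0; apply: nat_act0_pos.
Qed.

Lemma nat_eps_formulas : [/\
  pgen (fun x : 'rV[C]_6 => nat_eps pos1 i1 x = eps1_formula x),
  pgen (fun x : 'rV[C]_6 => nat_eps pos1 i2 x = eps2_formula x) &
  pgen (fun x : 'rV[C]_6 => nat_eps pos2 i0 (yhat x) = eps0_formula x)].
Proof.
have id6 := @PFmap_id6 R; have py := PFmap_yhat id6.
split; apply: PF_eq_pos6.
- have h : PF (fun x : 'rV[C]_6 => t1_1 x + (t1_3 x + t1_5 x)).
    by rewrite /t1_1 /t1_3 /t1_5; pf.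
  by apply: PF_eq h => x; have [] := nat_epsE x.
- exact: PF_eps1.
- by move=> x /nat_eps_pos[].
- have h : PF (fun x : 'rV[C]_6 => t2_2 x + t2_4 x) by rewrite /t2_2 /t2_4; pf.
  by apply: PF_eq h => x; have [] := nat_epsE x.
- exact: PF_eps2.
- by move=> x /nat_eps_pos[].
- have h : PF (fun x : 'rV[C]_6 => xc (yhat x) 1 * xc (yhat x) 3 / xc (yhat x) 0).
    by pf.
  by apply: PF_eq h => x; have [] := nat_epsE (yhat x).
- exact: PF_eps0.
move=> x px; have [_ _ ->] := nat_eps_pos (yhat_pos px).
have [[-> _ _ _] [-> _ _ _]] := yhat_prop px.
rewrite eps0_formulaE // /ep0.
have := yscale_gt0 px; have : 0 < co x 0 by apply: px.
by move=> ? ?; field; neq0.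
Qed.

Lemma nat_gam_formulas : [/\
  pgen (fun x : 'rV[C]_6 => nat_gam i1 x = gam1_formula x),
  pgen (fun x : 'rV[C]_6 => nat_gam i2 x = gam2_formula x) &
  pgen (fun x : 'rV[C]_6 => nat_gam i0 (yhat x) = gam0_formula x)].
Proof.
have id6 := @PFmap_id6 R; have py := PFmap_yhat id6.
split.
- by apply: pgen_mono (pgen_torus R 6) => x /nat_gamE[].
- by apply: pgen_mono (pgen_torus R 6) => x /nat_gamE[].
have h : pgen (fun x : 'rV[C]_6 => gam0_formula (yhat x) = gam0_formula x).
  apply: PF_eq_pos6 => [||x px]; first exact: PF_gam0.
    exact: PF_gam0.
  exact: ga_yhat.
apply: pgen_mono (pgen_and h (pgen_comp py (pgen_torus R 6))) => x [<-].
by case/nat_gamE.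
Qed.

Lemma e0_formula_pgen :
  pgen1 (fun c (x : 'rV[C]_6) => xhat (e0y c (yhat x)) = e0_formula c x).
Proof.
have h := @PF_head R 6; have t := @PFmap_tail R 6.
apply: pgen1_map_pos6; first exact: PFmap_xhat (PFmap_e0y h (PFmap_yhat t)).
  exact: PFmap_e0.
by move=> c x px c1; rewrite e0_formulaE // (lt_trans ltr01).
Qed.

(** For i = 1, 2 this compares two expansions.  For i = 0, each of the maps that
   make up the action is known only generically on its source, and is evaluated
   at a point produced by the previous ones; every such substitution is a
   subtraction-free map with a right inverse. *)
Lemma chi_explicit (chi : crystal_data R 3 8) : is_chi chi -> forall i,
  has_explicit_form chi i (@efun R i) (@gamfun R i) (@epsfun R i).
Proof.
move=> [sigma [sigma' [chibar [ss [n1 n2] [n0 _] [act0 gam0 eps0]]]]].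
have [pV1 _] := calV1_param_variety R; have tI := @torus_irr R 6.
have id6 := @PFmap_id6 R; have py := PFmap_yhat id6; have px := PFmap_xhat id6.
have [gs gs'] := sigma_coordinates ss.
have [a1 a2 a0] := nat_formulas; have [p1 p2 p0] := nat_eps_formulas.
have [q1 q2 q0] := nat_gam_formulas.
have [e0 e1 e2] := efunE R; have [f0 f1 f2] := gamfunE R.
have [h0 h1 h2] := epsfunE R.
move=> i; case: (I3_cases i) => ->;
  rewrite ?e0 ?e1 ?e2 ?f0 ?f1 ?f2 ?h0 ?h1 ?h2; first last.
- case: n2 => n2 g2 s2; split.
  + have := generic1_and n2 (pgen_generic1 a2).
    by apply: generic1_mono => c x [-> ->].
  + by apply: generic_weaken (generic_and tI g2 (pgen_generic q2)) => x [-> ->].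
  by apply: generic_weaken (generic_and tI s2 (pgen_generic p2)) => x [-> ->].
- case: n1 => n1 g1 s1; split.
  + have := generic1_and n1 (pgen_generic1 a1).
    by apply: generic1_mono => c x [-> ->].
  + by apply: generic_weaken (generic_and tI g1 (pgen_generic q1)) => x [-> ->].
  by apply: generic_weaken (generic_and tI s1 (pgen_generic p1)) => x [-> ->].
case: n0 => n0 g0 s0.
move/(param_generic1 _ pV1): act0 => act0.
move/(param_generic pV1): gam0 => gam0.
move/(param_generic pV1): eps0 => eps0.
split.
- have hd := @PF_head R 6; have tl := @PFmap_tail R 6.
  pose F (z : 'rV[C]_(1 + 6)) : 'rV[C]_(1 + 6) :=
    row_mx (lsubmx z 0 0)%:M (yhat (rsubmx z)).
  pose G (z : 'rV[C]_(1 + 6)) : 'rV[C]_(1 + 6) :=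
    row_mx (lsubmx z 0 0)%:M (xhat (rsubmx z)).
  have pF : PFmap F := PFmap_row hd (PFmap_yhat tl).
  have pG : PFmap G := PFmap_row hd (PFmap_xhat tl).
  have FG : pgen (fun z => F (G z) = z).
    apply: pgen_mono (pgen_comp tl (@yhat_xhat R)) => z e.
    rewrite /F /G row_mxKl row_mxKr e mxE eqxx mulr1n -[RHS]hsubmxK.
    by congr row_mx; apply/matrixP => a b; rewrite !ord1 !mxE eqxx mulr1n.
  have /generic1_torus b0 := n0.
  have k0 : generic1 T6 (fun c x =>
      act chibar i0 c (V2 (yhat x)) = V2 (nat_act pos2 i0 c (yhat x))).
    have b1 := generic_pull pF pG FG b0.
    apply/generic1_torus; apply: generic_mono b1 => [z|z _]; first exact: iff_refl.
    by rewrite [X in X -> _]uncurry_row.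
  have k1 : generic1 T6 (fun c x => nat_act pos2 i0 c (yhat x) = e0y c (yhat x)).
    exact: pgen_generic1 (pgen1_at hd (PFmap_yhat tl) a0).
  have pe : PFmap (uncurry_Gm (fun c (x : 'rV[C]_6) => e0y c (yhat x))).
    exact: (PFmap_e0y hd (PFmap_yhat tl)).
  have pH : PFmap (fun y : 'rV[C]_6 => row_mx 1%:M (xhat y)).
    exact: PFmap_row (PF1 R 6) px.
  (* at c = 1 the map [e0y c] is the identity, which gives a right inverse *)
  have k2 : generic1 T6 (fun c x =>
      sigma' (V2 (e0y c (yhat x))) = V1 (xhat (e0y c (yhat x)))).
    apply/generic1_torus; apply: (generic_pull pe pH _ gs').
    apply: pgen_mono (@yhat_xhat R) => y e.
    by rewrite uncurry_row e /e0y mul1r -vec6_co.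
  have := generic1_and (generic1_and k0 k1)
    (generic1_and k2 (pgen_generic1 e0_formula_pgen)).
  move/(generic1_and (generic1_tail gs))/(generic1_and act0).
  apply: generic1_mono => c x [-> [-> [[-> ->] [-> ->]]]] //.
- have := generic_pull py px (@yhat_xhat R) g0.
  move/(generic_and tI gs)/(generic_and tI gam0).
  move/(generic_and tI (pgen_generic q0)).
  by apply: generic_weaken => x [<- [-> [-> ->]]].
have := generic_pull py px (@yhat_xhat R) s0.
move/(generic_and tI gs)/(generic_and tI eps0).
move/(generic_and tI (pgen_generic p0)).
by apply: generic_weaken => x [<- [-> [-> ->]]].
Qed.

(** Rational maps are total functions with arbitrary values off a dense set, so
   those of the quadruple are obtained from coordinate formulas by rational
   inverses [th1], [th2] of the two parametrizations. *)
Lemma chi_exists : exists chi : crystal_data R 3 8, is_chi chi.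
Proof.
have [pV1 _] := calV1_param_variety R; have pV2 := calV2_param R.
have tI := @torus_irr R 6; have id6 := @PFmap_id6 R.
have py := PFmap_yhat id6; have px := PFmap_xhat id6.
have [th1 [_ _ gt1 _]] := param_birational pV1.
have [th2 [_ _ gt2 _]] := param_birational pV2.
pose sigma w := V2 (yhat (th1 w)); pose sigma' w := V1 (xhat (th2 w)).
pose chibar : crystal_data R 3 8 := CrystalData
  (fun i c w => V2 (nat_act pos2 i c (th2 w)))
  (fun i w => nat_gam i (th2 w)) (fun i w => nat_eps pos2 i (th2 w)).
pose chi : crystal_data R 3 8 := CrystalData
  (fun i c w => if i == i0 then sigma' (act chibar i0 c (sigma w))
                else V1 (nat_act pos1 i c (th1 w)))
  (fun i w => if i == i0 then gam chibar i0 (sigma w) else nat_gam i (th1 w))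
  (fun i w => if i == i0 then eps chibar i0 (sigma w)
              else nat_eps pos1 i (th1 w)).
have [[n01 n02 n12] [n10 n20 n21]] := i_neq.
have nat1 i : (i == i0) = false -> is_natural (@V1 R) pos1 chi i.
  move=> ni; split; rewrite /chi /= ni.
  - by apply: generic1_mono (generic1_tail gt1) => c x ->.
  - by apply: generic_weaken gt1 => x ->.
  by apply: generic_weaken gt1 => x ->.
have nat2 i : is_natural (@V2 R) pos2 chibar i.
  split; rewrite /chibar /=.
  - by apply: generic1_mono (generic1_tail gt2) => c x ->.
  - by apply: generic_weaken gt2 => x ->.
  by apply: generic_weaken gt2 => x ->.
exists chi, sigma, sigma', chibar; split.
- split; last first.
    exact: param_birational_conj pV1 pV2 py px (@xhat_yhat R) (@yhat_xhat R)
      gt1 gt2.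
  exists (@yhat C), (@yscale C); split.
  + split; first by move=> j; apply: PF_rational.
    by apply: pgen_generic; apply: pgen_comp py (pgen_torus R 6).
  + exact: PF_rational (PF_yscale id6).
  + by apply: pgen_generic; apply: pgen_mono V2_yhat => x [].
  by apply: generic_weaken gt1 => x e; rewrite /sigma e.
- by split; apply: nat1.
- by split; apply: nat2.
split.
- by apply/(param_generic1 _ pV1); apply: pgen_generic1; apply: pgenT => z;
    rewrite /uncurry_Gm /= eqxx.
- by apply/(param_generic pV1); apply: generic_torus_all => x _; rewrite /= eqxx.
by apply/(param_generic pV1); apply: generic_torus_all => x _; rewrite /= eqxx.
Qed.

End Sigma.

Theorem theorem4p3 (R : realType) :
  (exists chi : crystal_data R 3 8, is_chi chi) /\
  forall chi : crystal_data R 3 8, is_chi chi ->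
    [/\ geometric_crystal cartan (@calV1 R) chi,
        positive_structure (@calV1 R) chi (@V1 R),
        has_explicit_form chi i1
          (@e1_formula R) (@gam1_formula R) (@eps1_formula R),
        has_explicit_form chi i2
          (@e2_formula R) (@gam2_formula R) (@eps2_formula R) &
        has_explicit_form chi i0
          (@e0_formula R) (@gam0_formula R) (@eps0_formula R)].
Proof.
split=> [|chi /chi_explicit ex]; first exact: chi_exists.
have [pV1 vV1] := calV1_param_variety R; have id6 := @PFmap_id6 R.
have [e0 e1 e2] := efunE R; have [f0 f1 f2] := gamfunE R.
have [h0 h1 h2] := epsfunE R.
have actE i : generic1 (@torus R 6)
    (fun c x => act chi i c (V1 x) = V1 (efun i c x)) by case: (ex i).
have gamE i : generic (@torus R 6)
    (fun x => gam chi i (V1 x) = gamfun i x) by case: (ex i).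
have epsE i : generic (@torus R 6)
    (fun x => eps chi i (V1 x) = epsfun i x) by case: (ex i).
have pg i : PF (@gamfun R i) by apply: PF_gamfun.
have pe i : PF (@epsfun R i) by apply: PF_epsfun.
split.
- exact: (param_crystal pV1 (@PFmap_efun R) pg pe actE gamE epsE (@efun1 R)
    (@efunM R) (@efun_verma R) (@gamfun_efun R) (@epsfun_efun R) vV1).
- exact: (param_positive_structure pV1 (@PFmap_efun R) pg pe actE gamE epsE
    (@efun1 R)).
- by rewrite -e1 -f1 -h1.
- by rewrite -e2 -f2 -h2.
by rewrite -e0 -f0 -h0.
Qed.
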